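(* For every $\phi\in\mathbb R$, the subgroup $K_\phi$ is a coisotropic subgroup of $(U,r)$, that is, $$\delta_r(\mathfrak k_\phi)\subset\mathfrak k_\phi\otimes\mathfrak u+\mathfrak u\otimes\mathfrak k_\phi.$$ It is a Poisson–Lie subgroup if and only if $\phi$ is an odd integer.
   Context: Let $\mathfrak u$ be a compact simple Lie algebra, $\mathfrak g$ its complexification, $U\subset G$ the connected simply connected Lie groups. $(\cdot,\cdot)_{\mathfrak g}$ is the invariant symmetric bilinear form whose dual form on $\mathfrak h^*$, for any Cartan subalgebra $\mathfrak h$, satisfies $(\alpha,\alpha)=2$ for short roots. $*$ is the antilinear involution on $\mathfrak g$ with $X^*=-X$ for $X\in\mathfrak u$. $\nu$ is an involutive automorphism of $\mathfrak u$ (extended to $\mathfrak g$, $U$, $G$) such that $\mathfrak u^\nu<\mathfrak u$ is an irreducible Hermitian symmetric pair, i.e. $\mathfrak z(\mathfrak u^\nu)$ is one-dimensional; $\mathfrak m_\nu$ is the $(-1)$-eigenspace of $\nu$ in $\mathfrak u$, and $Z_\nu\in\mathfrak z(\mathfrak u^\nu)$ satisfies $(\mathrm{ad}Z_\nu)^2=-1$ on $\mathfrak m_\nu$. $\mathfrak t$ is a Cartan subalgebra of $\mathfrak u$ containing $\mathfrak z(\mathfrak u^\nu)$ (so $\mathfrak t\subset\mathfrak u^\nu$), $\mathfrak h=\mathfrak t^{\mathbb C}$. Roots are ordered lexicographically with respect to an ordered basis of $i\mathfrak t$ whose first element is $-iZ_\nu$; positivity of roots refers to this order. A root $\alpha$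 is compact if $\mathfrak g_\alpha\subset\mathfrak g^\nu$ and noncompact otherwise. $H_\alpha\in\mathfrak h$ is the coroot element. For $\alpha>0$ choose $X_\alpha\in\mathfrak g_\alpha$ with $(X_\alpha,X_\alpha^* )_{\mathfrak g}=2/(\alpha,\alpha)$, and put $X_{-\alpha}=X_\alpha^*$. Put $$r=i\sum_{\alpha>0}\frac{(\alpha,\alpha)}2(X_{-\alpha}\otimes X_\alpha-X_\alpha\otimes X_{-\alpha})\in\mathfrak u\otimes\mathfrak u,\qquad\delta_r(X)=[r,X\otimes1+1\otimes X];$$ $\delta_r$ makes $\mathfrak u$ a Lie bialgebra and $U$ a Poisson–Lie group $(U,r)$ (Sklyanin bracket). A closed connected subgroup with Lie algebra $\mathfrak l$ is a Poisson–Lie subgroup iff $\delta_r(\mathfrak l)\subset\mathfrak l\otimes\mathfrak l$. Cascade: $\gamma_1$ is the largest root; given $\gamma_1,\dots,\gamma_i$, let $\mathfrak g^{(i)}$ be the centralizer of $\{H_{\gamma_1},\dots,H_{\gamma_i}\}$ in $\mathfrak g$; if $\mathfrak g^{(i)}\not\subset\mathfrak g^\nu$, let $\gamma_{i+1}$ be the largest root with $X_{\gamma_{i+1}}\in\mathfrak g^{(i)}$; stop at $s$ with $\mathfrak g^{(s)}\subset\mathfrak g^\nu$. For $\phi\in\mathbb R$ put $$g_\phi=\exp\Bigl(\frac{\pi i\phi}4\sum_{i=1}^s(X_{-\gamma_i}+X_{\gamma_i})\Bigr)\in U,\qquad K_\phi=g_{\phi-1}U^\nu g_{1-\phi},\qquad\mathfrak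 k_\phi=(\mathrm{Ad}\,g_{\phi-1})(\mathfrak u^\nu).$$ *)

(* Defs.v *)
From HB Require Import structures.
From mathcomp Require Import all_boot all_order all_algebra.
From mathcomp Require Import complex.
From mathcomp Require Import all_classical all_reals all_analysis.

Set Implicit Arguments.
Unset Strict Implicit.
Unset Printing Implicit Defensive.

Import Order.TTheory GRing.Theory Num.Theory.
Import numFieldNormedType.Exports.
Import passmx.

Local Open Scope classical_set_scope.
Local Open Scope ring_scope.
Local Open Scope complex_scope.

HB.mixin Record Vector_isLie (K : fieldType) L of Vector K L := {
  lie : L -> L -> L;
  lie_linearl : forall y, linear (lie^~ y);
  lie_linearr : forall x, linear (lie x);
  liexx : forall x, lie x x = 0;
  lie_jacobi : forall x y z,
    lie x (lie y z) + lie y (lie z x) + lie z (lie x y) = 0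
}.

#[short(type="lieAlgType")]
HB.structure Definition LieAlgebra (K : fieldType) :=
  { L of Vector K L & Vector_isLie K L }.

Section LieAlgebraTheory.
Variables (K : fieldType) (L : lieAlgType K).
Implicit Types (x y : L) (U V I : {vspace L}).

HB.instance Definition _ x :=
  GRing.isLinear.Build K L L *:%R (lie x) (lie_linearr x).

Lemma lieDl y : {morph lie^~ y : x x' / x + x'}.
Proof. by move=> x x'; rewrite -[x]scale1r lie_linearl !scale1r. Qed.

Lemma lieZl c x y : lie (c *: x) y = c *: lie x y.
Proof.
have lie0 : lie 0 y = 0 by apply: (addrI (lie 0 y)); rewrite -lieDl !addr0.
by rewrite -[c *: x]addr0 lie_linearl lie0 addr0.
Qed.

Lemma lieBl y : {morph lie^~ y : x x' / x - x'}.
Proof. by move=> x x'; rewrite lieDl -[- x']scaleN1r lieZl scaleN1r. Qed.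

Lemma lieC x y : lie x y = - lie y x.
Proof.
apply/eqP; rewrite -addr_eq0; have := liexx (x + y).
by rewrite lieDl !linearD /= !liexx add0r addr0 => ->.
Qed.

Definition ad x : 'End(L) := linfun (lie x).
Definition adr y : 'End(L) := linfun (fun x => lie x y).

Definition killing x y : K :=
  \tr (mxof (vbasis {:L}) (vbasis {:L}) (ad x \o ad y)%VF).

Definition lie_ideal I := forall x y, y \in I -> lie x y \in I.

Definition lie_simple :=
  (exists x y, lie x y != 0) /\
  (forall I, lie_ideal I -> I = 0%VS \/ I = fullv).

Definition lie_prodv U V : {vspace L} :=
  <<[seq lie x y | x <- vbasis U, y <- vbasis V]>>%VS.

Definition lie_nilpotent U := exists n, iter n (lie_prodv U) U = 0%VS.

Definition self_normalizing U :=
  forall x, (forall y, y \in U -> lie x y \in U) -> x \in U.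

Definition cartan_subalgebra U :=
  [/\ (lie_prodv U U <= U)%VS, lie_nilpotent U & self_normalizing U].

Definition lie_center U : {vspace L} :=
  (U :&: \bigcap_(y <- vbasis U) lker (ad y))%VS.

Definition lie_involution (f : 'End(L)) :=
  (forall x, f (f x) = x) /\ (forall x y, f (lie x y) = lie (f x) (f y)).

Definition invariant_form (B : L -> L -> K) :=
  forall x y z, B (lie x y) z = B x (lie y z).

(* The tensor square of L is modelled by square matrices: a matrix T stands   *)
(* for \sum_(i, j) T i j *: (e_i (x) e_j), where e is the standard basis.     *)
Definition tens x y : 'M[K]_(\dim {:L}) :=
  (rVof (vbasis {:L}) x)^T *m rVof (vbasis {:L}) y.

(* T |-> [T, x (x) 1 + 1 (x) x]; see tens_bracketE.                           *)
Definition tens_bracket (T : 'M[K]_(\dim {:L})) x : 'M[K]_(\dim {:L}) :=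
  let M := mxof (vbasis {:L}) (vbasis {:L}) (adr x) in M^T *m T + T *m M.

Lemma rVof_adr x y :
  rVof (vbasis {:L}) (lie y x) =
  rVof (vbasis {:L}) y *m mxof (vbasis {:L}) (vbasis {:L}) (adr x).
Proof.
pose f : {linear L -> L} := HB.pack (fun z => lie z x)
  (GRing.isLinear.Build _ _ _ _ _ (lie_linearl x)).
by rewrite mul_mxof rVofK ?vbasisP // /adr (lfunE f).
Qed.

Lemma tens_bracketE x y z :
  tens_bracket (tens x y) z = tens (lie x z) y + tens x (lie y z).
Proof. by rewrite /tens_bracket /tens !rVof_adr trmx_mul !mulmxA. Qed.

(* The additive span of the x (x) y; for real subspaces A and B of a complex  *)
(* L this is the real span.                                                   *)
Definition tens_span (A B : set L) : set 'M[K]_(\dim {:L}) :=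
  [set T | exists n (x y : 'I_n -> L),
     (forall i, A (x i) /\ B (y i)) /\ T = \sum_i tens (x i) (y i)].

End LieAlgebraTheory.

(* (x, y) stands for x + i y.                                                 *)
Definition cplx (R : rcfType) (V : vectType R) : Type := (V * V)%type.

Section Complexification.
Variables (R : rcfType) (V : vectType R).

HB.instance Definition _ := GRing.Zmodule.copy (cplx V) (V * V)%type.

Definition cplx_scale (c : R[i]) (X : cplx V) : cplx V :=
  (complex.Re c *: X.1 - complex.Im c *: X.2,
   complex.Re c *: X.2 + complex.Im c *: X.1).

Fact cplx_scaleA a b X : cplx_scale a (cplx_scale b X) = cplx_scale (a * b) X.
Proof.
case: a b X => [a1 a2] [b1 b2] [x y]; rewrite /cplx_scale /=.
congr pair; rewrite !scalerDr !scalerDl ?scalerN ?scaleNr !scalerA ?opprD.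
  by rewrite [LHS](AC (2*2) ((1*4)*(2*3))).
by rewrite [LHS](AC (2*2) ((1*4)*(2*3))).
Qed.

Fact cplx_scale1 : left_id 1 cplx_scale.
Proof. by case=> x y; rewrite /cplx_scale /= !scale1r !scale0r subr0 addr0. Qed.

Fact cplx_scaleDr : right_distributive cplx_scale +%R.
Proof.
case=> a b [x y] [z w]; rewrite /cplx_scale /=.
by congr pair; rewrite /= !scalerDr ?opprD addrACA.
Qed.

Fact cplx_scaleDl X : {morph cplx_scale^~ X : a b / a + b}.
Proof.
case: X => x y [a1 a2] [b1 b2]; rewrite /cplx_scale /=.
by congr pair; rewrite /= !scalerDl ?opprD addrACA.
Qed.

HB.instance Definition _ := GRing.Zmodule_isLmodule.Build R[i] (cplx V)
  cplx_scaleA cplx_scale1 cplx_scaleDr cplx_scaleDl.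

Fact cplx_vect_iso : Vector.axiom (\dim {:V}) (cplx V).
Proof.
pose e := vbasis {:V}; have eB : basis_of {:V} e := vbasisP _.
pose f (X : cplx V) : 'rV[R[i]]_(\dim {:V}) :=
  \row_i (coord e i X.1 +i* coord e i X.2).
pose g (v : 'rV[R[i]]_(\dim {:V})) : cplx V :=
  (vecof e (\row_i complex.Re (v 0 i)), vecof e (\row_i complex.Im (v 0 i))).
exists f; last exists g.
- move=> [a b] [x y] [z w]; apply/rowP=> i; rewrite !mxE /=.
  apply/eqP; rewrite eq_complex /= !linearD /= !linearN /= !linearZ /=.
  by rewrite !eqxx.
- by case=> x y; congr pair; rewrite -[RHS](rVofK eB); congr (vecof e _);
     apply/rowP=> i; rewrite !mxE.
- move=> v; apply/rowP=> i; rewrite !mxE /= !coord_vecof // !mxE.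
  by case: (v 0 i).
Qed.

HB.instance Definition _ := Lmodule_hasFinDim.Build R[i] (cplx V) cplx_vect_iso.

Definition cincl (x : V) : cplx V := (x, 0).

Definition cplx_vspace (W : {vspace V}) : {vspace cplx V} :=
  <<[seq cincl x | x <- vbasis W]>>%VS.

Definition cplx_fun (f : V -> V) (X : cplx V) : cplx V := (f X.1, f X.2).

End Complexification.

Section ComplexificationLie.
Variables (R : rcfType) (u : lieAlgType R).
Implicit Types X Y Z : cplx u.

Definition cplx_lie X Y : cplx u :=
  (lie X.1 Y.1 - lie X.2 Y.2, lie X.1 Y.2 + lie X.2 Y.1).

Fact cplx_liexx X : cplx_lie X X = 0.
Proof.
case: X => x y; rewrite /cplx_lie /= !liexx subr0.
by rewrite [lie y x]lieC subrr.
Qed.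

Fact cplx_lie_linearr X : linear (cplx_lie X).
Proof.
case: X => x y [a b] [z w] [p q]; rewrite /cplx_lie /=.
apply: injective_projections; rewrite /= !linearD !linearN !linearZ /=.
  by rewrite ?scalerDr [LHS](AC (3*3) ((1*4)*(2*5)*(3*6))).
by rewrite ?scalerDr [LHS](AC (3*3) ((1*4)*(2*5)*(3*6))).
Qed.

Fact cplx_lieC X Y : cplx_lie X Y = - cplx_lie Y X.
Proof.
apply: injective_projections; rewrite /= opprD ?opprK.
  by rewrite (lieC X.1) (lieC X.2) opprK.
by rewrite (lieC X.1) (lieC X.2) addrC.
Qed.

Fact cplx_lie_linearl Y : linear (cplx_lie^~ Y).
Proof.
move=> c X X'; rewrite ![cplx_lie _ Y]cplx_lieC cplx_lie_linearr opprD scalerN.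
by [].
Qed.

Fact cplx_lie_jacobi X Y Z :
  cplx_lie X (cplx_lie Y Z) + cplx_lie Y (cplx_lie Z X)
    + cplx_lie Z (cplx_lie X Y) = 0.
Proof.
case: X Y Z => [x1 x2] [y1 y2] [z1 z2]; have J := @lie_jacobi R u.
apply: injective_projections; rewrite /= !(linearB, linearD, opprD) /=.
  rewrite [LHS](AC ((2*2)*(2*2)*(2*2))
    ((1*5*9) * (2*8*11) * (3*6*12) * (4*7*10))) /= -!opprD.
  by rewrite !J !subr0.
rewrite [LHS](AC ((2*2)*(2*2)*(2*2))
  ((1*6*11) * (2*7*9) * (3*5*10) * (4*8*12))) /=.
by rewrite -!opprD !J subr0 !addr0.
Qed.

HB.instance Definition _ := Vector_isLie.Build R[i] (cplx u)
  cplx_lie_linearl cplx_lie_linearr cplx_liexx cplx_lie_jacobi.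

(* The antilinear involution with X^* = - X on u.                             *)
Definition star X : cplx u := (- X.1, X.2).

End ComplexificationLie.

Section Roots.
Variables (K : fieldType) (g : lieAlgType K) (h : {vspace g}).

Definition dual := 'Hom(subvs_of h, K^o).
Implicit Types (alpha beta : dual) (B : g -> g -> K).

Definition root_space alpha : set g :=
  [set X | forall H : subvs_of h, lie (vsval H) X = (alpha H : K) *: X].

Definition is_root alpha :=
  alpha != 0 /\ exists2 X, X != 0 & root_space alpha X.

(* The T in h with B(T, H) = alpha(H) for all H in h, when B is nondegenerate *)
(* on h.                                                                      *)
Definition dual_vector B alpha : subvs_of h :=
  xget 0 [set T | forall H : subvs_of h, B (vsval T) (vsval H) = alpha H].

Definition dual_form B alpha beta : K :=
  B (vsval (dual_vector B alpha)) (vsval (dual_vector B beta)).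

Definition coroot B alpha : g :=
  (2 / dual_form B alpha alpha) *: vsval (dual_vector B alpha).

End Roots.

Section NormalizedForm.
Variables (R : rcfType) (g : lieAlgType R[i]).

(* Root lengths are compared with the form dual to the Killing form, which is *)
(* positive on roots; in the simply laced case every root is short.           *)
Definition short_root (h : {vspace g}) (alpha : dual h) :=
  is_root alpha /\
  forall beta : dual h, is_root beta ->
    dual_form (@killing _ g) alpha alpha <= dual_form (@killing _ g) beta beta.

Definition normalized_form (B : g -> g -> R[i]) :=
  forall h : {vspace g}, cartan_subalgebra h ->
  forall alpha : dual h, short_root alpha -> dual_form B alpha alpha = 2.

End NormalizedForm.

Section Exponential.
Variable R : realType.

Definition vect_lim (V : vectType R) (s : nat -> V) : V :=
  vecof (vbasis {:V}) (\row_i limn (fun n => rVof (vbasis {:V}) (s n) 0 i)).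

Definition cplx_lim (V : vectType R) (s : nat -> cplx V) : cplx V :=
  (vect_lim (fun n => (s n).1), vect_lim (fun n => (s n).2)).

(* Ad(exp X) = exp(ad X).                                                     *)
Definition Ad_exp (u : lieAlgType R) (X Y : cplx u) : cplx u :=
  cplx_lim (fun n => \sum_(k < n) (k`!%:R : R[i])^-1 *: iter k (lie X) Y).

End Exponential.

Section CompactSimple.
Variables (R : realType) (u : lieAlgType R).
Local Notation g := (cplx u).

Definition compact_simple :=
  lie_simple u /\ forall x : u, x != 0 -> killing x x < 0.

Definition real_form : set g := range (@cincl R u).

Variable nu : 'End(u).

Definition fixed_cplx : set g := [set Y | cplx_fun nu Y = Y].

Variables (B : g -> g -> R[i]) (t : {vspace u}) (b : seq u).
Local Notation h := (cplx_vspace t).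
Implicit Types alpha beta gamma : dual h.

(* Roots are compared lexicographically by their values on the ordered basis  *)
(* - i x, x in b, of i t; these values are real.                              *)
Definition root_key alpha : seqlexi R :=
  [seq complex.Re (alpha (vsproj h ((0 -i* 1) *: cincl x))) | x <- b].

Definition root_le alpha beta := (root_key alpha <= root_key beta)%O.

Definition positive_root alpha :=
  is_root alpha /\ (root_key 0 < root_key alpha)%O.

Definition largest_root (P : set (dual h)) gamma :=
  [/\ is_root gamma, P gamma &
      forall beta, is_root beta -> P beta -> root_le beta gamma].

Definition root_vectors (X : dual h -> g) :=
  forall alpha, positive_root alpha ->
    [/\ root_space alpha (X alpha),
        B (X alpha) (star (X alpha)) = 2 / dual_form B alpha alpha &
        X (- alpha) = star (X alpha)].

Variable X : dual h -> g.

Definition r_matrix : 'M[R[i]]_(\dim {:g}) :=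
  (0 +i* 1) *: \sum_(alpha \in [set alpha | positive_root alpha])
    (dual_form B alpha alpha / 2) *:
      (tens (X (- alpha)) (X alpha) - tens (X alpha) (X (- alpha))).

Definition delta_r (Y : g) : 'M[R[i]]_(\dim {:g}) := tens_bracket r_matrix Y.

Definition coroot_centralizer (gam : seq (dual h)) : set g :=
  [set Y | forall gamma, gamma \in gam -> lie (coroot B gamma) Y = 0].

Definition cascade (gam : seq (dual h)) :=
  [/\ (0 < size gam)%N,
      largest_root setT gam`_0,
      forall i, (0 < i < size gam)%N ->
        ~ (coroot_centralizer (take i gam) `<=` fixed_cplx) /\
        largest_root [set alpha | coroot_centralizer (take i gam) (X alpha)]
          gam`_i &
      coroot_centralizer gam `<=` fixed_cplx].

Variable gam : seq (dual h).

Definition log_g (phi : R) : g :=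
  (0 +i* (pi * phi / 4)) *: \sum_(gamma <- gam) (X (- gamma) + X gamma).

(* The Lie algebra of K_phi = g_{phi - 1} U^nu g_{1 - phi}, that is the image *)
(* of u^nu under Ad(g_{phi - 1}), where g_phi = exp(log_g phi). The group U   *)
(* enters only through its adjoint action and is not constructed.             *)
Definition k_ (phi : R) : set g :=
  [set Ad_exp (log_g (phi - 1)) (cincl x) | x in [set` fixedSpace nu]].

(* The infinitesimal criteria for the connected subgroup with Lie algebra k.  *)
Definition coisotropic (k : set g) :=
  forall Y, k Y -> exists T1 T2,
    [/\ tens_span k real_form T1, tens_span real_form k T2 &
        delta_r Y = T1 + T2].

Definition poisson_lie (k : set g) :=
  forall Y, k Y -> tens_span k k (delta_r Y).

End CompactSimple.

(* Main.v *)
(* Through the invariant form, r becomes the operator r_op acting by i on the *)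
(* positive root spaces, by -i on the negative ones and by 0 on h.  As the    *)
(* order starts with -iZ, r_op is ad Z on the noncompact part m.  Let E be the*)
(* sum of the X_gamma over the cascade, and G = exp(i theta ad(E + E^* )) with*)
(* theta = pi (phi - 1) / 4, so that k_phi = G(u^nu).  A root vector x of a   *)
(* positive noncompact root generates a string of spin 1/2 or 1 under the sl2 *)
(* of E; the maximality of the cascade roots determines r_op on [E^*, x], and *)
(* rotating the string gives, for every x in m,                               *)
(*     r_op (G x) = G (cos (2 theta) [Z, x] + sin (2 theta) v), v in g^nu.    *)
(* As ad Z commutes with ad u^nu, the G(m) (x) G(m) component of delta_r      *)
(* vanishes on k_phi, which is coisotropy.  The mixed components vanish when  *)
(* sin (2 theta) = 0; conversely, delta_r (G Z) paired with G X_gamma_1 and   *)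
(* G H_gamma_1 is a nonzero multiple of sin (2 theta).                        *)
Require Import Defs.
From HB Require Import structures.
From mathcomp Require Import all_boot all_order all_algebra.
From mathcomp Require Import complex.
From mathcomp Require Import all_classical all_reals all_analysis.
From mathcomp Require Import ring lra zify.

Set Implicit Arguments.
Unset Strict Implicit.
Unset Printing Implicit Defensive.

Import Order.TTheory GRing.Theory Num.Theory.
Import numFieldNormedType.Exports.
Import passmx.

Local Open Scope classical_set_scope.
Local Open Scope ring_scope.

Local Notation "x %:C" := (real_complex _ x) : ring_scope.

(** * Lie algebras and invariant forms *)

(** Pairing tensors with the invariant form turns both properties into statements about the operator
    [r_op]: by [tens_pair_bracket] and [tens_pair_r], delta_r(Y) paired with p and q is (r_op
    [Y, p], q) + (r_op p, [Y, q]). As r is real ([real_part_r]), delta_r(Y) lies in u ⊗ u and splits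
    into four components along u = k_phi + G(m). Coisotropy says that the G(m) ⊗ G(m) component
    vanishes; the Poisson-Lie property says that the two mixed components vanish as well.

    The core is [rotation_noncompact]: on m, the conjugate of [r_op] by G is cos (2 theta) ad Z plus
    sin (2 theta) times a vector of g^nu. It is enough to treat a vector x of a noncompact root beta
    with beta(Z) = i, the opposite roots following by the involution. Since ad Z has only the
    eigenvalues 0, i, -i, the string of x under the sl2 of E has at most three terms
    ([string_cases]). The values of beta on the cascade coroots therefore add up to at most 2, and
    not to 0, because the cascade stops only when no noncompact root is orthogonal to it
    ([cascade_pattern]). Maximality of the cascade roots fixes the signs of the roots beta -
    gamma_i, hence [r_op] on the middle of the string ([cascade_string]); the rest is trigonometry
    in a string of spin 1/2 or 1 ([rotation_spin_half], [rotation_spin1]).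

    Then [delta_mm] is invariance of the form together with [Z, y] = 0 for y in u^nu. If sin (2
    theta) = 0, the rotated operator preserves m and [delta_mk] kills the mixed components;
    otherwise the first cascade root gives a nonzero one ([rotation_gam0], [cayley_poisson_lie]).

    All this is done for an abstract compact structure. The concrete data fit it because the
    normalized form is a positive multiple of the Killing form ([symmetric_schur],
    [normalized_compact_structure]), because the cascade consists of noncompact roots with the
    required extremality ([cascade_largest]), and because the exponential series acts on
    eigenvectors of E + E^* by complex exponentials ([Ad_exp_sum]). As 2 theta = pi (phi - 1) / 2,
    its sine vanishes exactly at odd integers phi. *)

Section LieTheory.
Variables (K : fieldType) (L : lieAlgType K).
Implicit Types x y z : L.

Lemma lie0l y : lie 0 y = 0.
Proof. by rewrite -[X in lie X](subrr (0 : L)) lieBl subrr. Qed.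

Lemma lie0r x : lie x 0 = 0.
Proof. exact: linear0. Qed.

Lemma lieNl x y : lie (- x) y = - lie x y.
Proof. by rewrite -scaleN1r lieZl scaleN1r. Qed.

Lemma lieNr x y : lie x (- y) = - lie x y.
Proof. exact: linearN. Qed.

Lemma lieDr x y z : lie x (y + z) = lie x y + lie x z.
Proof. exact: linearD. Qed.

Lemma lieBr x y z : lie x (y - z) = lie x y - lie x z.
Proof. exact: linearB. Qed.

Lemma lieZr c x y : lie x (c *: y) = c *: lie x y.
Proof. exact: linearZ. Qed.

Lemma lie_suml I r (P : pred I) (F : I -> L) y :
  lie (\sum_(i <- r | P i) F i) y = \sum_(i <- r | P i) lie (F i) y.
Proof. exact: (big_morph _ (lieDl y) (lie0l y)). Qed.

Lemma lie_sumr I r (P : pred I) (F : I -> L) x :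
  lie x (\sum_(i <- r | P i) F i) = \sum_(i <- r | P i) lie x (F i).
Proof. exact: linear_sum. Qed.

Lemma lie_derivation x y z : lie x (lie y z) = lie (lie x y) z + lie y (lie x z).
Proof.
apply/eqP; rewrite -subr_eq0 -[X in _ == X](lie_jacobi x y z); apply/eqP.
by rewrite (lieC z x) lieNr (lieC z) opprD addrA addrAC -!addrA.
Qed.

Lemma adE x y : ad x y = lie x y.
Proof. by rewrite lfunE. Qed.

Lemma lie_memP (U : {vspace L}) x :
  (forall v, v \in U -> lie x v = 0) <-> all (fun v => lie x v == 0) (vbasis U).
Proof.
split=> [xU|/allP xU v vU].
  by apply/allP => v vU; rewrite xU ?(vbasis_mem vU).
rewrite (coord_vbasis vU) lie_sumr big1// => i _.
by rewrite lieZr (eqP (xU _ _)) ?scaler0// mem_nth// size_tuple.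
Qed.

Lemma mem_lie_center (U : {vspace L}) x :
  x \in lie_center U <-> x \in U /\ forall v, v \in U -> lie x v = 0.
Proof.
have E v : (x \in lker (ad v)) = (lie x v == 0).
  by rewrite memv_ker adE lieC oppr_eq0.
rewrite /lie_center memv_cap; split=> [/andP[xU]|[xU xC]].
  move=> h; split=> //; case: (lie_memP U x) => _; apply; apply/allP => v vU; rewrite -E.
  by move: h; rewrite (big_rem v vU) /= memv_cap => /andP[].
rewrite xU /= big_seq; elim/big_ind: _ => [|A B xA xB|v vU]; first exact: memvf.
  by rewrite memv_cap xA.
by rewrite E xC ?(vbasis_mem vU).
Qed.

End LieTheory.

Section TraceBasis.
Variables (K : fieldType) (V : vectType K).

(** The Killing form is defined through one chosen basis; on a complexification it is computed in
    another, coming from the real form. *)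
Lemma trace_basis (e e' : (\dim {:V}).-tuple V) (f : 'End(V)) :
  basis_of {:V} e -> basis_of {:V} e' -> \tr (mxof e e f) = \tr (mxof e' e' f).
Proof.
move=> eB e'B.
have {1}-> : f = (\1 \o (f \o \1))%VF by rewrite comp_lfun1l comp_lfun1r.
rewrite (@mxof_comp _ _ _ _ _ e')// (@mxof_comp _ _ _ _ _ e')// mxtrace_mulC.
rewrite mulmxA -!mxof_comp// !comp_lfun1l comp_lfun1r //.
Qed.

End TraceBasis.

Section Killing.
Variables (K : fieldType) (L : lieAlgType K).
Implicit Types x y z : L.
Local Notation e := (vbasis {:L}).
Local Notation M x := (mxof e e (ad x)).

Lemma killingE x y : killing x y = \tr (M x *m M y).
Proof. by rewrite /killing (@mxof_comp _ _ _ _ e e e) ?vbasisP// mxtrace_mulC. Qed.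

Lemma killingC x y : killing x y = killing y x.
Proof. by rewrite !killingE mxtrace_mulC. Qed.

Lemma ad_linear : linear (@ad K L).
Proof.
by move=> c x y; apply/lfunP => z; rewrite add_lfunE scale_lfunE !adE lieDl lieZl.
Qed.

Lemma killing_linearl y : linear (fun x => killing x y : K^o).
Proof.
move=> c x z; rewrite !killingE ad_linear linearP /= mulmxDl -scalemxAl.
by rewrite linearD linearZ.
Qed.

(** Vectors are rows, so composition of operators reverses the order of the matrices. *)
Lemma ad_lie x y : M (lie x y) = M y *m M x - M x *m M y.
Proof.
rewrite -!mxof_comp ?vbasisP// -linearB; congr mxof; apply/lfunP => z.
by rewrite add_lfunE opp_lfunE !comp_lfunE !adE (lie_derivation x) addrK.
Qed.

Lemma killing_invariant : invariant_form (@killing K L).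
Proof.
move=> x y z; rewrite !killingE !ad_lie.
move: (M x) (M y) (M z) => A A' A''.
rewrite mulmxBl mulmxBr !raddfB /=; congr (_ - _); last by rewrite mulmxA.
by rewrite -mulmxA mxtrace_mulC -mulmxA.
Qed.

End Killing.

(** * Simultaneous diagonalization of self-adjoint operators *)

Section Selfadjoint.
Variable C : numClosedFieldType.

(** The minimal polynomial has simple roots. A double root r would give w with w(A - r) nonzero and
    w(A - r)^2 = 0; then r is real, being the eigenvalue of w(A - r), and moving one factor A - r
    across the inner product shows that w(A - r) has length 0. *)
Lemma selfadjoint_mx_diagonalizable n (A : 'M[C]_n)
  (h : 'rV[C]_n -> 'rV[C]_n -> C) :
  (forall v w z, h (v + w) z = h v z + h w z) ->
  (forall c v z, h (c *: v) z = c * h v z) ->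
  (forall v w, h w v = (h v w)^*) -> (forall v, v != 0 -> 0 < h v v) ->
  (forall v w, h (v *m A) w = h v (w *m A)) ->
  diagonalizable A.
Proof.
case: n A h => [|n] A h hD hZ hC h0 hA.
  by exists 1%:M; rewrite ?unitmx1//; apply/is_diag_mxP => -[].
have h00 v : h 0 v = 0 by rewrite -(scale0r (0 : 'rV_n.+1)) hZ mul0r.
have hdef v : h v v = 0 -> v = 0.
  by move=> hv; apply/eqP/negPn/negP => /h0; rewrite hv ltxx.
have real_eigen a (v : 'rV_n.+1) : v != 0 -> v *m A = a *: v -> a^* = a.
  move=> v0 vA; have := hA v v; rewrite vA hZ (hC (a *: v)) hZ rmorphM /= -hC.
  have hv : h v v != 0 by rewrite gt_eqF// h0.
  by move/(mulIf hv).
apply/diagonalizableP.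
have [rs rsE] := closed_field_poly_normal (mxminpoly A).
rewrite (monicP (mxminpoly_monic A)) scale1r in rsE.
exists rs; last by rewrite rsE dvdpp.
apply/negPn/negP => /uniqPn -/(_ 0)[i [j [ij jn rij]]].
pose r := rs`_i.
have [q qE] : exists q, mxminpoly A = q * ('X - r%:P) ^+ 2.
  exists (\prod_(z <- rem r (rem r rs)) ('X - z%:P)).
  have ri : r \in rs by rewrite mem_nth// (ltn_trans ij).
  have rj : r \in rem r rs.
    rewrite -has_pred1 has_count.
    have : (1 < count_mem r rs)%N; last first.
      by rewrite (permP (perm_to_rem ri)) /= eqxx.
    rewrite -(cat_take_drop j rs) count_cat (leq_add (m1 := 1) (m2 := 1))//.
      rewrite -has_count has_pred1; apply/(nthP 0); exists i; rewrite ?nth_take//.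
      by rewrite size_take jn.
    rewrite -has_count has_pred1 /r rij; apply/(nthP 0); exists 0%N.
      by rewrite size_drop subn_gt0.
    by rewrite nth_drop addn0.
  rewrite rsE (perm_big _ (perm_to_rem ri)) big_cons.
  by rewrite (perm_big _ (perm_to_rem rj)) big_cons [RHS]mulrC expr2 -mulrA.
have qr : horner_mx A (q * ('X - r%:P)) != 0.
  apply/eqP => /mxminpoly_min; rewrite qE expr2 mulrA.
  have qr0 : q * ('X - r%:P) != 0.
    apply/eqP => q0; have := monic_neq0 (mxminpoly_monic A).
    by rewrite qE expr2 mulrA q0 mul0r eqxx.
  move/(dvdp_leq qr0); rewrite size_mul ?polyXsubC_eq0// size_XsubC addn2 /=.
  by rewrite ltnn.
have [k wk] : exists k, row k (horner_mx A (q * ('X - r%:P))) != 0.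
  apply/existsP; move: qr; apply: contraNT.
  rewrite negb_exists => /forallP qr; apply/eqP/row_matrixP => k.
  by rewrite row0; apply/eqP/negPn/qr.
move: wk; rewrite rmorphM /= row_mul.
set w := row k _; set B := horner_mx A ('X - r%:P) => wk.
have BE : B = A - r%:M by rewrite /B rmorphB /= horner_mx_X horner_mx_C.
have wBB : w *m B *m B = 0.
  rewrite -mulmxA -/(B ^+ 2) -[B *m B]/(B * B) -expr2.
  have := mx_root_minpoly A; rewrite qE rmorphM rmorphXn /= -/B => /(congr1 (row k)).
  by rewrite row0 -[horner_mx A q * _]/(_ *m _) row_mul.
have wA : w *m B *m A = r *: (w *m B).
  by apply/eqP; rewrite -subr_eq0 -mul_mx_scalar -mulmxBr -BE wBB.
have rr : r^* = r by apply: (real_eigen _ _ wk).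
case/eqP: wk; apply: hdef.
have {2}-> : w *m B = w *m A - r *: w by rewrite BE mulmxBr mul_mx_scalar.
rewrite (hC (w *m A - _)) -scaleNr hD hZ !hA wA.
by rewrite (hC (r *: _) w) hZ rmorphM /= -hC rr mulNr subrr conjC0.
Qed.

Lemma selfadjoint_eigenbasis (V : vectType C) (h : V -> V -> C)
    (fs : seq 'End(V)) :
  (forall v w z, h (v + w) z = h v z + h w z) ->
  (forall c v z, h (c *: v) z = c * h v z) ->
  (forall v w, h w v = (h v w)^*) -> (forall v, v != 0 -> 0 < h v v) ->
  (forall f v w, f \in fs -> h (f v) w = h v (f w)) ->
  (forall f f' v, f \in fs -> f' \in fs -> f (f' v) = f' (f v)) ->
  exists e : (\dim {:V}).-tuple V, basis_of {:V} e /\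
    forall f (i : 'I_(\dim {:V})), f \in fs ->
      exists2 a, a \is Num.real & f e`_i = a *: e`_i.
Proof.
move=> hD hZ hC h0 hf fC.
pose e := vbasis {:V}; have eB : basis_of {:V} e := vbasisP _.
have [P Pu /allP PA] : codiagonalizable [seq mxof e e f | f <- fs].
  apply/codiagonalizableP; split.
    move=> _ _ /mapP[f ff ->] /mapP[f' ff' ->].
    rewrite /comm_mx -!mxof_comp//; congr mxof.
    by apply/lfunP => v; rewrite !comp_lfunE fC.
  move=> _ /mapP[f ff ->].
  apply: (selfadjoint_mx_diagonalizable (h := fun v w => h (vecof e v) (vecof e w))).
  - by move=> v w z; rewrite linearD hD.
  - by move=> c v z; rewrite linearZ hZ.
  - by move=> v w; rewrite hC.
  - by move=> v v0; rewrite h0// vecof_eq0.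
  by move=> v w; rewrite -!hom_vecof// hf.
pose e' := [tuple vecof e (row i P) | i < \dim {:V}].
have e'E (i : 'I_(\dim {:V})) : e'`_i = vecof e (row i P).
  by rewrite -tnth_nth tnth_mktuple.
have e'B : basis_of {:V} e'.
  rewrite basisEdim size_tuple leqnn andbT; apply/subvP => v _.
  rewrite -(rVofK eB v) -[rVof e v](mulmxKV Pu) mulmx_sum_row linear_sum.
  rewrite memv_suml// => i _.
  by rewrite linearZ memvZ//= memv_span// -e'E mem_nth ?size_tuple.
exists e'; split=> // f i ff.
have /diagonalizable_forPex[d /(simmxP Pu) PE] := PA _ (map_f _ ff).
have fE : f e'`_i = d 0 i *: e'`_i.
  rewrite e'E (hom_vecof e eB) -row_mul PE -linearZ row_mul row_diag_mx.
  by rewrite -scalemxAl -rowE.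
exists (d 0 i) => //; rewrite CrealE.
have e0 : e'`_i != 0.
  apply/eqP => ei0; have := coord_free i i (basis_free e'B).
  by rewrite ei0 linear0 eqxx => /eqP; rewrite eq_sym oner_eq0.
have := hf f e'`_i e'`_i ff; rewrite fE hZ (hC (_ *: _)) hZ rmorphM /= -hC.
have hv : h e'`_i e'`_i != 0 by rewrite gt_eqF// h0.
by move/(mulIf hv) => {2}->.
Qed.

End Selfadjoint.

Section SymmetricForm.
Variables (K : fieldType) (V : vectType K) (f : {symmetric V}).

Lemma formC x y : f x y = f y x.
Proof. by rewrite hermC expr0 mul1r. Qed.

Lemma formDl x y z : f (x + y) z = f x z + f y z.
Proof. exact: linearDl. Qed.

Lemma formDr x y z : f z (x + y) = f z x + f z y.
Proof. exact: linearDr. Qed.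

Lemma formZl c x z : f (c *: x) z = c * f x z.
Proof. exact: linearZl_LR. Qed.

Lemma formZr c x z : f z (c *: x) = c * f z x.
Proof. by rewrite formC formZl formC. Qed.

Lemma form0l z : f 0 z = 0.
Proof. exact: linear0l. Qed.

Lemma form0r z : f z 0 = 0.
Proof. exact: linear0r. Qed.

Lemma formNl x z : f (- x) z = - f x z.
Proof. exact: linearNl. Qed.

Lemma formNr x z : f z (- x) = - f z x.
Proof. exact: linearNr. Qed.

Lemma form_suml I r (P : pred I) (F : I -> V) z :
  f (\sum_(i <- r | P i) F i) z = \sum_(i <- r | P i) f (F i) z.
Proof. exact: (big_morph (f^~ z) (fun x y => formDl x y z) (form0l z)). Qed.

End SymmetricForm.

Section KillingForm.
Variables (K : fieldType) (L : lieAlgType K).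

Lemma killing_bilinear : bilinear_for *%R *%R (@killing K L : L -> L -> K).
Proof.
split=> [y c x z|y c x z]; first exact: killing_linearl.
by rewrite /= ![killing y _]killingC; apply: killing_linearl.
Qed.

HB.instance Definition _ := bilinear_isBilinear.Build K L L K *%R *%R
  (@killing K L) killing_bilinear.

Lemma killing_hermitian x y :
  @killing K L x y = (-1) ^+ false * idfun (killing y x).
Proof. by rewrite expr0 mul1r killingC. Qed.

HB.instance Definition _ := isHermitianSesquilinear.Build K L false idfun
  (@killing K L) killing_hermitian.

End KillingForm.

(** * Tensors, their additive spans and their pairing with a form *)

Section TensorSpan.
Variables (K : fieldType) (L : lieAlgType K).
Implicit Types (x y : L) (T : 'M[K]_(\dim {:L})).

Lemma tensDl x x' y : tens (x + x') y = tens x y + tens x' y.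
Proof. by rewrite /tens linearD /= linearD mulmxDl. Qed.

Lemma tensDr x y y' : tens x (y + y') = tens x y + tens x y'.
Proof. by rewrite /tens linearD /= mulmxDr. Qed.

Lemma tensZl c x y : tens (c *: x) y = c *: tens x y.
Proof. by rewrite /tens linearZ /= linearZ /= -scalemxAl. Qed.

Lemma tensZr c x y : tens x (c *: y) = c *: tens x y.
Proof. by rewrite /tens linearZ /= -scalemxAr. Qed.

Lemma tensNl x y : tens (- x) y = - tens x y.
Proof. by rewrite -scaleN1r tensZl scaleN1r. Qed.

Lemma tensNr x y : tens x (- y) = - tens x y.
Proof. by rewrite -scaleN1r tensZr scaleN1r. Qed.

Lemma tens_bracketD T T' z :
  tens_bracket (T + T') z = tens_bracket T z + tens_bracket T' z.
Proof. by rewrite /tens_bracket mulmxDr mulmxDl addrACA. Qed.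

Lemma tens_bracket0 z : tens_bracket 0 z = 0 :> 'M[K]_(\dim {:L}).
Proof. by rewrite /tens_bracket mulmx0 mul0mx addr0. Qed.

Lemma tens_bracket_sum I r (P : pred I) (F : I -> 'M[K]_(\dim {:L})) z :
  tens_bracket (\sum_(i <- r | P i) F i) z = \sum_(i <- r | P i) tens_bracket (F i) z.
Proof.
apply: (big_morph (fun T => tens_bracket T z)); last exact: tens_bracket0.
by move=> T T'; apply: tens_bracketD.
Qed.

Lemma tens_span_tens (A B : set L) x y : A x -> B y -> tens_span A B (tens x y).
Proof.
by move=> Ax By; exists 1%N, (fun=> x), (fun=> y); split=> //; rewrite big_ord1.
Qed.

Lemma tens_span0 (A B : set L) : tens_span A B 0.
Proof.
by exists 0%N, (fun=> 0), (fun=> 0); split; [case|rewrite big_ord0].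
Qed.

Lemma tens_spanD (A B : set L) T T' :
  tens_span A B T -> tens_span A B T' -> tens_span A B (T + T').
Proof.
move=> [m [x [y [xy ->]]]] [m' [x' [y' [xy' ->]]]].
exists (m + m')%N, (fun i => match fintype.split i with inl j => x j | inr j => x' j end),
  (fun i => match fintype.split i with inl j => y j | inr j => y' j end); split.
  by move=> i; case: (fintype.split i).
rewrite big_split_ord /=; congr (_ + _); apply: eq_bigr => i _.
  by rewrite (unsplitK (inl i)).
by rewrite (unsplitK (inr i)).
Qed.

Lemma tens_span_sum (A B : set L) I r (P : pred I) (F : I -> 'M[K]_(\dim {:L})) :
  (forall i, P i -> tens_span A B (F i)) -> tens_span A B (\sum_(i <- r | P i) F i).
Proof.
move=> FAB; elim/big_ind: _ => //; [exact: tens_span0|exact: tens_spanD].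
Qed.

Lemma tens_span_ind (A B : set L) (Q : 'M[K]_(\dim {:L}) -> Prop) :
  Q 0 -> (forall T T', Q T -> Q T' -> Q (T + T')) ->
  (forall x y, A x -> B y -> Q (tens x y)) -> forall T, tens_span A B T -> Q T.
Proof.
move=> Q0 QD Qt T [m [x [y [xy ->]]]]; elim/big_ind: _ => // i _.
by have [Ax By] := xy i; apply: Qt.
Qed.

Lemma tens_basis T :
  T = \sum_i \sum_j T i j *: tens (vbasis {:L})`_i (vbasis {:L})`_j.
Proof.
rewrite [LHS]matrix_sum_delta; apply: eq_bigr => i _; apply: eq_bigr => j _.
congr (_ *: _); rewrite /tens !rVofE ?vbasisP// trmx_delta.
by rewrite mul_delta_mx.
Qed.

Section Pairing.
Variable f : {symmetric L}.
Hypothesis f_nondegenerate : forall x, (forall y, f x y = 0) -> x = 0.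
Local Notation e := (vbasis {:L}).

Definition tens_pair T p q : K := \sum_i \sum_j T i j * (f e`_i p * f e`_j q).

Lemma tens_pairD T T' p q :
  tens_pair (T + T') p q = tens_pair T p q + tens_pair T' p q.
Proof.
rewrite /tens_pair -big_split; apply: eq_bigr => i _ /=.
by rewrite -big_split; apply: eq_bigr => j _ /=; rewrite mxE mulrDl.
Qed.

Lemma tens_pairZ c T p q : tens_pair (c *: T) p q = c * tens_pair T p q.
Proof.
rewrite /tens_pair mulr_sumr; apply: eq_bigr => i _ /=.
by rewrite mulr_sumr; apply: eq_bigr => j _ /=; rewrite mxE mulrA.
Qed.

Lemma tens_pair0 p q : tens_pair 0 p q = 0.
Proof. by rewrite -(scale0r 0) tens_pairZ mul0r. Qed.

Lemma tens_pairN T p q : tens_pair (- T) p q = - tens_pair T p q.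
Proof. by rewrite -scaleN1r tens_pairZ mulN1r. Qed.

Lemma tens_pair_sum I r (P : pred I) (F : I -> 'M[K]_(\dim {:L})) p q :
  tens_pair (\sum_(i <- r | P i) F i) p q = \sum_(i <- r | P i) tens_pair (F i) p q.
Proof.
apply: (big_morph (fun T => tens_pair T p q)); last exact: tens_pair0.
by move=> T T'; apply: tens_pairD.
Qed.

Lemma tens_pair_tens x y p q : tens_pair (tens x y) p q = f x p * f y q.
Proof.
rewrite [in RHS](coord_vbasis (memvf x)) [in RHS](coord_vbasis (memvf y)).
rewrite !form_suml mulr_suml; apply: eq_bigr => i _.
rewrite mulr_sumr; apply: eq_bigr => j _.
rewrite !formZl mxE big_ord1 !mxE; ring.
Qed.

(** Nondegeneracy is used once for each tensor factor. *)
Lemma tens_pair_eq0 T : (forall p q, tens_pair T p q = 0) -> T = 0.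
Proof.
move=> T0; apply/matrixP => i j; rewrite mxE.
have eF := basis_free (vbasisP {:L}).
have Ti (q : L) : \sum_k T i k * f e`_k q = 0.
  have : \sum_l (\sum_k T l k * f e`_k q) *: e`_l = 0.
    apply: f_nondegenerate => p; rewrite form_suml -[RHS](T0 p q).
    apply: eq_bigr => l _; rewrite formZl mulr_suml; apply: eq_bigr => k _.
    by ring.
  by move/freeP: eF => /[apply]; apply.
have : \sum_k T i k *: e`_k = 0.
  apply: f_nondegenerate => q; rewrite form_suml -[RHS](Ti q).
  by apply: eq_bigr => k _; rewrite formZl.
by move/freeP: eF => /[apply]; apply.
Qed.

Hypothesis f_inv : invariant_form f.

(** Invariance moves the bracket with z from the tensor to the arguments: f([x, z], p) = f(x,
    [z, p]). *)
Lemma tens_pair_bracket T z p q : tens_pair (tens_bracket T z) p q =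
  tens_pair T (lie z p) q + tens_pair T p (lie z q).
Proof.
have scaleE c x y : c *: tens x y = tens (c *: x) y by rewrite tensZl.
rewrite [T]tens_basis tens_bracket_sum !tens_pair_sum -big_split.
apply: eq_bigr => i _ /=; rewrite tens_bracket_sum !tens_pair_sum -big_split.
apply: eq_bigr => j _ /=; rewrite scaleE tens_bracketE tens_pairD !tens_pair_tens.
by rewrite !f_inv.
Qed.

End Pairing.
End TensorSpan.

(** * Root systems of compact structures *)

Section CompactStructure.
Variables (C : numClosedFieldType) (g : lieAlgType C).

(* The anti-involution X |-> X^* of the complexification of a compact Lie     *)
(* algebra, with an invariant form K for which K(X, Y^* ) is a Hermitian      *)
(* inner product.                                                             *)
Record compact_structure (star : g -> g) (K : {symmetric g}) : Prop := {
  starD : {morph star : X Y / X + Y};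
  starZ : forall c X, star (c *: X) = c^* *: star X;
  starK : involutive star;
  star_lie : forall X Y, star (lie X Y) = lie (star Y) (star X);
  form_invariant : invariant_form K;
  form_star : forall X Y, K (star X) (star Y) = (K X Y)^*;
  form_gt0 : forall X, X != 0 -> 0 < K X (star X)
}.

Variables (star : g -> g) (K : {symmetric g}).
Hypothesis cs : compact_structure star K.
Implicit Types (X Y : g) (c : C).

Lemma star0 : star 0 = 0.
Proof. by apply: (addrI (star 0)); rewrite -(starD cs) !addr0. Qed.

Lemma starN X : star (- X) = - star X.
Proof. by rewrite -scaleN1r (starZ cs) rmorphN rmorph1 scaleN1r. Qed.

Lemma starB X Y : star (X - Y) = star X - star Y.
Proof. by rewrite (starD cs) starN. Qed.

Lemma star_sum I r (P : pred I) (F : I -> g) :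
  star (\sum_(i <- r | P i) F i) = \sum_(i <- r | P i) star (F i).
Proof. exact: (big_morph _ (starD cs) star0). Qed.

Lemma star_eq0 X : (star X == 0) = (X == 0).
Proof. by rewrite -[in LHS]star0 (inj_eq (can_inj (starK cs))). Qed.

Definition hform X Y : C := K X (star Y).

Lemma hformC X Y : hform Y X = (hform X Y)^*.
Proof. by rewrite /hform -(form_star cs) (starK cs) formC. Qed.

Lemma hformDl X Y Y' : hform (X + Y) Y' = hform X Y' + hform Y Y'.
Proof. exact: formDl. Qed.

Lemma hformZl c X Y : hform (c *: X) Y = c * hform X Y.
Proof. exact: formZl. Qed.

Lemma hformZr c X Y : hform X (c *: Y) = c^* * hform X Y.
Proof. by rewrite /hform (starZ cs) formZr. Qed.

Lemma hform_gt0 X : X != 0 -> 0 < hform X X.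
Proof. exact: form_gt0. Qed.

Lemma hform_ge0 X : 0 <= hform X X.
Proof.
by have [->|/hform_gt0/ltW//] := eqVneq X 0; rewrite /hform form0l.
Qed.

Lemma hform_eq0 X : hform X X = 0 -> X = 0.
Proof. by move=> h; apply/eqP/negPn/negP => /hform_gt0; rewrite h ltxx. Qed.

Lemma hform_adjoint X Y Y' : hform (lie X Y) Y' = hform Y (lie (star X) Y').
Proof.
rewrite /hform (star_lie cs) (starK cs) lieC formNl (form_invariant cs).
by rewrite (lieC X) formNr opprK.
Qed.

Lemma hform_adjointr X Y Y' : hform Y (lie X Y') = hform (lie (star X) Y) Y'.
Proof. by rewrite hform_adjoint (starK cs). Qed.

Lemma ad_selfadjoint_eigenbasis (s : seq g) :
  (forall X, X \in s -> star X = X) ->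
  (forall X Y, X \in s -> Y \in s -> lie X Y = 0) ->
  exists e : (\dim {:g}).-tuple g, basis_of {:g} e /\
    forall X (i : 'I_(\dim {:g})), X \in s ->
      exists2 a, a \is Num.real & lie X e`_i = a *: e`_i.
Proof.
move=> sS sC.
have [| |e [eB eA]] := selfadjoint_eigenbasis (fs := [seq ad X | X <- s])
  hformDl hformZl hformC hform_gt0.
- by move=> _ X Y /mapP[A /sS As ->]; rewrite !adE hform_adjoint As.
- move=> _ _ X /mapP[A As ->] /mapP[A' As' ->]; rewrite !adE lie_derivation.
  by rewrite (sC _ _ As As') lie0l add0r.
exists e; split=> // X i /(map_f (@ad _ g)) /(eA _ i)[a].
by rewrite adE; exists a.
Qed.

(* With F = E^* and H = [E, F] this is |[E, X]|^2 = |[F, X]|^2 - c |X|^2 for  *)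
(* X of weight c.                                                             *)
Lemma hform_sl2 E X c : lie (lie E (star E)) X = c *: X ->
  hform (lie E X) (lie E X) =
  hform (lie (star E) X) (lie (star E) X) - c * hform X X.
Proof.
move=> H; rewrite hform_adjointr [in RHS]hform_adjointr (starK cs).
by rewrite [in RHS]lie_derivation H hformDl hformZl [X in _ = X - _]addrC addrK.
Qed.

End CompactStructure.

(** * Weights, roots and coroots of a maximal abelian subspace *)

Section Weights.
Variables (C : numClosedFieldType) (g : lieAlgType C).
Variables (star : g -> g) (K : {symmetric g}).
Hypothesis cs : compact_structure star K.
Variable h : {vspace g}.
Hypothesis h_abelian : forall H H', H \in h -> H' \in h -> lie H H' = 0.
Hypothesis h_maximal : forall X, (forall H, H \in h -> lie H X = 0) -> X \in h.
Hypothesis h_star : forall H, H \in h -> star H \in h.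
Implicit Types (X Y H : g) (c : C) (alpha beta : dual h).

(** The projection onto h extends a functional on h to all of g, so that it can be evaluated without
    a membership proof. *)
Definition wt alpha H : C := alpha (vsproj h H).

Lemma wtDl alpha beta H : wt (alpha + beta) H = wt alpha H + wt beta H.
Proof. by rewrite /wt add_lfunE. Qed.

Lemma wtNl alpha H : wt (- alpha) H = - wt alpha H.
Proof. by rewrite /wt opp_lfunE. Qed.

Lemma wtBl alpha beta H : wt (alpha - beta) H = wt alpha H - wt beta H.
Proof. by rewrite wtDl wtNl. Qed.

Lemma wt0l H : wt 0 H = 0.
Proof. by rewrite /wt zero_lfunE. Qed.

Lemma wtD alpha H H' : wt alpha (H + H') = wt alpha H + wt alpha H'.
Proof. by rewrite /wt !linearD. Qed.

Lemma wtZ alpha c H : wt alpha (c *: H) = c * wt alpha H.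
Proof. by rewrite /wt !linearZ. Qed.

Lemma wtN alpha H : wt alpha (- H) = - wt alpha H.
Proof. by rewrite /wt !linearN. Qed.

Lemma wt_sum alpha I r (P : pred I) (F : I -> g) :
  wt alpha (\sum_(i <- r | P i) F i) = \sum_(i <- r | P i) wt alpha (F i).
Proof. by rewrite /wt !linear_sum. Qed.

Lemma wt_ext alpha beta :
  (forall H, H \in h -> wt alpha H = wt beta H) -> alpha = beta.
Proof.
by move=> E; apply/lfunP => H; have := E _ (subvsP H); rewrite /wt vsvalK.
Qed.

Lemma root_spaceP alpha X :
  root_space alpha X <-> forall H, H \in h -> lie H X = wt alpha H *: X.
Proof.
split=> [aX H hH|aX H]; first by rewrite -(aX (vsproj h H)) vsprojK.
by rewrite aX ?subvsP// /wt vsvalK.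
Qed.

Lemma root_spaceD alpha X Y :
  root_space alpha X -> root_space alpha Y -> root_space alpha (X + Y).
Proof. by move=> aX aY H; rewrite lieDr aX aY scalerDr. Qed.

Lemma root_spaceZ alpha c X : root_space alpha X -> root_space alpha (c *: X).
Proof. by move=> aX H; rewrite lieZr aX !scalerA mulrC. Qed.

Lemma root_spaceN alpha X : root_space alpha X -> root_space alpha (- X).
Proof. by rewrite -scaleN1r; apply: root_spaceZ. Qed.

Lemma root_space_lie alpha beta X Y : root_space alpha X -> root_space beta Y ->
  root_space (alpha + beta) (lie X Y).
Proof.
move=> /root_spaceP aX /root_spaceP bY; apply/root_spaceP => H hH.
by rewrite lie_derivation aX// lieZl (bY H hH) lieZr wtDl scalerDl.
Qed.

Lemma root_space0 X : root_space (0 : dual h) X <-> X \in h.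
Proof.
split=> [/root_spaceP X0|hX].
  by apply: h_maximal => H hH; rewrite X0// wt0l scale0r.
by apply/root_spaceP => H hH; rewrite wt0l scale0r h_abelian.
Qed.

Lemma weight_star alpha X H : X != 0 -> root_space alpha X -> H \in h ->
  wt alpha (star H) = (wt alpha H)^*.
Proof.
move=> X0 /root_spaceP aX hH; have := hform_adjoint cs H X X.
rewrite !aX ?h_star// hformZl (hformZr cs) => E.
have nz : hform star K X X != 0 by rewrite gt_eqF// (hform_gt0 cs).
by move: E => /(mulIf nz) ->; rewrite conjCK.
Qed.

Lemma root_space_star alpha X : root_space alpha X -> root_space (- alpha) (star X).
Proof.
have [->|X0] := eqVneq X 0.
  by move=> _; rewrite (star0 cs); apply/root_spaceP => H _; rewrite lie0r scaler0.
move=> aX; apply/root_spaceP => H hH; move/root_spaceP: (aX) => a'X.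
rewrite -[H in LHS](starK cs) -(star_lie cs) lieC (starN cs) a'X ?h_star//.
by rewrite (weight_star X0 aX)// (starZ cs) conjCK wtNl scaleNr.
Qed.

Lemma root_orthogonal alpha beta X Y : root_space alpha X -> root_space beta Y ->
  beta != - alpha -> K X Y = 0.
Proof.
move=> /root_spaceP aX /root_spaceP bY nab.
apply/eqP/negPn/negP => KXY; case/eqP: nab; apply: wt_ext => H hH.
have := form_invariant cs X H Y; rewrite lieC aX// bY// formNl formZl formZr.
by rewrite -mulNr => /(mulIf KXY) <-; rewrite wtNl.
Qed.

Lemma root_decomposition :
  exists (e : (\dim {:g}).-tuple g) (al : 'I_(\dim {:g}) -> dual h),
    basis_of {:g} e /\ forall i : 'I_(\dim {:g}), root_space (al i) e`_i.
Proof.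
pose s := [seq v + star v | v <- vbasis h] ++
  [seq 'i *: (v - star v) | v <- vbasis h].
have sh X : X \in s -> X \in h.
  rewrite mem_cat => /orP[] /mapP[v /vbasis_mem vh ->]; first by rewrite memvD ?h_star.
  by rewrite memvZ// memvB ?h_star.
have [||e [eB eA]] := ad_selfadjoint_eigenbasis cs (s := s).
- move=> X; rewrite mem_cat => /orP[] /mapP[v _ ->].
    by rewrite (starD cs) (starK cs) addrC.
  by rewrite (starZ cs) (starB cs) (starK cs) conjCi scaleNr -scalerN opprB.
- by move=> X Y /sh hX /sh hY; apply: h_abelian.
have lineP (i : 'I_(\dim {:g})) X : X \in h -> lie X e`_i = coord e i (lie X e`_i) *: e`_i.
  pose L := [pred Y | lie Y e`_i == coord e i (lie Y e`_i) *: e`_i].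
  have LD X' Y : L X' -> L Y -> L (X' + Y).
    by rewrite /= lieDl linearD scalerDl => /eqP{1}-> /eqP{1}->.
  have LZ c Y : L Y -> L (c *: Y).
    by rewrite /= lieZl linearZ /= -scalerA => /eqP{1}->.
  have L0 : L 0 by rewrite /= lie0l linear0 scale0r.
  have Ls Y : Y \in s -> L Y.
    move=> /(eA _ i)[a _ E]; rewrite /= E linearZ /= coord_free ?(basis_free eB)//.
    by rewrite eqxx mulr1.
  move=> hX; apply/eqP; rewrite -[_ == _]/(L X) (coord_vbasis hX).
  elim/big_ind: _ => // j _; apply: (LZ).
  set v := _`_j; have vh : v \in vbasis h by rewrite mem_nth ?size_tuple.
  have -> : v = (2^-1) *: (v + star v) + (- 'i / 2) *: ('i *: (v - star v)).
    rewrite scalerA mulrAC mulNr -expr2 sqrCi opprK mul1r -scalerDr addrACA subrr addr0.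
    by rewrite scalerDr -scalerDl -[2^-1]mul1r -splitr scale1r.
  apply: LD; apply: LZ; apply: Ls; rewrite mem_cat.
    by rewrite (map_f (fun v => v + star v) vh).
  by rewrite (map_f (fun v => 'i *: (v - star v)) vh) orbT.
pose ev (i : 'I_(\dim {:g})) (H : subvs_of h) : C^o := coord e i (lie (vsval H) e`_i).
have ev_lin i : linear (ev i).
  by move=> c H H'; rewrite /ev linearP /= lieDl lieZl linearD linearZ.
pose evL i : {linear subvs_of h -> C^o} :=
  HB.pack (ev i) (GRing.isLinear.Build _ _ _ _ _ (ev_lin i)).
exists e, (fun i => linfun (evL i)); split=> // i H.
by rewrite lfunE /= [LHS]lineP ?subvsP.
Qed.

Lemma weight_ind (P : g -> Prop) : P 0 -> (forall X Y, P X -> P Y -> P (X + Y)) ->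
  (forall alpha X, root_space alpha X -> P X) -> forall X, P X.
Proof.
move=> P0 PD Pr X; have [e [al [eB e_root]]] := root_decomposition.
rewrite [X](coord_basis eB (memvf X)); elim/big_ind: _ => // i _.
by apply: (Pr (al i)); apply: root_spaceZ.
Qed.

(** A root vector has a nonzero coordinate in a basis of weight vectors, and comparing that
    coordinate in the eigenvalue equation identifies the root with the weight of the basis
    vector. *)
Lemma finite_roots : exists s : seq (dual h),
  forall alpha, is_root alpha -> alpha \in s.
Proof.
have [e [al [eB e_root]]] := root_decomposition.
exists (codom al) => alpha [_ [X X0 aX]].
have [i ci] : exists i, coord e i X != 0.
  apply/existsP; apply: contraNT X0; rewrite negb_exists => /forallP c0.
  rewrite [X](coord_basis eB (memvf X)) big1// => i _.
  by rewrite (eqP (negPn (c0 i))) scale0r.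
suff -> : alpha = al i by apply: codom_f.
apply: wt_ext => H hH.
have := (root_spaceP alpha X).1 aX H hH => /(congr1 (coord e i)).
rewrite linearZ /= {1}[X](coord_basis eB (memvf X)) lie_sumr.
rewrite (eq_bigr (fun j => (coord e j X * wt (al j) H) *: e`_j)); last first.
  by move=> j _; rewrite lieZr ((root_spaceP _ _).1 (e_root j))// scalerA.
rewrite coord_sum_free ?(basis_free eB)// mulrC.
by move/(mulIf ci).
Qed.

Lemma lie_star_root alpha X : root_space alpha X -> lie X (star X) \in h.
Proof.
move=> aX; apply/root_space0.
by rewrite -(subrr alpha); apply/root_space_lie/root_space_star.
Qed.

Lemma lie_star_form alpha X H : root_space alpha X -> H \in h ->
  K (lie X (star X)) H = K X (star X) * wt alpha H.
Proof.
move=> aX hH; rewrite (form_invariant cs) lieC.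
rewrite ((root_spaceP _ _).1 (root_space_star aX))// wtNl scaleNr opprK.
by rewrite formZr mulrC.
Qed.

Lemma form_star_neq0 X : X != 0 -> K X (star X) != 0.
Proof. by move=> X0; rewrite gt_eqF// (form_gt0 cs). Qed.

Lemma cartan_nondegenerate A : A \in h -> (forall H, H \in h -> K A H = 0) -> A = 0.
Proof. by move=> Ah A0; apply/(hform_eq0 cs)/A0/h_star. Qed.

Lemma dual_vectorP alpha H : is_root alpha -> H \in h ->
  K (vsval (dual_vector K alpha)) H = wt alpha H.
Proof.
move=> [_ [X X0 aX]] hH; rewrite -[H in LHS](vsprojK hH) /dual_vector.
set P := [set T | _].
have : P (xget 0 P).
  apply: xgetPex; exists (vsproj h ((K X (star X))^-1 *: lie X (star X))) => H'.
  rewrite vsprojK ?memvZ ?(lie_star_root aX)// formZl.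
  rewrite (lie_star_form aX) ?subvsP// mulKf ?form_star_neq0//.
  by rewrite /wt vsvalK.
by apply.
Qed.

Lemma dual_vectorE alpha X : alpha != 0 -> X != 0 -> root_space alpha X ->
  vsval (dual_vector K alpha) = (K X (star X))^-1 *: lie X (star X).
Proof.
move=> a0 X0 aX; have ra : is_root alpha by split; last by exists X.
apply/eqP; rewrite -subr_eq0; apply/eqP/cartan_nondegenerate.
  by rewrite memvB ?subvsP ?memvZ ?(lie_star_root aX).
move=> H hH; rewrite formDl formNl formZl dual_vectorP// (lie_star_form aX)//.
by rewrite mulKf ?form_star_neq0// subrr.
Qed.

Lemma star_dual_vector alpha : is_root alpha ->
  star (vsval (dual_vector K alpha)) = vsval (dual_vector K alpha).
Proof.
move=> [a0 [X X0 aX]]; rewrite (dual_vectorE a0 X0 aX) (starZ cs) (star_lie cs).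
by rewrite (starK cs) fmorphV /= -/(hform star K X X) -(hformC cs).
Qed.

Lemma dual_formE alpha beta : is_root alpha ->
  dual_form K alpha beta = wt alpha (vsval (dual_vector K beta)).
Proof. by move=> ra; rewrite /dual_form dual_vectorP ?subvsP. Qed.

Lemma dual_form_gt0 alpha : is_root alpha -> 0 < dual_form K alpha alpha.
Proof.
move=> ra; rewrite /dual_form -{2}(star_dual_vector ra) (form_gt0 cs)//.
apply/eqP => T0; case: (ra) => a0 _; case/eqP: a0; apply: wt_ext => H hH.
by rewrite -(dual_vectorP ra hH) T0 form0l wt0l.
Qed.

Lemma coroot_mem alpha : coroot K alpha \in h.
Proof. by rewrite memvZ ?subvsP. Qed.

Lemma star_coroot alpha : is_root alpha -> star (coroot K alpha) = coroot K alpha.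
Proof.
move=> ra; rewrite (starZ cs) star_dual_vector//.
by rewrite rmorphM fmorphV /= conjC_nat (CrealP (gtr0_real (dual_form_gt0 ra))).
Qed.

Lemma wt_coroot alpha : is_root alpha -> wt alpha (coroot K alpha) = 2.
Proof.
by move=> ra; rewrite wtZ -dual_formE// mulfVK// gt_eqF// dual_form_gt0.
Qed.

Lemma lie_coroot beta alpha X : root_space beta X ->
  lie (coroot K alpha) X = wt beta (coroot K alpha) *: X.
Proof. by move=> /root_spaceP bX; rewrite bX ?coroot_mem. Qed.

Section RootVector.
Variables (alpha : dual h) (E : g).
Hypotheses (ra : is_root alpha) (aE : root_space alpha E).
Hypothesis E_norm : K E (star E) = 2 / dual_form K alpha alpha.

Lemma root_vector_neq0 : E != 0.
Proof.
apply/eqP => E0; move/eqP: E_norm; rewrite E0 form0l eq_sym.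
by rewrite mulf_eq0 invr_eq0 pnatr_eq0 /= gt_eqF// dual_form_gt0.
Qed.

Lemma lie_root_vector : lie E (star E) = coroot K alpha.
Proof.
have [a0 _] := ra; rewrite /coroot (dual_vectorE a0 root_vector_neq0 aE).
by rewrite -E_norm scalerA mulfV ?scale1r// form_star_neq0 ?root_vector_neq0.
Qed.

(** Let Y be the part of X orthogonal to E. Then [E^*, Y] lies in h and is orthogonal to h, hence is
    0, and [hform_sl2] gives |[E, Y]|^2 = -2 |Y|^2, so Y = 0. *)
Lemma root_space_line X : root_space alpha X ->
  X = (K X (star E) / K E (star E)) *: E.
Proof.
move=> aX; apply/eqP; rewrite -subr_eq0; set c := _ / _.
pose Y := X - c *: E; rewrite -/Y; apply/eqP.
have nE : K E (star E) != 0 by rewrite form_star_neq0 ?root_vector_neq0.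
have aY : root_space alpha Y.
  by apply: root_spaceD => //; apply/root_spaceN/root_spaceZ.
have KY : K Y (star E) = 0 by rewrite formDl formNl formZl mulfVK// subrr.
have EY : lie (star E) Y = 0.
  apply: cartan_nondegenerate.
    apply/root_space0; rewrite -(addNr alpha).
    by apply: root_space_lie => //; apply: root_space_star.
  move=> H hH; rewrite lieC formNl (form_invariant cs) lieC formNr opprK.
  by rewrite ((root_spaceP _ _).1 (root_space_star aE))// formZr KY mulr0.
apply: (hform_eq0 cs); have := @hform_sl2 _ _ _ _ cs E Y 2.
rewrite lie_root_vector (lie_coroot _ aY) wt_coroot// => /(_ erefl).
rewrite EY {2}/hform form0l sub0r => HE.
have := hform_ge0 cs (lie E Y); rewrite HE oppr_ge0 pmulr_rle0 ?ltr0n// => le0.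
by apply: le_anti; rewrite le0 (hform_ge0 cs).
Qed.

End RootVector.

(** The lengths are elements of a partially ordered field; that they are positive, hence real, makes
    them comparable. *)
Lemma shortest_root alpha0 : is_root alpha0 -> exists2 alpha : dual h, is_root alpha &
  forall beta : dual h, is_root beta -> dual_form K alpha alpha <= dual_form K beta beta.
Proof.
have [s sP] := finite_roots.
pose rs := [seq a <- s | `[< is_root a >]].
have rsP (a : dual h) : (a \in rs) <-> is_root a.
  rewrite mem_filter; split=> [/andP[/asboolP//]|ra].
  by rewrite sP// andbT; apply/asboolP.
suff H (r : seq (dual h)) (a : dual h) : {subset r <= rs} -> a \in rs ->
    exists2 a' : dual h, a' \in rs &
    forall b : dual h, b \in a :: r -> dual_form K a' a' <= dual_form K b b.
  move=> /rsP ra0; have [//|a' /rsP ra' min_a'] := H rs alpha0 _ ra0.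
  by exists a' => // b /rsP rb; apply: min_a'; rewrite inE rb orbT.
elim: r a => [|b r IHr] a r_rs a_rs.
  by exists a => // b; rewrite inE => /eqP->.
have b_rs : b \in rs by apply: r_rs; rewrite mem_head.
have [x xr|a' a'_rs min_a'] := IHr b _ b_rs.
  by apply: r_rs; rewrite inE xr orbT.
have rl (c : dual h) : c \in rs -> dual_form K c c \is Num.real.
  by move=> /rsP rc; rewrite gtr0_real// dual_form_gt0.
have [le_aa'|le_a'a] := real_leP (rl _ a_rs) (rl _ a'_rs).
  exists a => // c; rewrite inE => /orP[/eqP->//|/min_a' /(le_trans le_aa')//].
exists a' => // c; rewrite inE => /orP[/eqP->|/min_a'//]; exact: ltW.
Qed.

End Weights.

Section LinearCombination.
Variables (C : fieldType) (V : lmodType C) (x y z w : V).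

(** Coordinates along four vectors that need not be independent: identities between combinations
    reduce to [ring] or [field] on the coefficients. *)
Definition lincomb (a b c d : C) : V := a *: x + b *: y + c *: z + d *: w.

Lemma lincombD a b c d a' b' c' d' :
  lincomb a b c d + lincomb a' b' c' d' =
  lincomb (a + a') (b + b') (c + c') (d + d').
Proof. rewrite /lincomb (addrACA _ (d *: w)) (addrACA _ (c *: z)) (addrACA _ (b *: y)).
by rewrite !scalerDl. Qed.

Lemma lincombZ k a b c d :
  k *: lincomb a b c d = lincomb (k * a) (k * b) (k * c) (k * d).
Proof. by rewrite /lincomb !scalerDr !scalerA. Qed.

Lemma lincombN a b c d :
  - lincomb a b c d = lincomb (- a) (- b) (- c) (- d).
Proof. by rewrite /lincomb !opprD -!scaleNr. Qed.

Lemma lincomb1 : x = lincomb 1 0 0 0.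
Proof. by rewrite /lincomb !scale0r scale1r !addr0. Qed.

Lemma lincomb2 : y = lincomb 0 1 0 0.
Proof. by rewrite /lincomb !scale0r scale1r !addr0 add0r. Qed.

Lemma lincomb3 : z = lincomb 0 0 1 0.
Proof. by rewrite /lincomb !scale0r scale1r !addr0 !add0r. Qed.

Lemma lincomb4 : w = lincomb 0 0 0 1.
Proof. by rewrite /lincomb !scale0r scale1r !add0r. Qed.

End LinearCombination.

(** * Strings of noncompact root vectors *)

Section GradedString.
Variables (C : numClosedFieldType) (g : lieAlgType C).
Variables (star : g -> g) (K : {symmetric g}).
Hypothesis cs : compact_structure star K.
Variable Z : g.
Hypothesis star_Z : star Z = - Z.
Hypothesis Z_cube : forall X, lie Z (lie Z (lie Z X)) = - lie Z X.

Lemma grade_cases (c : C) X : X != 0 -> lie Z X = c *: X ->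
  [\/ c = 0, c = 'i | c = - 'i].
Proof.
move=> X0 ZX; have := Z_cube X; rewrite !(ZX, lieZr, scalerA) => /eqP.
rewrite -addr_eq0 -scalerDl scaler_eq0 (negPf X0) orbF => E.
have : c * ((c - 'i) * (c + 'i)) == 0.
  by rewrite -subr_sqr sqrCi opprK mulrDr mulr1 expr2 mulrA.
rewrite !mulf_eq0 subr_eq0 addr_eq0 => /or3P[] /eqP ->.
- by constructor 1.
- by constructor 2.
- by constructor 3.
Qed.

Lemma grade2_eq0 X : lie Z X = (2 * 'i) *: X -> X = 0.
Proof.
move=> ZX; apply/eqP/negPn/negP => X0.
case: (grade_cases X0 ZX) => /eqP.
- by rewrite mulf_eq0 pnatr_eq0 (negPf (neq0Ci _)).
- rewrite -subr_eq0 -[X in _ - X]mul1r -mulrBl mulf_eq0 (negPf (neq0Ci _)) orbF.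
  by rewrite (_ : 2 - 1 = 1) ?oner_eq0//; ring.
- rewrite -subr_eq0 opprK -[X in _ + X]mul1r -mulrDl mulf_eq0 (negPf (neq0Ci _)).
  by rewrite orbF -[X in _ + X]/(1%:R) -natrD pnatr_eq0.
Qed.

Lemma star_grade c X : lie Z X = c *: X -> lie Z (star X) = c^* *: star X.
Proof.
move=> ZX; have /(congr1 star) := ZX; rewrite (star_lie cs) (starZ cs) star_Z.
by rewrite lieNr -lieC.
Qed.

Lemma grade_lie c c' X Y : lie Z X = c *: X -> lie Z Y = c' *: Y ->
  lie Z (lie X Y) = (c + c') *: lie X Y.
Proof. by move=> ZX ZY; rewrite lie_derivation ZX ZY lieZl lieZr scalerDl. Qed.

(** The bracket would have ad Z-eigenvalue 2i, which does not occur. *)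
Lemma grade_commute X Y : lie Z X = 'i *: X -> lie Z Y = 'i *: Y -> lie X Y = 0.
Proof.
move=> ZX ZY; apply: grade2_eq0.
by rewrite (grade_lie ZX ZY) mulrDl mul1r.
Qed.

Section String.
Variables (E x : g) (mu : C).
Local Notation F := (star E).
Local Notation H := (lie E F).
Hypotheses (ZE : lie Z E = 'i *: E) (HE : lie H E = 2 *: E).
Hypotheses (Zx : lie Z x = 'i *: x) (Hx : lie H x = mu *: x).
Local Notation y := (lie F x).
Local Notation z := (lie F y).

Let ZF : lie Z F = (- 'i) *: F.
Proof. by rewrite (star_grade ZE) conjCi. Qed.

Lemma string_grade1 : lie Z y = 0.
Proof. by rewrite (grade_lie ZF Zx) addNr scale0r. Qed.

Lemma string_grade2 : lie Z z = (- 'i) *: z.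
Proof.
by have := string_grade1; rewrite -(scale0r y) => /(grade_lie ZF) ->; rewrite addr0.
Qed.

Lemma string_E1 : lie E x = 0.
Proof. exact: grade_commute. Qed.

Lemma string_F3 : lie F z = 0.
Proof.
apply/eqP; rewrite -(star_eq0 cs); apply/eqP; rewrite (star_lie cs) (starK cs).
rewrite lieC (grade_commute ZE) ?oppr0//.
by rewrite (star_grade string_grade2) rmorphN /= conjCi opprK.
Qed.

Let HF : lie H F = (- 2) *: F.
Proof.
have /(congr1 star) := HE; rewrite !(star_lie cs) (starK cs) (starZ cs) conjC_nat.
by rewrite scaleNr lieC => <-; rewrite opprK.
Qed.

Let Hy : lie H y = (mu - 2) *: y.
Proof. by rewrite lie_derivation HF Hx lieZl lieZr -scalerDl addrC. Qed.

Let Hz : lie H z = (mu - 4) *: z.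
Proof.
rewrite lie_derivation HF Hy lieZl lieZr -scalerDl; congr (_ *: _); ring.
Qed.

Lemma string_E2 : lie E y = mu *: x.
Proof. by rewrite lie_derivation Hx string_E1 lie0r addr0. Qed.

Lemma string_E3 : lie E z = (2 * mu - 2) *: y.
Proof.
rewrite lie_derivation Hy string_E2 lieZr -scalerDl; congr (_ *: _); ring.
Qed.

(** The string stops after z, so [E, [F, z]] = 0; expanding it as [H, z] + [F, [E, z]] gives the
    factor (mu - 4) + (2 mu - 2). *)
Lemma string_cubic : (3 * mu - 6) *: z = 0.
Proof.
have := lie_derivation E F z; rewrite string_F3 lie0r Hz string_E3 lieZr.
by rewrite -scalerDl => /esym; have -> : mu - 4 + (2 * mu - 2) = 3 * mu - 6 by ring.
Qed.

(** According to the last nonzero term among x, y, z, the relation at the end of the string forces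
    mu = 0, 1 or 2. *)
Lemma string_cases : x != 0 -> [\/ mu = 0, mu = 1 | mu = 2].
Proof.
move=> x0; have := string_cubic; have := string_E3; have := string_E2.
have [->|z0 _ _ /eqP] := eqVneq z 0; last first.
  rewrite scaler_eq0 (negPf z0) orbF (_ : 3 * mu - 6 = 3 * (mu - 2)); last by ring.
  by rewrite mulf_eq0 pnatr_eq0 subr_eq0 => /eqP->; constructor 3.
rewrite lie0r; have [->|y0 _ /esym/eqP + _] := eqVneq y 0; last first.
  rewrite scaler_eq0 (negPf y0) orbF (_ : 2 * mu - 2 = 2 * (mu - 1)); last by ring.
  by rewrite mulf_eq0 pnatr_eq0 subr_eq0 => /eqP->; constructor 2.
by rewrite lie0r => /esym/eqP; rewrite scaler_eq0 (negPf x0) orbF => /eqP -> _ _; constructor 1.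
Qed.

(** Since [E, x] = 0, the identity [hform_sl2] reads |y|^2 = mu |x|^2. *)
Lemma string_weight0 : mu = 0 -> y = 0.
Proof.
move=> mu0; apply: (hform_eq0 cs); have := hform_sl2 cs Hx.
by rewrite string_E1 mu0 mul0r subr0 => <-; rewrite /hform form0l.
Qed.

Lemma string_weight1 : mu = 1 -> z = 0.
Proof.
move=> mu1; have /eqP := string_cubic; rewrite mu1 scaler_eq0.
by rewrite mulr1 subr_eq0 eqr_nat => /eqP.
Qed.

End String.
End GradedString.

(** * The r-matrix and the cascade *)

Section Cascade.
Variables (C : numClosedFieldType) (g : lieAlgType C).
Variables (star : g -> g) (K : {symmetric g}).
Hypothesis cs : compact_structure star K.
Variable h : {vspace g}.
Hypothesis h_abelian : forall H H', H \in h -> H' \in h -> lie H H' = 0.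
Hypothesis h_maximal : forall X, (forall H, H \in h -> lie H X = 0) -> X \in h.
Hypothesis h_star : forall H, H \in h -> star H \in h.
Variable Z : g.
Hypothesis h_Z : Z \in h.
Hypothesis star_Z : star Z = - Z.
Hypothesis Z_cube : forall X, lie Z (lie Z (lie Z X)) = - lie Z X.
Implicit Types (alpha beta : dual h).

Variables (pos : dual h -> Prop) (ps : seq (dual h)) (X : dual h -> g).
Hypothesis pos_asym : forall alpha, pos alpha -> ~ pos (- alpha).
Hypothesis pos_total : forall alpha, is_root alpha -> pos alpha \/ pos (- alpha).
Hypothesis pos_noncompact :
  forall alpha, is_root alpha -> wt alpha Z = 'i -> pos alpha.
Hypothesis ps_uniq : uniq ps.
Hypothesis psP : forall alpha, alpha \in ps <-> is_root alpha /\ pos alpha.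
Hypothesis X_root : forall alpha, is_root alpha -> pos alpha ->
  [/\ root_space alpha (X alpha),
      K (X alpha) (star (X alpha)) = 2 / dual_form K alpha alpha &
      X (- alpha) = star (X alpha)].

Let space_lie alpha H x : root_space alpha x -> H \in h -> lie H x = wt alpha H *: x.
Proof. by move=> /root_spaceP ax /ax. Qed.

Lemma is_root_vector alpha x : root_space alpha x -> x != 0 -> alpha != 0 ->
  is_root alpha.
Proof. by move=> ax x0 a0; split=> //; exists x. Qed.

Lemma is_rootN alpha : is_root alpha -> is_root (- alpha).
Proof.
move=> [a0 [x x0 ax]]; split; first by rewrite oppr_eq0.
by exists (star x); [rewrite (star_eq0 cs)|apply: (root_space_star cs h_star)].
Qed.

Lemma noncompact_neq0 alpha : wt alpha Z = 'i -> alpha != 0.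
Proof.
by move=> aZ; apply/eqP => a0; move/eqP: aZ; rewrite a0 wt0l eq_sym (negPf (neq0Ci _)).
Qed.

(* The operator attached to the r-matrix by the form: i on positive root      *)
(* spaces, -i on negative ones, 0 on h.                                       *)
Definition r_op p : g := \sum_(alpha <- ps) ('i * (dual_form K alpha alpha / 2)) *:
  (K (X (- alpha)) p *: X alpha - K (X alpha) p *: X (- alpha)).

Lemma r_opD p q : r_op (p + q) = r_op p + r_op q.
Proof.
rewrite /r_op -big_split /=; apply: eq_bigr => alpha _.
by rewrite -scalerDr !formDr !scalerDl opprD addrACA.
Qed.

Lemma r_opZ c p : r_op (c *: p) = c *: r_op p.
Proof.
rewrite /r_op scaler_sumr; apply: eq_bigr => alpha _.
rewrite !formZr -!(scalerA c) -scalerBr !scalerA.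
by congr (_ *: _); ring.
Qed.

Lemma r_op0 : r_op 0 = 0.
Proof. by have := r_opZ 0 0; rewrite !scale0r. Qed.

Lemma r_opN p : r_op (- p) = - r_op p.
Proof. by rewrite -scaleN1r r_opZ scaleN1r. Qed.

Lemma r_op_star p : r_op (star p) = star (r_op p).
Proof.
rewrite /r_op (star_sum cs) [in LHS]big_seq [in RHS]big_seq.
apply: eq_bigr => alpha /psP[ra pa]; have [ax _ XN] := X_root ra pa.
rewrite (starZ cs) (starB cs) !(starZ cs) XN (starK cs) !rmorphM fmorphV /=.
rewrite conjCi conjC_nat (CrealP (gtr0_real (dual_form_gt0 cs h_abelian h_maximal h_star ra))).
rewrite -!(form_star cs) (starK cs) mulNr scaleNr -scalerN opprB.
by congr (_ *: (_ - _)); rewrite formC.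
Qed.

Lemma r_op_cartan p : p \in h -> r_op p = 0.
Proof.
move=> hp; rewrite /r_op big_seq big1// => alpha /psP[ra pa].
have [ax _ XN] := X_root ra pa; have [a0 _] := ra.
have p0 : root_space (0 : dual h) p by apply/(root_space0 h_abelian h_maximal).
have nax := root_space_star cs h_star ax; rewrite -XN in nax.
rewrite (root_orthogonal cs nax p0) 1?(root_orthogonal cs ax p0).
- by rewrite !scale0r subrr scaler0.
- by rewrite eq_sym oppr_eq0.
- by rewrite opprK eq_sym.
Qed.

Lemma r_op_pos alpha p : is_root alpha -> pos alpha -> root_space alpha p ->
  r_op p = 'i *: p.
Proof.
move=> ra pa ap; have /psP aps := conj ra pa; have [ax nx XN] := X_root ra pa.
rewrite /r_op (bigD1_seq alpha)//= big_seq_cond big1 ?addr0; last first.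
  move=> beta /andP[/psP[rb pb] ba]; have [bx _ XNb] := X_root rb pb.
  rewrite (root_orthogonal cs bx ap) ?scale0r ?subr0; last first.
    by apply/eqP => E; apply: (pos_asym pb); rewrite -E.
  have nbx := root_space_star cs h_star bx; rewrite -XNb in nbx.
  by rewrite (root_orthogonal cs nbx ap) ?scale0r ?scaler0// opprK eq_sym.
rewrite (root_orthogonal cs ax ap) ?scale0r ?subr0; last first.
  by apply/eqP => E; apply: (pos_asym pa); rewrite -E.
have := root_space_line cs h_abelian h_maximal h_star ra ax nx ap.
rewrite nx => {2}->; rewrite XN (formC K (star _)) !scalerA; congr (_ *: _).
by rewrite invf_div; ring.
Qed.

Lemma r_op_neg alpha p : is_root alpha -> pos (- alpha) -> root_space alpha p ->
  r_op p = - 'i *: p.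
Proof.
move=> ra pa ap; rewrite -[in LHS](starK cs p) r_op_star.
rewrite (r_op_pos (is_rootN ra) pa); last exact: (root_space_star cs h_star).
by rewrite (starZ cs) (starK cs) conjCi.
Qed.

Lemma weight_cases alpha p : root_space alpha p ->
  [\/ p = 0, p \in h, is_root alpha /\ pos alpha | is_root alpha /\ pos (- alpha)].
Proof.
move=> ap; have [->|p0] := eqVneq p 0; first by constructor 1.
have [a0|a0] := eqVneq alpha 0.
  by constructor 2; apply/(root_space0 h_abelian h_maximal); rewrite -a0.
have ra := is_root_vector ap p0 a0.
by case: (pos_total ra) => pa; [constructor 3|constructor 4].
Qed.

Lemma r_op_scalar alpha p : root_space alpha p -> exists c, r_op p = c *: p.
Proof.
move=> ap; case: (weight_cases ap) => [->|hp|[ra pa]|[ra pa]].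
- by exists 0; rewrite r_op0 scaler0.
- by exists 0; rewrite r_op_cartan// scale0r.
- by exists 'i; rewrite (r_op_pos ra pa ap).
- by exists (- 'i); rewrite (r_op_neg ra pa ap).
Qed.

Lemma r_op_weight alpha p : root_space alpha p -> root_space alpha (r_op p).
Proof. by move=> ap; have [c ->] := r_op_scalar ap; apply: root_spaceZ. Qed.

Lemma lie_r_op H p : H \in h -> lie H (r_op p) = r_op (lie H p).
Proof.
move=> hH; elim/(weight_ind cs h_abelian h_star): p => [|p q|alpha p ap].
- by rewrite lie0r r_op0 lie0r.
- by rewrite r_opD !lieDr r_opD => -> ->.
- by rewrite (space_lie (r_op_weight ap))// (space_lie ap)// r_opZ.
Qed.

(** The order begins with -iZ, so the roots with value i at Z are positive and those with value -i
    are negative: on both, [r_op] and ad Z have the same eigenvalue. *)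
Lemma r_op_noncompact p : lie Z (lie Z p) = - p -> r_op p = lie Z p.
Proof.
move=> ZZp; rewrite -[p in LHS]opprK -ZZp r_opN.
(* With p replaced by [Z, [Z, p]] the identity holds for every p, and induction on weight vectors
   applies. *)
suff -> : r_op (lie Z (lie Z p)) = lie Z (lie Z (lie Z p)).
  by rewrite Z_cube opprK.
move: p {ZZp}; apply: (weight_ind cs h_abelian h_star) => [|p q|alpha p ap].
- by rewrite !lie0r r_op0.
- by rewrite !lieDr r_opD => -> ->.
have [->|p0] := eqVneq p 0; first by rewrite !lie0r r_op0.
have ZpE := space_lie ap h_Z.
rewrite !(ZpE, lieZr) !r_opZ.
case: (grade_cases Z_cube p0 ZpE) => aZ.
- by rewrite aZ !scale0r.
- have ra : is_root alpha by apply: (is_root_vector ap p0); apply: noncompact_neq0.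
  by rewrite (r_op_pos ra (pos_noncompact ra aZ) ap) aZ.
- have aZ' : wt (- alpha) Z = 'i by rewrite wtNl aZ opprK.
  have ra' : is_root (- alpha).
    apply: (is_root_vector (root_space_star cs h_star ap)).
      by rewrite (star_eq0 cs).
    exact: noncompact_neq0.
  have ra : is_root alpha by rewrite -[alpha]opprK; apply: is_rootN.
  by rewrite (r_op_neg ra (pos_noncompact ra' aZ') ap) aZ.
Qed.

Variable gam : seq (dual h).
Local Notation n := (size gam).
Hypothesis gam_root : forall i, (i < n)%N -> is_root gam`_i /\ wt gam`_i Z = 'i.
Hypothesis gam_orthogonal : forall i j, (j < i < n)%N ->
  wt gam`_i (coroot K gam`_j) = 0.
Hypothesis gam_max : forall i beta, (i < n)%N -> is_root beta ->
  wt beta Z = 'i -> (forall j, (j < i)%N -> wt beta (coroot K gam`_j) = 0) ->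
  beta = gam`_i \/ pos (gam`_i - beta).
Hypothesis gam_end : forall beta, is_root beta -> wt beta Z = 'i ->
  exists2 i, (i < n)%N & wt beta (coroot K gam`_i) != 0.

Local Notation E := (fun i : 'I_n => X gam`_i).
Local Notation F i := (star (X gam`_i)).
Local Notation H i := (coroot K gam`_i).

Let gam_rootP (i : 'I_n) : is_root gam`_i /\ wt gam`_i Z = 'i.
Proof. exact: gam_root. Qed.

Let E_root (i : 'I_n) : root_space gam`_i (X gam`_i).
Proof.
by have [ri iZ] := gam_rootP i; have [] := X_root ri (pos_noncompact ri iZ).
Qed.

Let E_norm (i : 'I_n) :
  K (X gam`_i) (F i) = 2 / dual_form K gam`_i gam`_i.
Proof.
by have [ri iZ] := gam_rootP i; have [] := X_root ri (pos_noncompact ri iZ).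
Qed.

Let F_root (i : 'I_n) : root_space (- gam`_i) (F i).
Proof. exact: (root_space_star cs h_star). Qed.

Let EF (i : 'I_n) : lie (X gam`_i) (F i) = H i.
Proof. exact: (lie_root_vector cs h_abelian h_maximal h_star (gam_rootP i).1). Qed.

Let E_neq0 (i : 'I_n) : X gam`_i != 0.
Proof. exact: (root_vector_neq0 cs h_abelian h_maximal h_star (gam_rootP i).1 (E_norm i)). Qed.

Let ZE (i : 'I_n) : lie Z (X gam`_i) = 'i *: X gam`_i.
Proof. by rewrite (space_lie (E_root i)) ?(gam_rootP i).2. Qed.

Let HE (i : 'I_n) : lie (lie (X gam`_i) (F i)) (X gam`_i) = 2 *: X gam`_i.
Proof.
rewrite EF (space_lie (E_root i)) ?coroot_mem//.
by rewrite (wt_coroot cs h_abelian h_maximal h_star (gam_rootP i).1).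
Qed.

Lemma cascade_EE (i j : 'I_n) : lie (X gam`_i) (X gam`_j) = 0.
Proof. exact: (grade_commute Z_cube). Qed.

(** For i < j the root gamma_j vanishes on the coroot H_i, so its string under the i-th sl2 is
    trivial; applying the involution gives the other order. The cascade roots are thus strongly
    orthogonal. *)
Lemma cascade_FE (i j : 'I_n) : i != j -> lie (F i) (X gam`_j) = 0.
Proof.
have lt_case (k l : 'I_n) : (k < l)%N -> lie (F k) (X gam`_l) = 0.
  move=> kl; apply: (string_weight0 cs Z_cube (ZE k) (ZE l) _ (erefl 0)).
  by rewrite EF (space_lie (E_root l)) ?coroot_mem// gam_orthogonal ?kl/=.
rewrite -val_eqE neq_ltn => /orP[/lt_case//|/lt_case FE].
have /(congr1 star) := FE; rewrite (star_lie cs) (starK cs) (star0 cs) => FE'.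
exact: FE'.
Qed.

Lemma cascade_EF (i j : 'I_n) : i != j -> lie (X gam`_i) (F j) = 0.
Proof. by rewrite eq_sym lieC => /cascade_FE ->; rewrite oppr0. Qed.

Lemma cascade_orthogonal (i j : 'I_n) : i != j -> wt gam`_j (H i) = 0.
Proof.
move=> ij; have := space_lie (E_root j) (coroot_mem K gam`_i).
rewrite -EF => /esym/eqP; have := lie_derivation (X gam`_i) (F i) (X gam`_j).
rewrite cascade_FE// cascade_EE !lie0r addr0 => <-.
by rewrite scaler_eq0 (negPf (E_neq0 j)) orbF => /eqP.
Qed.

(** The raising operator of the diagonal sl2 in the product of the commuting sl2 subalgebras of the
    cascade, with [SH] as its semisimple element. *)
Definition SE := \sum_(i < n) X gam`_i.

Lemma star_SE : star SE = \sum_(i < n) F i.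
Proof. exact: (star_sum cs). Qed.

Definition SH := \sum_(i < n) H i.

Lemma SH_mem : SH \in h.
Proof. by apply: memv_suml => i _; apply: coroot_mem. Qed.

Lemma lie_SE_star : lie SE (star SE) = SH.
Proof.
rewrite star_SE lie_suml; apply: eq_bigr => i _.
rewrite lie_sumr (bigD1 i)//= EF big1 ?addr0// => j ji.
by rewrite cascade_EF// eq_sym.
Qed.

Let wt_SH (i : 'I_n) : wt gam`_i SH = 2.
Proof.
rewrite /SH wt_sum (bigD1 i)//= (wt_coroot cs h_abelian h_maximal h_star (gam_rootP i).1).
by rewrite big1 ?addr0// => j ji; rewrite cascade_orthogonal.
Qed.

Let HSE : lie (lie SE (star SE)) SE = 2 *: SE.
Proof.
rewrite lie_SE_star /SE lie_sumr scaler_sumr; apply: eq_bigr => i _.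
by rewrite (space_lie (E_root i)) ?SH_mem// wt_SH.
Qed.

Let ZSE : lie Z SE = 'i *: SE.
Proof. by rewrite /SE lie_sumr scaler_sumr; apply: eq_bigr => i _; rewrite ZE. Qed.

Section NoncompactRoot.
Variables (beta : dual h) (x : g).
Hypotheses (beta_root : is_root beta) (beta_Z : wt beta Z = 'i).
Hypotheses (bx : root_space beta x) (x0 : x != 0).

Let Zx : lie Z x = 'i *: x.
Proof. by rewrite (space_lie bx) ?beta_Z. Qed.

Let Hx (i : 'I_n) : lie (lie (X gam`_i) (F i)) x = wt beta (H i) *: x.
Proof. by rewrite EF (space_lie bx) ?coroot_mem. Qed.

Let SHx : lie (lie SE (star SE)) x = wt beta SH *: x.
Proof. by rewrite lie_SE_star (space_lie bx) ?SH_mem. Qed.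

Let y (i : 'I_n) := lie (F i) x.

Let Ey (i j : 'I_n) : i != j -> lie (X gam`_i) (y j) = 0.
Proof.
move=> ij; rewrite lie_derivation cascade_EF// lie0l add0r.
by rewrite (grade_commute Z_cube (ZE i) Zx) lie0r.
Qed.

Let Eyi (i : 'I_n) : lie (X gam`_i) (y i) = wt beta (H i) *: x.
Proof. exact: (string_E2 Z_cube (ZE i) Zx (Hx i)). Qed.

Let y_root (i : 'I_n) : root_space (beta - gam`_i) (y i).
Proof. by rewrite addrC; apply: root_space_lie. Qed.

Let y_weight0 (i : 'I_n) : wt beta (H i) = 0 -> y i = 0.
Proof. exact: (string_weight0 cs Z_cube (ZE i) Zx (Hx i)). Qed.

Let y_sum : lie (star SE) x = \sum_(i < n) y i.
Proof. by rewrite star_SE lie_suml. Qed.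

(** By [string_cases], each beta(H_i) is 0, 1 or 2, and so is their sum beta(SH), by the same lemma
    for the diagonal sl2. Not all of them vanish, by [gam_end]. *)
Lemma cascade_pattern :
  [\/ exists2 i : 'I_n, wt beta (H i) = 1 &
        forall k : 'I_n, k != i -> wt beta (H k) = 0,
      exists2 i : 'I_n, wt beta (H i) = 2 &
        forall k : 'I_n, k != i -> wt beta (H k) = 0 |
      exists i j : 'I_n, [/\ (i < j)%N, wt beta (H i) = 1, wt beta (H j) = 1 &
        forall k : 'I_n, k != i -> k != j -> wt beta (H k) = 0] ].
Proof.
pose l (i : 'I_n) := if wt beta (H i) == 0 then 0%N else
  if wt beta (H i) == 1 then 1%N else 2%N.
have lE (i : 'I_n) : wt beta (H i) = (l i)%:R.
  rewrite /l; case: (string_cases cs star_Z Z_cube (ZE i) (HE i) Zx (Hx i) x0) => ->.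
  - by rewrite eqxx.
  - by rewrite oner_eq0 eqxx.
  - by rewrite pnatr_eq0 (eqr_nat C 2 1).
have sE : wt beta SH = (\sum_(i < n) l i)%:R.
  by rewrite /SH wt_sum natr_sum; apply: eq_bigr => i _; rewrite lE.
have le2 : (\sum_(i < n) l i <= 2)%N.
  case: (string_cases cs star_Z Z_cube ZSE HSE Zx SHx x0); rewrite sE => /eqP;
    by rewrite ?pnatr_eq0 ?pnatr_eq1 ?eqr_nat => /eqP->.
have [i0 i0n li0] := gam_end beta_root beta_Z.
pose i := Ordinal i0n; have {}li0 : l i != 0%N.
  by apply: contraNneq li0 => li; rewrite -[i0]/(val i) lE li.
have [allz|/forallPn[j]] := boolP [forall k, (k != i) ==> (l k == 0%N)].
  have lk k : k != i -> wt beta (H k) = 0.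
    by move=> ki; rewrite lE; move/forallP: allz => /(_ k); rewrite ki => /eqP->.
  have : (l i <= 2)%N by rewrite (leq_trans _ le2)// (bigD1 i)//= leq_addr.
  case Eli: (l i) li0 => [|[|[|]]]// _ _.
    by constructor 1; exists i; rewrite // lE Eli.
  by constructor 2; exists i; rewrite // lE Eli.
rewrite negb_imply => /andP[ji lj].
have : (l i + l j + \sum_(k < n | (k != i) && (k != j)) l k <= 2)%N.
  by move: le2; rewrite (bigD1 i)//= (bigD1 j)//= addnA.
set s := (\sum_(k < n | _) _)%N => le3.
have [li1 lj1 s0] : [/\ l i = 1%N, l j = 1%N & s = 0%N].
  by split; move: le3 li0 lj; lia.
have lk k : k != i -> k != j -> wt beta (H k) = 0.
  move=> ki kj; move/eqP: s0; rewrite sum_nat_eq0 => /forallP/(_ k).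
  by rewrite ki kj /= lE => /eqP->.
constructor 3; move: ji; rewrite -val_eqE neq_ltn => /orP[ji|ij].
  by exists j, i; split; rewrite ?lE ?li1 ?lj1// => k kj ki; apply: lk.
by exists i, j; split; rewrite ?lE ?li1 ?lj1.
Qed.

(* When beta(H_i) = 1 and beta is orthogonal to the earlier cascade roots,    *)
(* maximality of gamma_i makes beta - gamma_i negative.  When moreover        *)
(* beta(H_j) = 1 with i < j, the reflected root gamma_i + gamma_j - beta is   *)
(* also below gamma_i, so beta - gamma_j is positive.                         *)
Lemma cascade_string (y' := lie (star SE) x) (z := lie (star SE) y') :
  [/\ lie SE y' = x, z = 0 & r_op y' = - 'i *: y'] \/
  [/\ lie SE y' = 2 *: x, lie SE z = 2 *: y', lie SE (r_op y') = 0 &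
      lie (star SE) (r_op y') = 0].
Proof.
have E_y (i : 'I_n) : lie SE (y i) = wt beta (H i) *: x.
  rewrite /SE lie_suml (bigD1 i)//= Eyi big1 ?addr0// => j ji.
  by rewrite Ey.
have wtS : wt beta SH = \sum_(i < n) wt beta (H i) by rewrite /SH wt_sum.
have SEy : lie SE y' = wt beta SH *: x by exact: (string_E2 Z_cube ZSE Zx SHx).
have SEz : lie SE z = (2 * wt beta SH - 2) *: y'.
  exact: (string_E3 cs Z_cube ZSE HSE Zx SHx).
have ri (i : 'I_n) : is_root gam`_i := (gam_rootP i).1.
have beta_max (i : 'I_n) : wt beta (H i) = 1 ->
    (forall k : 'I_n, (k < i)%N -> wt beta (H k) = 0) -> r_op (y i) = - 'i *: y i.
  move=> bi bk.
  have yi0 : y i != 0.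
    by apply: contraNneq x0 => yi; rewrite -[x]scale1r -bi -Eyi yi lie0r.
  have bgi : beta <> gam`_i.
    move=> bgi; move/eqP: bi; rewrite bgi.
    by rewrite (wt_coroot cs h_abelian h_maximal h_star (ri i)) (eqr_nat C 2 1).
  have bgi0 : beta - gam`_i != 0 by rewrite subr_eq0; apply/eqP.
  apply: (r_op_neg (is_root_vector (y_root i) yi0 bgi0) _ (y_root i)).
  rewrite opprB; have [//|/bgi//|//] := @gam_max i beta (ltn_ord i) beta_root beta_Z.
  by move=> j ji; have := bk (Ordinal (ltn_trans ji (ltn_ord i))) ji.
case: cascade_pattern => [[i bi bk]|[i bi bk]|[i [j [ij bi bj bk]]]].
- left; have m1 : wt beta SH = 1.
    by rewrite wtS (bigD1 i)//= bi big1 ?addr0// => k ki; rewrite bk.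
  have yE : y' = y i.
    by rewrite /y' y_sum (bigD1 i)//= big1 ?addr0// => k ki; rewrite y_weight0 ?bk.
  split; first by rewrite SEy m1 scale1r.
    exact: (string_weight1 cs star_Z Z_cube ZSE HSE Zx SHx).
  rewrite yE beta_max// => k ki; apply: bk.
  by apply: contraTneq ki => ->; rewrite ltnn.
- right; have m2 : wt beta SH = 2.
    by rewrite wtS (bigD1 i)//= bi big1 ?addr0// => k ki; rewrite bk.
  have yE : y' = y i.
    by rewrite /y' y_sum (bigD1 i)//= big1 ?addr0// => k ki; rewrite y_weight0 ?bk.
  have r0 : r_op y' = 0.
    have yi0 : y i != 0.
      apply: contraNneq x0 => yi; have := Eyi i; rewrite yi lie0r bi => /esym/eqP.
      by rewrite scaler_eq0 pnatr_eq0.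
    have zi0 : lie (F i) (y i) != 0.
      apply: contraNneq yi0 => zi.
      have := string_E3 cs Z_cube (ZE i) (HE i) Zx (Hx i).
      rewrite -/(y i) zi lie0r bi (_ : 2 * 2 - 2 = 2) ?natr1; last by ring.
      by move/esym/eqP; rewrite scaler_eq0 pnatr_eq0.
    have ziR : root_space (gam`_i + gam`_i - beta) (star (lie (F i) (y i))).
      rewrite -opprB; apply: (root_space_star cs h_star).
      have -> : beta - (gam`_i + gam`_i) = - gam`_i + (beta - gam`_i).
        by rewrite opprD [RHS]addrCA.
      exact: root_space_lie.
    have b'Z : wt (gam`_i + gam`_i - beta) Z = 'i.
      by rewrite wtBl wtDl (gam_rootP i).2 beta_Z addrK.
    have b'r : is_root (gam`_i + gam`_i - beta).
      apply: (is_root_vector ziR); first by rewrite (star_eq0 cs).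
      exact: noncompact_neq0.
    (* If beta differed from gamma_i, maximality would make gamma_i - beta positive. The reflection
       2 gamma_i - beta is also a noncompact root orthogonal to the earlier cascade roots, and
       maximality would make beta - gamma_i positive too. *)
    have bgi : beta = gam`_i.
      have bj0 j : (j < i)%N -> wt beta (H j) = 0.
        move=> ji; apply: (bk (Ordinal (ltn_trans ji (ltn_ord i)))).
        by rewrite -val_eqE /= ltn_eqF.
      have [//|pb] := gam_max (ltn_ord i) beta_root beta_Z bj0.
      have [j ji||pb'] := gam_max (ltn_ord i) b'r b'Z.
      - by rewrite wtBl wtDl bj0// gam_orthogonal ?ji/= // subr0 addr0.
      - by move/eqP; rewrite -addrA -[X in _ == X]addr0 (inj_eq (addrI _)) subr_eq0 => /eqP.
      case: (pos_asym pb); move: pb'; congr pos.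
      by rewrite !opprB addrCA opprD addNKr.
    rewrite yE r_op_cartan//; apply/(root_space0 h_abelian h_maximal).
    by have := y_root i; rewrite bgi subrr.
  rewrite r0 !lie0r SEy SEz m2; split=> //; congr (_ *: _); ring.
- have ij' : i != j by rewrite -val_eqE /= ltn_eqF.
  have ji' : j != i by rewrite eq_sym.
  have m2 : wt beta SH = 2.
    rewrite wtS (bigD1 i)//= (bigD1 j) ?(eq_sym j)//= bi bj big1 ?addr0//.
    by move=> k /andP[ki kj]; rewrite bk.
  have yE : y' = y i + y j.
    rewrite /y' y_sum (bigD1 i)//= (bigD1 j) ?(eq_sym j)//= big1 ?addr0//.
    by move=> k /andP[ki kj]; rewrite y_weight0 ?bk.
  have bk0 (k : 'I_n) : (k < i)%N -> wt beta (H k) = 0.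
    by move=> ki; apply: bk; rewrite -val_eqE /= ltn_eqF// (ltn_trans ki).
  have ryi : r_op (y i) = - 'i *: y i by apply: beta_max.
  have bgj : beta <> gam`_j.
    move=> bgj; move/eqP: bj; rewrite bgj.
    by rewrite (wt_coroot cs h_abelian h_maximal h_star (ri j)) (eqr_nat C 2 1).
  have nz (k : 'I_n) : wt beta (H k) = 1 -> y k != 0.
    by move=> bk1; apply: contraNneq x0 => yk; rewrite -[x]scale1r -bk1 -Eyi yk lie0r.
  have ryj : r_op (y j) = 'i *: y j.
    have bgj0 : beta - gam`_j != 0 by rewrite subr_eq0; apply/eqP.
    apply: (r_op_pos (is_root_vector (y_root j) (nz j bj) bgj0) _ (y_root j)).
    pose z' := lie (F j) (y i).
    (* Bracketing with X_(gamma_j) recovers y_i, because (beta - gamma_i)(H_j) = 1 and X_(gamma_j)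
       kills y_i. *)
    have z'0 : z' != 0.
      apply: contraNneq (nz i bi) => z'0.
      have := lie_derivation (X gam`_j) (F j) (y i).
      rewrite -/z' z'0 lie0r (Ey ji') lie0r addr0 EF.
      rewrite (space_lie (y_root i)) ?coroot_mem// wtBl bj.
      by rewrite cascade_orthogonal// subr0 scale1r => <-.
    have z'R : root_space (gam`_i + gam`_j - beta) (star z').
      rewrite -opprB; apply: (root_space_star cs h_star).
      have -> : beta - (gam`_i + gam`_j) = - gam`_j + (beta - gam`_i).
        by rewrite [RHS]addrCA opprD [- gam`_i - _]addrC.
      exact: root_space_lie.
    have b'Z : wt (gam`_i + gam`_j - beta) Z = 'i.
      by rewrite wtBl wtDl !(gam_rootP _).2 beta_Z addrK.
    have b'r : is_root (gam`_i + gam`_j - beta).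
      apply: (is_root_vector z'R); first by rewrite (star_eq0 cs).
      exact: noncompact_neq0.
    have [k ki|/eqP|] := gam_max (ltn_ord i) b'r b'Z.
    - have kn := ltn_trans ki (ltn_ord i).
      rewrite wtBl wtDl (bk0 (Ordinal kn))// !gam_orthogonal ?ki/= ?subr0 ?addr0//.
      by rewrite (ltn_trans ki) /=.
    - by rewrite -subr_eq0 addrAC [_ + gam`_j]addrC addrK subr_eq0 => /eqP/esym.
    by congr pos; rewrite opprB opprD addrA [gam`_i + _]addrC addrA addrK.
  right.
  have rE : r_op y' = 'i *: (y j - y i).
    by rewrite yE r_opD ryi ryj scaleNr addrC -scalerBr.
  have Er : lie SE (r_op y') = 0.
    by rewrite rE lieZr lieBr !E_y bi bj subrr scaler0.
  rewrite SEy SEz m2 Er; split=> //; first by congr (_ *: _); ring.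
  (* The vector i (y_j - y_i) is killed by E and has weight 0 under [E, E^*], so E^* kills it as
     well. *)
  apply: (hform_eq0 cs).
  have := @hform_sl2 _ _ _ _ cs SE (r_op y') 0; rewrite Er mul0r subr0.
  move=> <-; first by rewrite /hform form0l.
  have yw (k : 'I_n) : wt beta (H k) = 1 -> lie SH (y k) = 0.
    move=> bk1; rewrite (space_lie (y_root k)) ?SH_mem// wtBl wt_SH m2.
    by rewrite subrr scale0r.
  by rewrite lie_SE_star rE lieZr lieBr !yw// subrr scaler0 scale0r.
Qed.

End NoncompactRoot.

(** * Rotation of the strings and the two criteria *)

Section Rotation.
(* G stands for Ad(exp(i theta (E + E^* ))), with c1, s1 (resp. c2, s2) the   *)
(* cosine and sine of theta (resp. 2 theta).                                  *)
Variables (c1 s1 c2 s2 : C) (G : g -> g).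
Hypotheses (s2_real : s2^* = s2) (c2_real : c2^* = c2).
Hypothesis cs1 : c1 ^+ 2 + s1 ^+ 2 = 1.
Hypotheses (c2E : c2 = c1 ^+ 2 - s1 ^+ 2) (s2E : s2 = 2 * c1 * s1).
Hypothesis GD : {morph G : x y / x + y}.
Hypothesis GZ : forall c x, G (c *: x) = c *: G x.
Hypothesis G_lie : forall x y, G (lie x y) = lie (G x) (G y).
Hypothesis G_form : forall x y, K (G x) (G y) = K x y.
Hypothesis G_star : forall x, star (G x) = G (star x).
Local Notation A := (SE + star SE).
Hypothesis G0 : forall x, lie A x = 0 -> G x = x.
Hypothesis G1 : forall x, lie A x = x -> G x = (c1 + 'i * s1) *: x.
Hypothesis GN1 : forall x, lie A x = - x -> G x = (c1 - 'i * s1) *: x.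
Hypothesis G2 : forall x, lie A x = 2 *: x -> G x = (c2 + 'i * s2) *: x.
Hypothesis GN2 : forall x, lie A x = - 2 *: x -> G x = (c2 - 'i * s2) *: x.

Let ii : 'i * 'i = -1 :> C.
Proof. by rewrite -expr2 sqrCi. Qed.

Let cs2 : c2 ^+ 2 + s2 ^+ 2 = 1.
Proof.
have -> : c2 ^+ 2 + s2 ^+ 2 = (c1 ^+ 2 + s1 ^+ 2) ^+ 2 by rewrite c2E s2E; ring.
by rewrite cs1 expr1n.
Qed.

Let GN x : G (- x) = - G x.
Proof. by rewrite -scaleN1r GZ scaleN1r. Qed.

(** On the span of x, y, z the rotation is an explicit 3 by 3 matrix, while w is fixed by it. The
    sine term comes from [r_op] being i, -i on the two ends and sending y to the invariant vector
    w. *)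
Lemma rotation_spin1 x y (z := lie (star SE) y) (w := r_op y) :
  lie (star SE) x = y -> lie SE x = 0 ->
  lie SE y = 2 *: x -> lie SE z = 2 *: y -> lie (star SE) z = 0 ->
  lie SE w = 0 -> lie (star SE) w = 0 ->
  r_op x = 'i *: x -> r_op z = - 'i *: z ->
  r_op (G x) = G (('i * c2) *: x + (s2 / 2) *: (y + 'i *: w)).
Proof.
move=> Fx Ex Ey Ez Fz Ew Fw rx rz.
pose L := lincomb x y z w.
have [xL yL zL wL] : [/\ x = L 1 0 0 0, y = L 0 1 0 0, z = L 0 0 1 0 & w = L 0 0 0 1].
  by split; [apply: lincomb1|apply: lincomb2|apply: lincomb3|apply: lincomb4].
have LD a b c d a' b' c' d' : L a b c d + L a' b' c' d' =
  L (a + a') (b + b') (c + c') (d + d') by exact: lincombD.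
have LZ k a b c d : k *: L a b c d = L (k * a) (k * b) (k * c) (k * d).
  exact: lincombZ.
have LN a b c d : - L a b c d = L (- a) (- b) (- c) (- d) by exact: lincombN.
have AL a b c d : lie A (L a b c d) = L (2 * b) (a + 2 * c) b 0.
  rewrite {1}/L /lincomb !lieDr !lieZr !(lieDl _ SE) Fx Ex Ey Ez Fz Ew Fw -/z.
  rewrite [in LHS]xL [in LHS]yL [in LHS]zL !addr0 !add0r !scaler0 ?addr0.
  by rewrite !(LD, LZ); congr L; ring.
have two : (2 : C) != 0 by rewrite pnatr_eq0.
have GL a b c d : G (L a b c d) = 
   L ((c2 + 1) / 2 * a + 'i * s2 * b + (c2 - 1) * c)
     ('i * s2 / 2 * a + c2 * b + 'i * s2 * c)
     ((c2 - 1) / 4 * a + 'i * s2 / 2 * b + (c2 + 1) / 2 * c) d.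
  (* The vectors (2, 2, 1), (2, -2, 1), (-2, 0, 1) in x, y, z are eigenvectors of ad A with
     eigenvalues 2, -2, 0, and w has eigenvalue 0. *)
  have -> : L a b c d = (a / 8 + b / 4 + c / 4) *: L 2 2 1 0
     + (a / 8 - b / 4 + c / 4) *: L 2 (- 2) 1 0
     + (c / 2 - a / 4) *: L (- 2) 0 1 0 + d *: w.
    by rewrite [in RHS]wL !(LD, LZ); congr L; field.
  rewrite !GD !GZ (G2 (x := L 2 2 1 0)); last by rewrite AL LZ; congr L; ring.
  rewrite (GN2 (x := L 2 (- 2) 1 0)); last by rewrite AL LZ; congr L; ring.
  rewrite (G0 (x := L (-2) 0 1 0)); last first.
    rewrite AL; transitivity (0 *: L 0 0 0 0); last by rewrite scale0r.
    by rewrite LZ; congr L; ring.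
  rewrite (G0 (x := w)); last by rewrite lieDl Ew Fw addr0.
  by rewrite wL !(LD, LZ); congr L; field.
have -> : y + 'i *: w = L 0 1 0 'i by rewrite [in LHS]yL wL !(LD, LZ); congr L; ring.
rewrite [in RHS]xL !(LD, LZ) GL [in LHS]xL GL.
have rL a b c : r_op (L a b c 0) = L ('i * a) 0 (- 'i * c) b.
  rewrite /L /lincomb !r_opD !r_opZ rx rz -/w !scale0r !addr0 !scalerA.
  by rewrite [a * _]mulrC [c * _]mulrC addrAC.
have s22 : s2 * s2 = 1 - c2 * c2 by rewrite -cs2; ring.
have four : (4 : C) = 2 * 2 by ring.
rewrite rL four invfM; move: (2^-1) (mulVf two) => k k2.
congr L.
- by ring: ii s22.
- by ring: ii s22.
- by ring: ii s22.
- by ring: ii s22.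
Qed.

(** Here ad A exchanges x and y, so x + y and x - y are eigenvectors and G is a rotation by theta in
    the plane of x and y. *)
Lemma rotation_spin_half x y :
  lie (star SE) x = y -> lie SE x = 0 -> lie SE y = x -> lie (star SE) y = 0 ->
  r_op x = 'i *: x -> r_op y = - 'i *: y ->
  r_op (G x) = G (('i * c2) *: x + s2 *: y).
Proof.
move=> Fx Ex Ey Fy rx ry.
pose L := lincomb x y 0 0.
have [xL yL] : x = L 1 0 0 0 /\ y = L 0 1 0 0.
  by split; [apply: lincomb1|apply: lincomb2].
have LD a b c d a' b' c' d' : L a b c d + L a' b' c' d' =
  L (a + a') (b + b') (c + c') (d + d') by exact: lincombD.
have LZ k a b c d : k *: L a b c d = L (k * a) (k * b) (k * c) (k * d).
  exact: lincombZ.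
have LN a b c d : - L a b c d = L (- a) (- b) (- c) (- d) by exact: lincombN.
have Ax : lie A x = y by rewrite lieDl Ex Fx add0r.
have Ay : lie A y = x by rewrite lieDl Ey Fy addr0.
have two : (2 : C) != 0 by rewrite pnatr_eq0.
have Gxy : G (x + y) = (c1 + 'i * s1) *: (x + y).
  by apply: G1; rewrite lieDr Ax Ay addrC.
have Gxmy : G (x - y) = (c1 - 'i * s1) *: (x - y).
  by apply: GN1; rewrite lieBr Ax Ay opprB.
have Gx : G x = c1 *: x + ('i * s1) *: y.
  have -> : x = 2^-1 *: (x + y) + 2^-1 *: (x - y).
    by rewrite xL yL !(LD, LZ, LN); congr L; field.
  by rewrite GD !GZ Gxy Gxmy xL yL !(LD, LZ, LN); congr L; field.
have Gy : G y = ('i * s1) *: x + c1 *: y.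
  have -> : y = 2^-1 *: (x + y) - 2^-1 *: (x - y).
    by rewrite xL yL !(LD, LZ, LN); congr L; field.
  by rewrite GD GN !GZ Gxy Gxmy xL yL !(LD, LZ, LN); congr L; field.
rewrite GD !GZ Gx Gy r_opD !r_opZ rx ry [in LHS]xL [in LHS]yL [in RHS]xL yL !(LD, LZ, LN).
(* Makes both sides homogeneous of degree three in c1 and s1. *)
have c1E : c1 = c1 * (c1 ^+ 2 + s1 ^+ 2) by rewrite cs1 mulr1.
have s1E : s1 = s1 * (c1 ^+ 2 + s1 ^+ 2) by rewrite cs1 mulr1.
congr L; try ring; rewrite c2E s2E.
- by rewrite {1}c1E; ring: ii.
- by rewrite {1}s1E; ring: ii.
Qed.

Lemma rotation_noncompact x : lie Z (lie Z x) = - x ->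
  exists2 v, lie Z v = 0 & r_op (G x) = G (c2 *: lie Z x + s2 *: v).
Proof.
move=> ZZx; rewrite -[x]opprK -ZZx.
(* As in [r_op_noncompact], inserting [Z, [Z, x]] gives a statement about all x. Positive grade is
   handled by [cascade_string], negative grade by applying the involution. *)
suff [v Zv rv] : exists2 v, lie Z v = 0 & r_op (G (lie Z (lie Z x))) =
    G (c2 *: lie Z (lie Z (lie Z x)) + s2 *: v).
  exists (- v); first by rewrite lieNr Zv oppr0.
  by rewrite GN r_opN rv !lieNr !scalerN -opprD GN.
move: x {ZZx}; apply: (weight_ind cs h_abelian h_star) => [|x y [v Zv rv] [w Zw rw]|alpha x ax].
- exists 0; rewrite !(lie0r, scaler0, addr0)//.
  by rewrite -(scale0r (0 : g)) GZ !scale0r r_op0.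
- exists (v + w); first by rewrite lieDr Zv Zw addr0.
  by rewrite !lieDr GD r_opD rv rw -GD addrACA -!scalerDr.
have [->|x0] := eqVneq x 0.
  exists 0; rewrite !(lie0r, scaler0, addr0)//.
  by rewrite -(scale0r (0 : g)) GZ !scale0r r_op0.
have pos_case beta w : root_space beta w -> w != 0 -> wt beta Z = 'i ->
    exists2 v, lie Z v = 0 & r_op (G w) = G (('i * c2) *: w + s2 *: v).
  move=> bw w0 bZ.
  have rb : is_root beta by apply: (is_root_vector bw w0); apply: noncompact_neq0.
  have Zw : lie Z w = 'i *: w by rewrite (space_lie bw) ?bZ.
  have SHw : lie (lie SE (star SE)) w = wt beta SH *: w.
    by rewrite lie_SE_star (space_lie bw) ?SH_mem.
  have rw : r_op w = 'i *: w by apply: (r_op_pos rb (pos_noncompact rb bZ) bw).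
  have SEw : lie SE w = 0 by apply: (string_E1 Z_cube ZSE Zw).
  have Zy : lie Z (lie (star SE) w) = 0 by apply: (string_grade1 cs star_Z ZSE Zw).
  case: (cascade_string rb bZ bw w0) => [[Ey z0 ry]|[Ey Ez Er Fr]].
    exists (lie (star SE) w) => //.
    exact: rotation_spin_half.
  have Zz := string_grade2 cs star_Z ZSE Zw.
  have rz : r_op (lie (star SE) (lie (star SE) w)) =
      - 'i *: lie (star SE) (lie (star SE) w).
    by rewrite r_op_noncompact Zz// lieZr Zz scalerA mulrNN ii scaleN1r.
  have Fz := string_F3 cs star_Z Z_cube ZSE Zw.
  exists (2^-1 *: (lie (star SE) w + 'i *: r_op (lie (star SE) w))).
    by rewrite lieZr lieDr lieZr lie_r_op// Zy r_op0 !scaler0 addr0 scaler0.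
  by rewrite (rotation_spin1 (erefl _))// scalerA.
have Zx := space_lie ax h_Z.
case: (grade_cases Z_cube x0 Zx) => aZ.
- exists 0; rewrite !(Zx, lieZr, aZ, scale0r, scaler0, lie0r, addr0)//.
  by rewrite -(scale0r (0 : g)) GZ !scale0r r_op0.
- have [v Zv rv] := pos_case _ _ ax x0 aZ.
  exists (- v); first by rewrite lieNr Zv oppr0.
  rewrite !(Zx, lieZr, aZ, scalerA) ii !scaleN1r GN r_opN rv -GN.
  by rewrite opprD scalerN; congr (G (_ - _)); rewrite -scaleNr; congr (_ *: _); ring: ii.
- have [|||v Zv rv] := pos_case (- alpha) (star x).
  + exact: (root_space_star cs h_star).
  + by rewrite (star_eq0 cs).
  + by rewrite wtNl aZ opprK.
  exists (- star v).
    have := congr1 star Zv; rewrite (star_lie cs) (star0 cs) star_Z lieNr -lieC.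
    by rewrite lieNr => ->; rewrite oppr0.
  have {}rv : r_op (G x) = G ((- 'i * c2) *: x + s2 *: star v).
    have := congr1 star rv; rewrite -r_op_star !G_star (starK cs) => ->.
    rewrite (starD cs) !(starZ cs) (starK cs) rmorphM /= conjCi c2_real s2_real//.
  rewrite !(Zx, lieZr, aZ, scalerA) mulrNN ii !scaleN1r GN r_opN rv -GN.
  by rewrite opprD scalerN; congr (G (_ - _)); rewrite -scaleNr; congr (_ *: _); ring: ii.
Qed.

(** For x the first cascade vector, [E^*, x] is minus the coroot, on which [r_op] vanishes. This
    excludes spin 1/2, so the string has spin 1 with w = 0. *)
Lemma rotation_gam0 : (0 < n)%N ->
  r_op (G (X gam`_0)) =
  G (('i * c2) *: X gam`_0 - (s2 / 2) *: coroot K gam`_0).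
Proof.
move=> n0; pose i := Ordinal n0; set x := X gam`_0; set H0 := coroot K gam`_0.
have [r0 iZ] := gam_rootP i; have bx : root_space gam`_i x := E_root i.
have x0 : x != 0 := E_neq0 i.
have Zx : lie Z x = 'i *: x := ZE i.
have rx : r_op x = 'i *: x by apply: (r_op_pos r0 (pos_noncompact r0 iZ) bx).
have yE : lie (star SE) x = - H0.
  rewrite star_SE lie_suml (bigD1 i)//= big1 ?addr0; last first.
    by move=> j ji; rewrite -[x]/(X gam`_i) cascade_FE.
  by rewrite -[x]/(X gam`_i) lieC EF.
have ry : r_op (lie (star SE) x) = 0.
  by rewrite yE r_opN r_op_cartan ?oppr0// coroot_mem.
have SEx : lie SE x = 0 by apply: (string_E1 Z_cube ZSE Zx).
case: (cascade_string r0 iZ bx x0) => [[Ey _]|[Ey Ez Er Fr]].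
  rewrite ry => /esym/eqP; rewrite scaler_eq0 oppr_eq0 (negPf (neq0Ci _)) /= => /eqP y0.
  by move/eqP: x0; case; rewrite -Ey y0 lie0r.
have Zz := string_grade2 cs star_Z ZSE Zx.
have rz : r_op (lie (star SE) (lie (star SE) x)) =
    - 'i *: lie (star SE) (lie (star SE) x).
  by rewrite r_op_noncompact Zz// lieZr Zz scalerA mulrNN ii scaleN1r.
have Fz := string_F3 cs star_Z Z_cube ZSE Zx.
rewrite (rotation_spin1 (erefl _))// ry scaler0 addr0 yE scalerN.
by [].
Qed.

Definition r_tens : 'M[C]_(\dim {:g}) :=
  'i *: \sum_(alpha <- ps) (dual_form K alpha alpha / 2) *:
    (tens (X (- alpha)) (X alpha) - tens (X alpha) (X (- alpha))).

Lemma tens_pair_r p q : tens_pair K r_tens p q = K (r_op p) q.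
Proof.
rewrite /r_tens /r_op tens_pairZ tens_pair_sum form_suml mulr_sumr.
apply: eq_bigr => alpha _; rewrite tens_pairZ tens_pairD tens_pairN.
rewrite !tens_pair_tens formZl formDl formNl !formZl; ring.
Qed.

Lemma r_op_skew p q : K (r_op p) q = - K p (r_op q).
Proof.
rewrite (formC K p) -!tens_pair_r /r_tens !tens_pairZ !tens_pair_sum !mulr_sumr.
rewrite -sumrN; apply: eq_bigr => alpha _; rewrite !tens_pairZ !tens_pairD !tens_pairN.
rewrite !tens_pair_tens; ring.
Qed.

Definition real_part : set g := [set x | star x = - x].

Lemma real_part_lie x y : real_part x -> real_part y -> real_part (lie x y).
Proof.
move=> /= xr yr.
by rewrite /real_part /= (star_lie cs) xr yr lieNl lieNr opprK lieC.
Qed.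

Let real_r_identity (V : lmodType C) (aa bb ab ba : V) (d : C) :
  'i *: ((d / 2) *: (- (aa + 'i *: ab) + ('i *: ba + 'i *: ('i *: bb)) -
    (- aa + 'i *: ab + (- ('i *: ba) + 'i *: ('i *: bb))))) =
  d *: ab + - d *: ba.
Proof.
pose L := lincomb aa bb ab ba.
have [-> -> -> ->] : [/\ aa = L 1 0 0 0, bb = L 0 1 0 0, ab = L 0 0 1 0 & ba = L 0 0 0 1].
  by split; [apply: lincomb1|apply: lincomb2|apply: lincomb3|apply: lincomb4].
rewrite /L !(lincombN, lincombZ, lincombD).
have : 2^-1 * 2 = 1 :> C by rewrite mulVf ?pnatr_eq0.
move: (2^-1) => k k2; congr lincomb; try by ring: ii.
- by rewrite -[RHS]mulr1 -k2; ring: ii.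
- by rewrite -[RHS]mulr1 -k2; ring: ii.
Qed.

(** With X_alpha = a + i b for a, b in the compact form, the term of alpha equals (alpha, alpha) (a
    ⊗ b - b ⊗ a). *)
Lemma real_part_r : tens_span real_part real_part r_tens.
Proof.
rewrite /r_tens scaler_sumr [X in tens_span _ _ X]big_seq.
apply: tens_span_sum => alpha /psP[ra pa]; have [ax _ ->] := X_root ra pa.
have := dual_form_gt0 cs h_abelian h_maximal h_star ra.
move: (dual_form _ _ _) (X alpha) => d e d0.
have dJ : d^* = d by apply/CrealP/gtr0_real.
pose a := 2^-1 *: (e - star e); pose b := (- 'i / 2) *: (e + star e).
have two : (2 : C) != 0 by rewrite pnatr_eq0.
have aJ : star a = - a.
  by rewrite (starZ cs) (starB cs) (starK cs) fmorphV /= conjC_nat -scalerN opprB.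
have bJ : star b = - b.
  rewrite (starZ cs) (starD cs) (starK cs) rmorphM rmorphN fmorphV /= conjC_nat.
  by rewrite conjCi opprK addrC /b mulNr scaleNr opprK.
have h2 : 2^-1 + 2^-1 = 1 :> C by field.
have eE : e = a + 'i *: b.
  rewrite scalerA mulrA mulrN ii opprK mul1r -scalerDr addrACA addNr addr0.
  by rewrite scalerDr -scalerDl h2 scale1r.
clearbody a b.
have seE : star e = - a + 'i *: b.
  have := congr1 star eE.
  by rewrite (starD cs) (starZ cs) aJ bJ conjCi scaleNr scalerN opprK.
have -> : 'i *: ((d / 2) *: (tens (star e) e - tens e (star e))) =
    tens (d *: a) b + tens (- d *: b) a.
  rewrite seE {1 2}eE !(tensDl, tensDr, tensNl, tensNr, tensZl, tensZr).
  exact: real_r_identity.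
apply: tens_spanD; apply: tens_span_tens => //; rewrite /real_part /=.
  by rewrite (starZ cs) aJ dJ scalerN.
by rewrite (starZ cs) bJ rmorphN /= dJ scalerN.
Qed.

Lemma real_bracket Y : real_part Y ->
  tens_span real_part real_part (tens_bracket r_tens Y).
Proof.
move=> Yr.
apply: (tens_span_ind (Q := fun T => tens_span _ _ (tens_bracket T Y)) _ _ _ real_part_r).
- by rewrite tens_bracket0; apply: tens_span0.
- by move=> T T' ? ?; rewrite tens_bracketD; apply: tens_spanD.
move=> x y xr yr; rewrite tens_bracketE; apply: tens_spanD; apply: tens_span_tens => //;
  exact: real_part_lie.
Qed.

Lemma form_nondegenerate x : (forall y, K x y = 0) -> x = 0.
Proof. by move=> Kx; apply: (hform_eq0 cs); apply: Kx. Qed.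

Lemma G_inj : injective G.
Proof.
move=> x y Gxy; apply/eqP; rewrite -subr_eq0; apply/eqP/form_nondegenerate => z.
by rewrite -G_form GD GN Gxy subrr form0l.
Qed.

Lemma G_surj x : exists y, x = G y.
Proof.
have G_lin : linear G by move=> c y z; rewrite GD GZ.
pose GL : {linear g -> g} := HB.pack G (GRing.isLinear.Build _ _ _ _ _ G_lin).
have GE y : linfun GL y = G y by rewrite lfunE.
have inj : lker (linfun GL) == 0%VS.
  by apply/lker0P => y z; rewrite !GE; apply: G_inj.
have : x \in limg (linfun GL).
  suff -> : limg (linfun GL) = fullv by rewrite memvf.
  exact: lker0_limgf.
by move=> /memv_imgP[y _ ->]; exists y; rewrite GE.
Qed.

Let k_real : set g := [set G y | y in [set y | star y = - y /\ lie Z y = 0]].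

(** As -(ad Z)^2 is the projection onto the noncompact part along g^nu, [Pm] and [Pk] are the
    projections onto G(m) and G(g^nu). *)
Let Pm p := - lie (G Z) (lie (G Z) p).
Let Pk p := p - Pm p.

Let PmG x : Pm (G x) = G (- lie Z (lie Z x)).
Proof. by rewrite /Pm -!G_lie GN. Qed.

Let PkG x : Pk (G x) = G (x + lie Z (lie Z x)).
Proof. by rewrite /Pk PmG GN opprK GD. Qed.

Let P_split p : p = Pk p + Pm p.
Proof. by rewrite /Pk subrK. Qed.

Let KPm p q : K (Pm p) q = K p (Pm q).
Proof.
rewrite /Pm formNl formNr; congr (- _).
rewrite (lieC _ (lie _ p)) formNl (form_invariant cs) (lieC _ p) formNl.
by rewrite (form_invariant cs) opprK.
Qed.

Let KPk p q : K (Pk p) q = K p (Pk q).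
Proof. by rewrite /Pk formDl formDr formNl formNr KPm. Qed.

Let PkR p : real_part p -> k_real (Pk p).
Proof.
have [x ->] := G_surj p; rewrite /real_part /= G_star -GN => /G_inj xr.
rewrite PkG; exists (x + lie Z (lie Z x)) => //; split; last first.
  by rewrite lieDr Z_cube subrr.
have ZR : real_part Z by [].
rewrite (starD cs) xr opprD; congr (_ + _).
by apply: real_part_lie => //; apply: real_part_lie.
Qed.

Let PmR p : real_part p -> real_part (Pm p).
Proof.
have GZR : real_part (G Z) by rewrite /real_part /= G_star star_Z GN.
move=> pr; rewrite /real_part /= /Pm (starN cs); congr (- _).
by apply: real_part_lie => //; apply: real_part_lie.
Qed.

Let k_realR p : k_real p -> real_part p.
Proof. by move=> [x [xr _] <-]; rewrite /real_part /= G_star xr GN. Qed.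

Let noncompact_m x : lie Z (lie Z (- lie Z (lie Z x))) = - (- lie Z (lie Z x)).
Proof. by rewrite !lieNr Z_cube. Qed.

Let K_mk x v : lie Z v = 0 -> K v (lie Z x) = 0.
Proof. by move=> Zv; rewrite -(form_invariant cs) lieC Zv oppr0 form0l. Qed.

(** For Y = G y and arguments G m, G m', the g^nu parts given by [rotation_noncompact] are
    orthogonal to m. What is left is cos (2 theta) times ([y, [Z, m]], m') + ([Z, m], [y, m']),
    which is 0 by invariance. *)
Lemma delta_mm Y p q : k_real Y ->
  tens_pair K (tens_bracket r_tens Y) (Pm p) (Pm q) = 0.
Proof.
move=> [y [yr Zy] <-]; rewrite (tens_pair_bracket (form_invariant cs)) !tens_pair_r.
have [x ->] := G_surj p; have [w ->] := G_surj q; rewrite !PmG -!G_lie.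
move: (noncompact_m x) (noncompact_m w).
set m := - lie Z (lie Z x); set m' := - lie Z (lie Z w) => Zm Zm'.
have ZyC z : lie Z (lie y z) = lie y (lie Z z) by rewrite lie_derivation Zy lie0l add0r.
have Zym : lie Z (lie Z (lie y m)) = - lie y m by rewrite !ZyC Zm lieNr.
have m'E : m' = lie Z (- lie Z m') by rewrite lieNr Zm' opprK.
have [v Zv ->] := rotation_noncompact Zym; have [v' Zv' ->] := rotation_noncompact Zm.
rewrite !G_form !formDl !formZl ZyC.
rewrite {2}m'E (K_mk _ Zv) mulr0 addr0.
have -> : lie y m' = lie Z (- lie y (lie Z m')) by rewrite lieNr ZyC Zm' lieNr opprK.
rewrite (K_mk _ Zv') mulr0 addr0 lieNr ZyC Zm' lieNr opprK -mulrDr.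
by rewrite (lieC y) formNl (form_invariant cs) addNr mulr0.
Qed.

(** Each a ⊗ b is Pk a ⊗ b + Pm a ⊗ Pk b + Pm a ⊗ Pm b, and the last terms sum to 0 by [delta_mm].
    The projections preserve the compact form, so the spans stay real. *)
Theorem cayley_coisotropic Y : k_real Y -> exists T1 T2,
  [/\ tens_span k_real real_part T1, tens_span real_part k_real T2 &
      tens_bracket r_tens Y = T1 + T2].
Proof.
move=> kY; have Yr := k_realR kY.
have [m [x [y [xy TE]]]] := real_bracket Yr.
exists (\sum_i tens (Pk (x i)) (y i)), (\sum_i tens (Pm (x i)) (Pk (y i))); split.
- apply: tens_span_sum => i _; have [xr yr] := xy i.
  by apply: tens_span_tens => //; apply: PkR.
- apply: tens_span_sum => i _; have [xr yr] := xy i.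
  by apply: tens_span_tens; [apply: PmR|apply: PkR].
have S0 : \sum_i tens (Pm (x i)) (Pm (y i)) = 0.
  apply: (tens_pair_eq0 form_nondegenerate) => p q.
  rewrite -[RHS](delta_mm p q kY) TE !tens_pair_sum; apply: eq_bigr => i _.
  by rewrite !tens_pair_tens !KPm.
rewrite TE -[RHS]addr0 -[in X in _ = _ + X]S0 -!big_split /=.
apply: eq_bigr => i _; by rewrite -addrA -tensDr -P_split -tensDl -P_split.
Qed.

Let K_rop_mk m v : s2 = 0 -> lie Z (lie Z m) = - m -> lie Z v = 0 ->
  K (r_op (G m)) (G v) = 0.
Proof.
move=> s0 Zm Zv; have [v' _ ->] := rotation_noncompact Zm.
by rewrite s0 scale0r addr0 G_form formZl formC (K_mk _ Zv) mulr0.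
Qed.

(** When s2 = 0, [r_op] maps G(m) to itself, which is orthogonal to G(g^nu), and ad Y preserves
    both; skewness of [r_op] exchanges the two mixed cases. *)
Lemma delta_mk Y p q : s2 = 0 -> k_real Y ->
  tens_pair K (tens_bracket r_tens Y) (Pm p) (Pk q) = 0 /\
  tens_pair K (tens_bracket r_tens Y) (Pk p) (Pm q) = 0.
Proof.
move=> s0 [y [yr Zy] <-]; rewrite !(tens_pair_bracket (form_invariant cs)) !tens_pair_r.
have [x ->] := G_surj p; have [w ->] := G_surj q; rewrite !PmG !PkG -!G_lie.
have ZyC z : lie Z (lie y z) = lie y (lie Z z) by rewrite lie_derivation Zy lie0l add0r.
have Zk z : lie Z (z + lie Z (lie Z z)) = 0 by rewrite lieDr Z_cube subrr.
have Zyk z : lie Z (lie y (z + lie Z (lie Z z))) = 0 by rewrite ZyC Zk lie0r.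
have Zym z : lie Z (lie Z (lie y (- lie Z (lie Z z)))) = - lie y (- lie Z (lie Z z)).
  by rewrite !ZyC noncompact_m lieNr.
split.
  by rewrite !K_rop_mk ?addr0//.
by rewrite !r_op_skew ![K (G _) (r_op _)]formC !K_rop_mk ?oppr0 ?addr0.
Qed.

Theorem cayley_poisson_lie : (0 < n)%N ->
  (forall Y, k_real Y -> tens_span k_real k_real (tens_bracket r_tens Y)) <-> s2 = 0.
Proof.
move=> n0; split=> [PL|s0 Y kY]; last first.
  have Yr := k_realR kY.
  have [m [x [y [xy TE]]]] := real_bracket Yr.
  have {TE}-> : tens_bracket r_tens Y = \sum_i tens (Pk (x i)) (Pk (y i)).
    apply/eqP; rewrite -subr_eq0; apply/eqP/(tens_pair_eq0 form_nondegenerate) => p q.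
    have [mk km] := delta_mk p q s0 kY; have mm := delta_mm p q kY.
    rewrite tens_pairD tens_pairN.
    have -> : tens_pair K (\sum_i tens (Pk (x i)) (Pk (y i))) p q =
        tens_pair K (tens_bracket r_tens Y) (Pk p) (Pk q).
      rewrite TE !tens_pair_sum; apply: eq_bigr => i _.
      by rewrite !tens_pair_tens !KPk.
    have pairD a b c d : tens_pair K (tens_bracket r_tens Y) (a + b) (c + d) =
        tens_pair K (tens_bracket r_tens Y) a c + tens_pair K (tens_bracket r_tens Y) a d +
        (tens_pair K (tens_bracket r_tens Y) b c + tens_pair K (tens_bracket r_tens Y) b d).
      rewrite TE !tens_pair_sum -!big_split; apply: eq_bigr => i _ /=.
      by rewrite !tens_pair_tens !formDr; ring.
    rewrite {1}(P_split p) {1}(P_split q) pairD mk km mm !addr0.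
    by rewrite subrr.
  by apply: tens_span_sum => i _; have [xr yr] := xy i; apply: tens_span_tens; apply: PkR.
have kGZ : k_real (G Z) by exists Z => //; split=> //; rewrite liexx.
pose i := Ordinal n0; pose H0 := coroot K gam`_0.
have r0 : is_root gam`_0 := (gam_rootP i).1.
have ZH : lie Z H0 = 0 by apply: h_abelian => //; apply: coroot_mem.
(* The first argument lies in G(m) and so is orthogonal to k_phi. The factor -i makes its bracket
   with G Z equal to G X_(gamma_1); the pairing is then -(s2 / 2) K(H0, H0), with K(H0, H0)
   positive. *)
have T0 : tens_pair K (tens_bracket r_tens (G Z)) (G (- 'i *: X gam`_0)) (G H0) = 0.
  apply: (tens_span_ind (Q := fun T => tens_pair K T _ _ = 0) _ _ _ (PL _ kGZ))
    => [|T T' T0 T'0|_ y' [x [_ Zx] <-] _].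
  - by rewrite tens_pair0.
  - by rewrite tens_pairD T0 T'0 addr0.
  rewrite tens_pair_tens G_form.
  have -> : - 'i *: X gam`_0 = lie Z (- X gam`_0).
    by rewrite lieNr -[X gam`_0]/(X gam`_i) ZE scaleNr.
  by rewrite (K_mk _ Zx) mul0r.
move: T0; rewrite (tens_pair_bracket (form_invariant cs)) !tens_pair_r -!G_lie.
rewrite ZH [X in G X](_ : lie Z _ = X gam`_0); last first.
  by rewrite lieZr -[X gam`_0]/(X gam`_i) ZE scalerA mulNr ii opprK scale1r.
have -> : G 0 = 0 by rewrite -[X in G X](scale0r (0 : g)) GZ scale0r.
rewrite form0r addr0 rotation_gam0// G_form formDl formNl.
rewrite (formZl K ('i * c2)) (formZl K (s2 / 2)).
have -> : K (X gam`_0) H0 = 0.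
  rewrite formC -[X gam`_0](scale1r) -[1](opprK) -ii -mulNr -scalerA.
  by rewrite -[X gam`_0]/(X gam`_i) -ZE formZr (K_mk _ ZH) mulr0.
rewrite mulr0 sub0r => /eqP; rewrite oppr_eq0 mulf_eq0 mulf_eq0 invr_eq0 pnatr_eq0 /= orbF.
case/orP => [/eqP//|KH].
have H00 : H0 != 0.
  apply/eqP => H00; have := wt_coroot cs h_abelian h_maximal h_star r0.
  rewrite -/H0 H00 /wt linear0 linear0 => /esym/eqP; by rewrite pnatr_eq0.
have := form_gt0 cs H00; rewrite (star_coroot cs h_abelian h_maximal h_star r0).
by rewrite (eqP KH) ltxx.
Qed.

End Rotation.
End Cascade.

(** * Exponentials *)

Section ExponentialAutomorphism.
(* G is exp(i theta ad A) and e a is exp(i theta a), given through the action *)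
(* of G on sums of eigenvectors of ad A.                                      *)
Variables (C : numClosedFieldType) (g : lieAlgType C).
Variables (star : g -> g) (K : {symmetric g}).
Hypothesis cs : compact_structure star K.
Variables (A : g) (e : C -> C) (G : g -> g).
Hypothesis star_A : star A = A.
Hypothesis e0 : e 0 = 1.
Hypothesis eD : forall a b, a \is Num.real -> b \is Num.real -> e (a + b) = e a * e b.
Hypothesis eJ : forall a, a \is Num.real -> (e a)^* = e (- a).
Hypothesis G_sum : forall n (v : 'I_n -> g) (l : 'I_n -> C),
  (forall i, l i \is Num.real) -> (forall i, lie A (v i) = l i *: v i) ->
  G (\sum_i v i) = \sum_i e (l i) *: v i.

Lemma exp_eigenvector a x : a \is Num.real -> lie A x = a *: x -> G x = e a *: x.
Proof.
move=> ar Ax; have := @G_sum 1 (fun=> x) (fun=> a) (fun=> ar) (fun=> Ax).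
by rewrite !big_ord1.
Qed.

Let eigenbasis : exists (b : (\dim {:g}).-tuple g) (l : 'I_(\dim {:g}) -> C),
  basis_of {:g} b /\ forall i : 'I_(\dim {:g}), l i \is Num.real /\ lie A b`_i = l i *: b`_i.
Proof.
have [||b [bB bA]] := ad_selfadjoint_eigenbasis cs (s := [:: A]).
- by move=> x; rewrite inE => /eqP->.
- by move=> x y; rewrite !inE => /eqP-> /eqP->; rewrite liexx.
have /choice[l lP] : forall i : 'I_(\dim {:g}), exists a,
    a \is Num.real /\ lie A b`_i = a *: b`_i.
  by move=> i; have [|a ar Ab] := bA A i; rewrite ?mem_head//; exists a.
by exists b, l.
Qed.

(** A is fixed by the involution, so ad A is self-adjoint and every vector is a sum of eigenvectors
    with real eigenvalues. *)
Lemma exp_ind (P : g -> Prop) : P 0 -> (forall x y, P x -> P y -> P (x + y)) ->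
  (forall a x, a \is Num.real -> lie A x = a *: x -> P x) -> forall x, P x.
Proof.
move=> P0 PD Pe x; have [b [l [bB bl]]] := eigenbasis.
rewrite [x](coord_basis bB (memvf x)); elim/big_ind: _ => // i _.
have [lr Ab] := bl i; apply: (Pe _ _ lr).
by rewrite lieZr Ab scalerA mulrC -scalerA.
Qed.

Let GE (b : (\dim {:g}).-tuple g) (l : 'I_(\dim {:g}) -> C) x : basis_of {:g} b ->
  (forall i : 'I_(\dim {:g}), l i \is Num.real /\ lie A b`_i = l i *: b`_i) ->
  G x = \sum_i coord b i x *: (e (l i) *: b`_i).
Proof.
move=> bB bl; rewrite {1}(coord_basis bB (memvf x)) (@G_sum _ _ l).
- by apply: eq_bigr => i _; rewrite !scalerA mulrC.
- by move=> i; have [] := bl i.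
by move=> i; have [_ Ab] := bl i; rewrite lieZr Ab !scalerA mulrC.
Qed.

Lemma expD : {morph G : x y / x + y}.
Proof.
move=> x y; have [b [l [bB bl]]] := eigenbasis; rewrite !(GE _ bB bl) -big_split.
by apply: eq_bigr => i _; rewrite linearD scalerDl.
Qed.

Lemma expZ c x : G (c *: x) = c *: G x.
Proof.
have [b [l [bB bl]]] := eigenbasis; rewrite !(GE _ bB bl) scaler_sumr.
apply: eq_bigr => i _; have -> : coord b i (c *: x) = c * coord b i x by rewrite linearZ.
by rewrite [RHS]scalerA.
Qed.

Let exp0 : G 0 = 0.
Proof. by rewrite -(scale0r (0 : g)) expZ !scale0r. Qed.

Lemma exp_lie x y : G (lie x y) = lie (G x) (G y).
Proof.
move: x; apply: exp_ind => [|x x' xP x'P|a x ar Ax].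
- by rewrite lie0l exp0 lie0l.
- by rewrite lieDl !expD xP x'P lieDl.
move: y; apply: exp_ind => [|y y' yP y'P|a' y ar' Ay].
- by rewrite lie0r exp0 lie0r.
- by rewrite lieDr !expD yP y'P lieDr.
rewrite (exp_eigenvector ar Ax) (exp_eigenvector ar' Ay).
rewrite (@exp_eigenvector (a + a')) ?rpredD ?eD// ?lieZl ?lieZr ?scalerA//.
by rewrite lie_derivation Ax Ay lieZl lieZr scalerDl.
Qed.

(** By invariance, eigenvectors with eigenvalues a and a' pair to 0 unless a + a' = 0, and then the
    two exponential factors cancel. *)
Lemma exp_form x y : K (G x) (G y) = K x y.
Proof.
move: x; apply: exp_ind => [|x x' xP x'P|a x ar Ax].
- by rewrite exp0 !form0l.
- by rewrite expD !formDl xP x'P.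
move: y; apply: exp_ind => [|y y' yP y'P|a' y ar' Ay].
- by rewrite exp0 !form0r.
- by rewrite expD !formDr yP y'P.
rewrite (exp_eigenvector ar Ax) (exp_eigenvector ar' Ay) formZl formZr mulrA -eD//.
have [-> |Kxy] := eqVneq (K x y) 0; first by rewrite mulr0.
suff -> : a + a' = 0 by rewrite e0 mul1r.
have := form_invariant cs x A y; rewrite lieC Ax Ay formNl formZl formZr -mulNr.
by move/(mulIf Kxy) => <-; rewrite subrr.
Qed.

Lemma exp_star x : star (G x) = G (star x).
Proof.
move: x; apply: exp_ind => [|x x' xP x'P|a x ar Ax].
- by rewrite exp0 (star0 cs) exp0.
- by rewrite expD !(starD cs) expD xP x'P.
have Asx : lie A (star x) = (- a) *: star x.
  rewrite -star_A -(star_lie cs) lieC (starN cs) Ax (starZ cs) scaleNr.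
  by rewrite (CrealP ar).
by rewrite (exp_eigenvector ar Ax) (exp_eigenvector _ Asx) ?rpredN// (starZ cs) eJ.
Qed.

End ExponentialAutomorphism.

Section Centralizer.
Variables (C : numClosedFieldType) (g : lieAlgType C).
Variables (star : g -> g) (K : {symmetric g}).
Hypothesis cs : compact_structure star K.
Variable h : {vspace g}.
Hypothesis h_abelian : forall H H', H \in h -> H' \in h -> lie H H' = 0.
Hypothesis h_star : forall H, H \in h -> star H \in h.

(** Some weight component of Y is not killed by H0, while the elements of s kill every component of
    Y. *)
Lemma centralizer_weight (s : seq g) (H0 Y : g) : {subset s <= h} -> H0 \in h ->
  (forall H, H \in s -> lie H Y = 0) -> lie H0 Y != 0 ->
  exists (alpha : dual h) (x : g), [/\ x != 0, root_space alpha x, wt alpha H0 != 0 &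
    forall H, H \in s -> wt alpha H = 0].
Proof.
move=> sh hH0 sY H0Y; have [e [al [eB e_root]]] := root_decomposition cs h_abelian h_star.
have lieE H : H \in h -> lie H Y = \sum_i (coord e i Y * wt (al i) H) *: e`_i.
  move=> hH; rewrite {1}(coord_basis eB (memvf Y)) lie_sumr; apply: eq_bigr => i _.
  by rewrite lieZr ((root_spaceP _ _).1 (e_root i))// scalerA.
have [i ci] : exists i, coord e i Y * wt (al i) H0 != 0.
  apply/existsP; apply: contraNT H0Y; rewrite negb_exists => /forallP c0.
  by rewrite lieE// big1// => i _; rewrite (eqP (negPn (c0 i))) scale0r.
move: ci; rewrite mulf_eq0 negb_or => /andP[ci wi].
exists (al i), e`_i; split=> // [|H Hs].
  apply/eqP => ei; have := coord_free i i (basis_free eB).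
  by rewrite ei linear0 eqxx => /eqP; rewrite eq_sym oner_eq0.
have := sY _ Hs; rewrite lieE ?sh// => /(congr1 (coord e i)).
rewrite coord_sum_free ?(basis_free eB)// linear0 => /eqP.
by rewrite mulf_eq0 (negPf ci) => /eqP.
Qed.

End Centralizer.

Lemma addKr_double (C : numClosedFieldType) (k b b' : C) :
  k + b + b = k + b' + b' -> b = b'.
Proof.
rewrite -!addrA => /addrI /eqP; rewrite -subr_eq0 opprD addrACA -mulr2n.
by rewrite mulrn_eq0 /= subr_eq0 => /eqP.
Qed.

(** * The complexification of a compact Lie algebra *)

Section ComplexLie.
Variables (R : realType) (u : lieAlgType R).
Local Notation g := (cplx u).
Implicit Types (x y z : u) (X Y : g) (c : R[i]) (a : R).

Lemma cinclD x y : cincl (x + y) = cincl x + cincl y.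
Proof. by congr pair; rewrite /= addr0. Qed.

Lemma cinclZ a x : cincl (a *: x) = a%:C *: cincl x.
Proof. by congr pair; rewrite /= ?scale0r ?scaler0 ?subr0 ?addr0. Qed.

Lemma cincl0 : cincl (0 : u) = 0.
Proof. by []. Qed.

Lemma cincl_sum I r (P : pred I) (F : I -> u) :
  cincl (\sum_(i <- r | P i) F i) = \sum_(i <- r | P i) cincl (F i).
Proof. exact: (big_morph _ cinclD cincl0). Qed.

Lemma cincl_lie x y : cincl (lie x y) = lie (cincl x) (cincl y).
Proof. by congr pair; rewrite /= ?lie0l ?lie0r ?subr0 ?addr0. Qed.

Lemma cincl_eq0 x : (cincl x == 0) = (x == 0).
Proof. by apply/eqP/eqP => [[]|->]. Qed.

Lemma cplx_split X : X = cincl X.1 + 'i *: cincl X.2.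
Proof.
rewrite -complexiE; case: X => x y; congr pair => /=.
  by rewrite scale0r scale1r sub0r oppr0 addr0.
by rewrite scale1r scale0r !add0r.
Qed.

Lemma cplx_starD : {morph @star R u : X Y / X + Y}.
Proof. by move=> X Y; congr pair; rewrite /= opprD. Qed.

Lemma cplx_starZ c X : star (c *: X) = c^* *: star X.
Proof.
case: c X => a a' [x y]; congr pair; rewrite /=.
  by rewrite opprB scalerN scaleNr opprK addrC.
by rewrite scaleNr scalerN opprK.
Qed.

Lemma cplx_starK : involutive (@star R u).
Proof. by case=> x y; rewrite /star /= opprK. Qed.

Lemma cplx_star_lie X Y : star (lie X Y) = lie (star Y) (star X).
Proof.
case: X Y => [x x'] [y y']; congr pair; rewrite /= /cplx_lie /=.
  by rewrite lieNl lieNr opprK opprB (lieC x y) [lie y' _]lieC !opprK addrC.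
by rewrite lieNl lieNr (lieC y) opprK (lieC y') opprK addrC.
Qed.

Lemma star_cincl x : star (cincl x) = - cincl x.
Proof. by congr pair; rewrite /= oppr0. Qed.

Lemma cplx_real X : star X = - X -> X = cincl X.1.
Proof.
case: X => x y [] /eqP; rewrite -addr_eq0 -mulr2n -scaler_nat scaler_eq0.
by rewrite pnatr_eq0 /= => /eqP->.
Qed.

Lemma dim_cplx : \dim {:g} = \dim {:u}.
Proof. by rewrite [LHS]dimvf. Qed.

Definition cplx_basis : (\dim {:g}).-tuple g :=
  tcast (esym dim_cplx) (map_tuple (@cincl R u) (vbasis {:u})).

Lemma cplx_basisE (i : 'I_(\dim {:u})) :
  cplx_basis`_i = cincl (vbasis {:u})`_i.
Proof.
by rewrite /cplx_basis val_tcast /= (nth_map 0) ?size_tuple.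
Qed.

Lemma cplx_basisP : basis_of {:g} cplx_basis.
Proof.
rewrite basisEdim size_tuple leqnn andbT; apply/subvP => X _.
have mem_cincl x : cincl x \in <<cplx_basis>>%VS.
  rewrite (coord_vbasis (memvf x)) cincl_sum memv_suml// => i _.
  rewrite cinclZ memvZ// -cplx_basisE memv_span// mem_nth// size_tuple.
  by rewrite dim_cplx.
by rewrite (cplx_split X) memvD// memvZ.
Qed.

(** A real basis of u is a complex basis of its complexification, with the same structure
    constants. *)
Lemma killing_cincl x y : killing (cincl x) (cincl y) = (killing x y)%:C.
Proof.
rewrite /killing (trace_basis _ (vbasisP _) cplx_basisP) /mxtrace rmorph_sum /=.
rewrite (reindex (cast_ord (esym dim_cplx))) /=; last first.
  by exists (cast_ord dim_cplx) => i _; rewrite ?cast_ordK ?cast_ordKV.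
apply: eq_bigr => i _; rewrite !mxE /= !vecof_delta !comp_lfunE !adE.
rewrite [X in lie _ (lie _ X)]cplx_basisE -!cincl_lie.
set v := lie x _; rewrite [in LHS](coord_vbasis (memvf v)) cincl_sum.
rewrite (eq_bigr (fun j => (coord (vbasis {:u}) j v)%:C *: cplx_basis`_j)); last first.
  by move=> j _; rewrite cinclZ cplx_basisE.
rewrite (reindex (cast_ord dim_cplx)) /=; last first.
  by exists (cast_ord (esym dim_cplx)) => j _; rewrite ?cast_ordK ?cast_ordKV.
rewrite (coord_sum_free _ _ (basis_free cplx_basisP)).
by rewrite cast_ordKV.
Qed.

Section CompactForm.
Variable K : {symmetric g}.
Hypothesis K_invariant : invariant_form K.
Hypothesis K_negative : forall x : u, x != 0 -> K (cincl x) (cincl x) < 0.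

(** Polarization: the diagonal values are real because they are 0 or negative. *)
Lemma cincl_form_real x y : (K (cincl x) (cincl y))^* = K (cincl x) (cincl y).
Proof.
have Kr z : (K (cincl z) (cincl z))^* = K (cincl z) (cincl z).
  have [->|z0] := eqVneq z 0; first by rewrite cincl0 form0l conjC0.
  by apply/CrealP/ltr0_real/K_negative.
have := Kr (x + y); rewrite !cinclD !(formDl, formDr) !rmorphD /= !Kr.
rewrite (formC K (cincl y) (cincl x)) !addrA => /addIr.
move: (K (cincl x) (cincl x)) (K (cincl x) (cincl y)) => k b.
exact: addKr_double.
Qed.

Lemma cplx_form_star X Y : K (star X) (star Y) = (K X Y)^*.
Proof.
rewrite (cplx_split X) (cplx_split Y) !cplx_starD !cplx_starZ !star_cincl.
rewrite !(formDl, formDr, formZl, formZr, formNl, formNr) !rmorphD !rmorphM /=.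
rewrite !cincl_form_real !conjCi; ring.
Qed.

Lemma cplx_form_gt0 X : X != 0 -> 0 < K X (star X).
Proof.
move=> X0.
have -> : K X (star X) = - K (cincl X.1) (cincl X.1) - K (cincl X.2) (cincl X.2).
  rewrite {1 2}(cplx_split X) cplx_starD cplx_starZ !star_cincl conjCi.
  rewrite !(formDl, formDr, formZl, formZr, formNl, formNr).
  rewrite (formC K (cincl X.2) (cincl X.1)).
  have i2 : ('i : R[i]) * 'i = -1 by rewrite -expr2 sqrCi.
  by ring: i2.
have K_le x : K (cincl x) (cincl x) <= 0.
  by have [->|/K_negative/ltW//] := eqVneq x 0; rewrite cincl0 form0l.
move: X0; case: (eqVneq X.1 0) => [X1|X1 X0]; last first.
  by rewrite ltr_wpDr ?oppr_ge0 ?oppr_gt0 ?K_negative.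
case: (eqVneq X.2 0) => [X2|X2 _].
  by move/eqP; case; rewrite (cplx_split X) X1 X2 cincl0 scaler0 addr0.
by rewrite ltr_wpDl ?oppr_ge0 ?oppr_gt0 ?K_negative.
Qed.

Lemma cplx_compact_structure : compact_structure (@star R u) K.
Proof.
split; [exact: cplx_starD | exact: cplx_starZ | exact: cplx_starK |
  exact: cplx_star_lie | by [] | exact: cplx_form_star | exact: cplx_form_gt0].
Qed.

End CompactForm.

Lemma mem_cplx_vspace (t : {vspace u}) X :
  (X \in cplx_vspace t) = (X.1 \in t) && (X.2 \in t).
Proof.
apply/idP/andP => [|[X1 X2]].
  rewrite /cplx_vspace => /coord_span ->; elim/big_ind: _ => [|Y Y' [? ?] [? ?]|i _].
  - by rewrite !mem0v.
  - by rewrite !memvD.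
  set v := nth _ _ _; have [w wt ->] : exists2 w, w \in t & v = cincl w.
    have /mapP[w /vbasis_mem wt ->] : v \in [seq cincl x | x <- vbasis t].
      by rewrite mem_nth// size_map size_tuple.
    by exists w.
  by rewrite /= !scaler0 subr0 add0r !memvZ// memvZ.
have mem_cincl x : x \in t -> cincl x \in cplx_vspace t.
  move=> xt; rewrite (coord_vbasis xt) cincl_sum memv_suml// => i _.
  rewrite cinclZ memvZ// memv_span//; apply: map_f.
  by rewrite mem_nth// size_tuple.
by rewrite (cplx_split X) memvD ?memvZ ?mem_cincl.
Qed.

End ComplexLie.

Section Subspace.
Variables (K : fieldType) (V : vectType K) (P : V -> Prop).

(** A subspace of maximal dimension contained in P must be all of P. *)
Lemma exists_vspace : P 0 -> (forall x y, P x -> P y -> P (x + y)) ->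
  (forall c x, P x -> P (c *: x)) ->
  exists U : {vspace V}, forall x, x \in U <-> P x.
Proof.
move=> P0 PD PZ; pose Q d := `[< exists2 U : {vspace V}, \dim U = d &
  forall x, x \in U -> P x >].
have Q0 : exists d, Q d.
  exists 0%N; apply/asboolP; exists 0%VS; first exact: dimv0.
  by move=> x; rewrite memv0 => /eqP->.
have Qle d : Q d -> (d <= \dim {:V})%N.
  by move=> /asboolP[U <- _]; apply/dimvS/subvf.
have [d /asboolP[U dU UP] d_max] := ex_maxnP Q0 Qle.
exists U => x; split=> [/UP//|Px].
have QUx : Q (\dim (U + <[x]>)%VS).
  apply/asboolP; exists (U + <[x]>)%VS => // _ /memv_addP[y yU [_ /vlineP[c ->] ->]].
  by apply: PD; [apply: UP|apply: PZ].
have := d_max _ QUx; rewrite -dU => le_dim.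
have /eqP -> : U == (U + <[x]>)%VS by rewrite eqEdim addvSl.
by apply: (subvP (addvSr U _)); apply: memv_line.
Qed.

End Subspace.

Section GeneralizedEigenvector.
Variables (C : numClosedFieldType) (V : vectType C) (f k : V -> V -> C).
Hypothesis fD : forall x y z, f (x + y) z = f x z + f y z.
Hypothesis fZ : forall c x z, f (c *: x) z = c * f x z.
Hypothesis fC : forall x y, f x y = f y x.
Hypothesis kD : forall x y z, k (x + y) z = k x z + k y z.
Hypothesis kZ : forall c x z, k (c *: x) z = c * k x z.
Hypothesis kC : forall x y, k x y = k y x.
Hypothesis k_nondegenerate : forall x, (forall y, k x y = 0) -> x = 0.

(** An eigenvector of the Gram matrix of f times the inverse of that of k. *)
Lemma generalized_eigenvector : (0 < \dim {:V})%N ->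
  exists c x, x != 0 /\ forall y, f x y = c * k x y.
Proof.
move=> n_gt0; pose e := vbasis {:V}; have eB : basis_of {:V} e := vbasisP _.
have gram (h : V -> V -> C) v j :
    (forall x y z, h (x + y) z = h x z + h y z) ->
    (forall c x z, h (c *: x) z = c * h x z) ->
    h (vecof e v) e`_j = \sum_i v 0 i * h e`_i e`_j.
  move=> hD hZ; have h0 : h 0 e`_j = 0 by rewrite -(scale0r 0) hZ mul0r.
  rewrite /vecof (big_morph (h^~ e`_j) (fun x y => hD x y e`_j) h0).
  by apply: eq_bigr => i _; rewrite hZ.
have basis_ext (h h' : V -> V -> C) x : (forall y y' z, h z (y + y') = h z y + h z y') ->
    (forall c y z, h z (c *: y) = c * h z y) ->
    (forall y y' z, h' z (y + y') = h' z y + h' z y') ->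
    (forall c y z, h' z (c *: y) = c * h' z y) ->
    (forall j : 'I_(\dim {:V}), h x e`_j = h' x e`_j) -> forall y, h x y = h' x y.
  move=> hD hZ hD' hZ' E y; rewrite (coord_basis eB (memvf y)).
  have h0 : h x 0 = 0 by rewrite -(scale0r 0) hZ mul0r.
  have h0' : h' x 0 = 0 by rewrite -(scale0r 0) hZ' mul0r.
  rewrite (big_morph (h x) (fun y y' => hD y y' x) h0).
  rewrite (big_morph (h' x) (fun y y' => hD' y y' x) h0').
  by apply: eq_bigr => j _; rewrite hZ hZ' E.
have fDr y y' z : f z (y + y') = f z y + f z y' by rewrite fC fD !(fC z).
have fZr c y z : f z (c *: y) = c * f z y by rewrite fC fZ (fC z).
have kDr y y' z : k z (y + y') = k z y + k z y' by rewrite kC kD !(kC z).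
have kZr c y z : k z (c *: y) = c * k z y by rewrite kC kZ (kC z).
pose M (h : V -> V -> C) : 'M[C]_(\dim {:V}) := \matrix_(i, j) h e`_i e`_j.
have mulM h v j : (forall x y z, h (x + y) z = h x z + h y z) ->
    (forall c x z, h (c *: x) z = c * h x z) ->
    (v *m M h) 0 j = h (vecof e v) e`_j.
  by move=> hD hZ; rewrite gram// mxE; apply: eq_bigr => i _; rewrite mxE.
have Mk : M k \in unitmx.
  rewrite -row_free_unit; apply: inj_row_free => v vM.
  apply/eqP; rewrite -(vecof_eq0 eB); apply/eqP/k_nondegenerate.
  apply: (basis_ext k (fun _ _ => 0)) => // [*|*|j].
  - by rewrite addr0.
  - by rewrite mulr0.
  - by rewrite -mulM// vM mxE.
have [c /eigenvalueP[v vA v0]] := eigenvalue_closed (M f *m invmx (M k)) n_gt0.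
exists c, (vecof e v); split; first by rewrite vecof_eq0.
apply: (basis_ext f (fun x y => c * k x y)) => // [y y' z|c' y z|j].
- by rewrite kDr mulrDr.
- by rewrite kZr mulrCA.
rewrite -!mulM//; have /(congr1 (mulmx^~ (M k))) := vA.
by rewrite mulmxA mulmxKV// => ->; rewrite -scalemxAl mxE.
Qed.

End GeneralizedEigenvector.

(** * Cartan subalgebras and Schur's lemma in the compact case *)

Section CompactLie.
Variables (R : realType) (u : lieAlgType R).
Local Notation g := (cplx u).
Local Notation C := R[i].
Hypothesis u_compact : forall x : u, x != 0 -> killing x x < 0.
Implicit Types (x y : u) (X Y : g).

Lemma killing_cplx_negative x : x != 0 -> killing (cincl x) (cincl x) < 0.
Proof. by move=> /u_compact; rewrite killing_cincl -ltcR. Qed.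

Lemma killing_compact_structure :
  compact_structure (@star R u) (@killing C g : {symmetric g}).
Proof.
apply: cplx_compact_structure; first exact: killing_invariant.
exact: killing_cplx_negative.
Qed.

Lemma mem_lie_prodv (K : fieldType) (L : lieAlgType K) (U V : {vspace L}) (a b : L) :
  a \in U -> b \in V -> lie a b \in lie_prodv U V.
Proof.
move=> aU bV; rewrite (coord_vbasis aU) (coord_vbasis bV) lie_suml.
rewrite memv_suml// => i _; rewrite lie_sumr memv_suml// => j _.
rewrite lieZl lieZr !memvZ// memv_span//.
by apply/allpairsP; exists ((vbasis U)`_i, (vbasis V)`_j); rewrite /= !mem_nth ?size_tuple.
Qed.

(** If [x, [x, y]] = 0 then [x, y] has Killing square 0 by invariance, hence is 0 by definiteness;
    induction on n reduces to this case. *)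
Lemma compact_ad_nilpotent n x y : iter n.+1 (lie x) y = 0 -> lie x y = 0.
Proof.
elim: n y => [//|n IHn] y; rewrite iterSr => /IHn xxy0.
have K0 : killing (lie y x) (lie x y) = 0.
  by rewrite killing_invariant xxy0; apply: (form0r (@killing R u : {symmetric u})).
apply/eqP/negPn/negP => /u_compact; rewrite {1}(lieC x y).
have -> : killing (- lie y x) (lie x y) = - killing (lie y x) (lie x y).
  exact: (formNl (@killing R u : {symmetric u})).
by rewrite K0 oppr0 ltxx.
Qed.

Lemma compact_nilpotent_abelian (t : {vspace u}) : lie_nilpotent t ->
  forall x y, x \in t -> y \in t -> lie x y = 0.
Proof.
move=> [n tn] x y xt yt.
have iter_mem m : iter m (lie x) y \in iter m (lie_prodv t) t.
  by elim: m => [//|m IHm] /=; apply: mem_lie_prodv.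
apply: (@compact_ad_nilpotent n); have := iter_mem n; rewrite tn memv0 => /eqP /= ->.
exact: lie0r.
Qed.

Section Cartan.
Variable t : {vspace u}.
Hypothesis t_cartan : cartan_subalgebra t.
Local Notation h := (cplx_vspace t).

Lemma cartan_abelian x y : x \in t -> y \in t -> lie x y = 0.
Proof. by have [_ tn _] := t_cartan; apply: compact_nilpotent_abelian. Qed.

Lemma cartan_maximal x : (forall y, y \in t -> lie y x = 0) -> x \in t.
Proof.
have [_ _ t_norm] := t_cartan; move=> tx; apply: t_norm => y yt.
by rewrite lieC tx// oppr0 mem0v.
Qed.

Lemma cplx_abelian X Y : X \in h -> Y \in h -> lie X Y = 0.
Proof.
rewrite !mem_cplx_vspace => /andP[X1 X2] /andP[Y1 Y2].
by congr pair; rewrite /= !cartan_abelian// ?subr0 ?addr0.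
Qed.

Lemma cplx_maximal X : (forall Y, Y \in h -> lie Y X = 0) -> X \in h.
Proof.
move=> hX; have hY y : y \in t -> cincl y \in h.
  by move=> yt; rewrite mem_cplx_vspace yt mem0v.
rewrite mem_cplx_vspace; apply/andP; split; apply: cartan_maximal => y yt.
  by have /(congr1 fst) := hX _ (hY y yt); rewrite /= lie0l subr0.
by have /(congr1 snd) := hX _ (hY y yt); rewrite /= lie0l addr0.
Qed.

Lemma cplx_star_mem X : X \in h -> star X \in h.
Proof. by rewrite !mem_cplx_vspace /= memvN. Qed.

Lemma cplx_cartan : cartan_subalgebra h.
Proof.
have hh0 : lie_prodv h h = 0%VS.
  apply/eqP; rewrite -subv0; apply/span_subvP => _ /allpairsP[[X Y] [/= Xh Yh ->]].
  by rewrite cplx_abelian ?mem0v ?(vbasis_mem Xh) ?(vbasis_mem Yh).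
split; first by rewrite hh0 sub0v.
  by exists 1%N.
move=> X hX; have [_ _ t_norm] := t_cartan.
have hX' y : y \in t -> (lie X.1 y \in t) && (lie X.2 y \in t).
  move=> yt; have := hX (cincl y); rewrite !mem_cplx_vspace /= yt mem0v.
  by rewrite !lie0r subr0 add0r; apply.
rewrite mem_cplx_vspace; apply/andP; split; apply: t_norm => y /hX' /andP[]//.
Qed.

End Cartan.

Section Schur.
Hypothesis u_ideal : forall I : {vspace u}, lie_ideal I -> I = 0%VS \/ I = fullv.
Hypothesis u_neq0 : exists x : u, x != 0.

(** A generalized eigenvector X0 of f relative to the Killing form has a real eigenvalue c, so X0^*
    is one too, and so are the real and imaginary parts of X0. The x in u with f(x, -) = c
    killing(x, -) then form a nonzero ideal, which is u by simplicity. *)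
Lemma real_schur (f : g -> g -> C) :
  (forall X Y V, f (X + Y) V = f X V + f Y V) ->
  (forall c X V, f (c *: X) V = c * f X V) ->
  (forall X Y, f X Y = f Y X) -> invariant_form f ->
  (forall X Y, f (star X) (star Y) = (f X Y)^* ) ->
  exists c, forall X Y, f X Y = c * killing X Y.
Proof.
move=> fD fZ fC f_inv f_star; pose k : {symmetric g} := @killing C g.
have cs := killing_compact_structure.
have dim_gt0 : (0 < \dim {:g})%N.
  rewrite lt0n dimv_eq0; apply/eqP => g0; have [x] := u_neq0.
  by rewrite -cincl_eq0 -memv0 -g0 memvf.
have [c [X0 [X0_neq0 X0E]]] := generalized_eigenvector fD fZ fC (formDl k) (formZl k)
  (formC k) (form_nondegenerate cs) dim_gt0.
have cJ : c^* = c.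
  have k0 : k X0 (star X0) != 0 by rewrite gt_eqF// (form_gt0 cs).
  apply: (mulIf k0); have kr : (k X0 (star X0))^* = k X0 (star X0).
    by apply/CrealP/gtr0_real/(form_gt0 cs).
  rewrite -{1}kr -rmorphM /= -X0E -f_star cplx_starK fC.
  by [].
have X0E' Y : f (star X0) Y = c * k (star X0) Y.
  rewrite -[Y]cplx_starK f_star X0E rmorphM /= cJ; congr (_ * _).
  by rewrite (form_star cs).
pose P (x : u) := forall Y, f (cincl x) Y = c * k (cincl x) Y.
have f0 Y : f 0 Y = 0 by rewrite -(scale0r (0 : g)) fZ mul0r.
have [||a x xP|I IP] := @exists_vspace _ _ P.
- by move=> Y; rewrite cincl0 f0 form0l mulr0.
- by move=> x y xP yP Y; rewrite cinclD fD formDl xP yP mulrDr.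
- by move=> Y; rewrite cinclZ fZ formZl xP mulrCA.
have I_ideal : lie_ideal I.
  have k_inv : invariant_form k := @killing_invariant C g.
  move=> x y /IP yP; apply/IP => Y; rewrite cincl_lie.
  have fN X V : f (- X) V = - f X V by rewrite -scaleN1r fZ mulN1r.
  by rewrite lieC fN formNl f_inv (k_inv (cincl y)) yP mulrN.
have two : (2 : C) != 0 by rewrite pnatr_eq0.
have h2 : 2^-1 + 2^-1 = 1 :> C by field.
have X1E : cincl X0.1 = 2^-1 *: (X0 + (-1) *: star X0).
  rewrite {2 3}(cplx_split X0) cplx_starD cplx_starZ !star_cincl conjCi.
  rewrite scaleN1r scaleNr scalerN opprK opprD opprK addrACA subrr addr0.
  by rewrite scalerDr -scalerDl h2 scale1r.
have X2E : cincl X0.2 = (- 'i / 2) *: (X0 + star X0).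
  rewrite {2 3}(cplx_split X0) cplx_starD cplx_starZ !star_cincl conjCi.
  rewrite scaleNr scalerN opprK addrACA subrr add0r -scalerDl scalerA.
  have ii : 'i * 'i = -1 :> C by rewrite -expr2 sqrCi.
  by rewrite [X in X *: _](_ : _ = 1) ?scale1r//; field: ii.
have X1P : X0.1 \in I.
  apply/IP => Y; rewrite X1E !(fZ, fD) !(formZl, formDl) X0E X0E'; ring.
have X2P : X0.2 \in I.
  apply/IP => Y; rewrite X2E !(fZ, fD) !(formZl, formDl) X0E X0E'; ring.
have [I0|I1] := u_ideal I_ideal.
  move: X1P X2P; rewrite I0 !memv0 => /eqP X1 /eqP X2.
  by move: X0_neq0; rewrite (cplx_split X0) X1 X2 cincl0 scaler0 addr0 eqxx.
have allP x : P x by apply/IP; rewrite I1 memvf.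
exists c => X Y; rewrite (cplx_split X) fD fZ !allP.
by rewrite -[killing _ _]/(k _ _) formDl formZl; ring.
Qed.

(* B + B' and i (B - B'), where B' X Y = (B X^* Y^* )^*, are compatible with  *)
(* star, so each has a real eigenvalue relative to the Killing form, and the  *)
(* corresponding eigenvectors in u form a nonzero ideal.                      *)
Lemma symmetric_schur (B : {symmetric g}) : invariant_form B ->
  exists c, forall X Y, B X Y = c * killing X Y.
Proof.
move=> B_inv; pose B' X Y := (B (star X) (star Y))^*.
have B'D X Y V : B' (X + Y) V = B' X V + B' Y V.
  by rewrite /B' cplx_starD formDl rmorphD.
have B'Z c X V : B' (c *: X) V = c * B' X V.
  by rewrite /B' cplx_starZ formZl rmorphM /= conjCK.
have B'C X Y : B' X Y = B' Y X by rewrite /B' formC.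
have B'_inv : invariant_form B'.
  by move=> X Y V; rewrite /B' !cplx_star_lie lieC formNl B_inv -formNr -lieC.
have two : (2 : C) != 0 by rewrite pnatr_eq0.
have ii : 'i * 'i = -1 :> C by rewrite -expr2 sqrCi.
have [||||X Y|c1 c1E] := @real_schur (fun X Y => B X Y + B' X Y).
- by move=> X Y V; rewrite formDl B'D addrACA.
- by move=> c X V; rewrite formZl B'Z mulrDr.
- by move=> X Y; rewrite formC B'C.
- by move=> X Y V; rewrite B_inv B'_inv.
- by rewrite /B' !cplx_starK rmorphD /= conjCK addrC.
have [||||X Y|c2 c2E] := @real_schur (fun X Y => 'i * (B X Y - B' X Y)).
- by move=> X Y V; rewrite formDl B'D; ring.
- by move=> c X V; rewrite formZl B'Z; ring.
- by move=> X Y; rewrite formC B'C.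
- by move=> X Y V; rewrite B_inv B'_inv.
- by rewrite /B' !cplx_starK rmorphM rmorphB /= conjCK conjCi; ring.
exists ((c1 - 'i * c2) / 2) => X Y; move: (c1E X Y) (c2E X Y).
set kXY := killing X Y => E1 E2.
have -> : (c1 - 'i * c2) / 2 * kXY = (c1 * kXY - 'i * (c2 * kXY)) / 2 by ring.
rewrite -E1 -E2 mulrA ii mulN1r opprK addrACA subrr addr0.
by field.
Qed.

End Schur.

End CompactLie.

(** * The exponential series on eigenvectors *)

Section AdExp.
Variables (R : realType) (u : lieAlgType R).
Local Notation g := (cplx u).
Local Notation C := R[i].

Definition expi (a : R) : C := Complex (cos a) (sin a).

Lemma exp_coeffE (a : R) k :
  (k`!%:R : C)^-1 * ('i * a%:C) ^+ k = Complex (cos_coeff a k) (sin_coeff a k).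
Proof.
have ik : ('i : C) ^+ k = (if odd k then 'i else 1) * ((-1) ^+ k./2)%:C.
  rewrite rmorphXn rmorphN1 -{1}(odd_double_half k) exprD -muln2 mulnC exprM sqrCi.
  by case: (odd k); rewrite ?expr1 ?expr0.
have kE : (k`!%:R : C)^-1 = (k`!%:R^-1)%:C by rewrite fmorphV rmorph_nat.
rewrite exprMn ik kE -rmorphXn /=.
have imE (s : R) : Complex 0 s = 'i * s%:C.
  by rewrite [LHS]complexE complexiE /= rmorph0 add0r.
rewrite /cos_coeff /sin_coeff /=; case: ifP => ok /=.
  rewrite !mul0r imE mul1r.
  have -> : k.-1./2 = k./2 by case: k ok {ik kE} => //= k; rewrite uphalf_half => /negPf->.
  by rewrite rmorphM rmorphM /=; ring.
by rewrite !mul0r !mul1r complexr0 -exprnP 2!rmorphM /=; ring.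
Qed.

Lemma vect_lim_cvg (V : vectType R) (s : nat -> V) (l : V) :
  (forall i : 'I_(\dim {:V}), (fun n => rVof (vbasis {:V}) (s n) 0 i) @ \oo -->
     rVof (vbasis {:V}) l 0 i) -> vect_lim s = l.
Proof.
move=> sl; rewrite /vect_lim -[RHS](rVofK (vbasisP {:V})); congr (vecof _ _).
apply/rowP => i; rewrite mxE; apply: cvg_lim; first exact: norm_hausdorff.
exact: sl.
Qed.

Lemma vect_lim_lincomb (V : vectType R) m (v w : 'I_m -> V) (a b : 'I_m -> nat -> R)
    (al bl : 'I_m -> R) :
  (forall j, a j n @[n --> \oo] --> al j) -> (forall j, b j n @[n --> \oo] --> bl j) ->
  vect_lim (fun n => \sum_j (a j n *: v j + b j n *: w j)) =
  \sum_j (al j *: v j + bl j *: w j).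
Proof.
move=> aP bP; apply: vect_lim_cvg => i.
have E (x y : 'I_m -> R) : rVof (vbasis {:V}) (\sum_j (x j *: v j + y j *: w j)) 0 i =
    \sum_j (x j * coord (vbasis {:V}) i (v j) + y j * coord (vbasis {:V}) i (w j)).
  by rewrite mxE linear_sum; apply: eq_bigr => j _; rewrite linearD !linearZ.
rewrite E; under eq_fun do rewrite E.
apply: cvg_big => [|j _]; first exact: add_continuous.
by apply: cvgD; apply: cvgMr_tmp; [exact: aP|exact: bP].
Qed.

Lemma cvg_cos_series (a : R) : series (cos_coeff a) n @[n --> \oo] --> cos a.
Proof. by rewrite unlock; apply: is_cvg_series_cos_coeff. Qed.

Lemma cvg_sin_series (a : R) : series (sin_coeff a) n @[n --> \oo] --> sin a.
Proof. by rewrite unlock; apply: is_cvg_series_sin_coeff. Qed.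

(** The partial sums have as coefficients the partial sums of the cosine and sine series, so the
    limit may be taken coordinatewise. Finite sums of eigenvectors are treated at once because
    additivity of [Ad_exp] is not immediate from its definition as a limit. *)
Lemma Ad_exp_sum (Y : g) m (v : 'I_m -> g) (a : 'I_m -> R) :
  (forall j, lie Y (v j) = ('i * (a j)%:C) *: v j) ->
  Ad_exp Y (\sum_j v j) = \sum_j expi (a j) *: v j.
Proof.
move=> Yv.
have iterE k : iter k (lie Y) (\sum_j v j) = \sum_j ('i * (a j)%:C) ^+ k *: v j.
  elim: k => [|k IHk]; first by apply: eq_bigr => j _; rewrite expr0 scale1r.
  rewrite iterS IHk lie_sumr; apply: eq_bigr => j _.
  by rewrite lieZr Yv scalerA -exprSr.
have partE n : \sum_(k < n) (k`!%:R : C)^-1 *: iter k (lie Y) (\sum_j v j) =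
    \sum_j Complex (series (cos_coeff (a j)) n) (series (sin_coeff (a j)) n) *: v j.
  under eq_bigr do rewrite iterE scaler_sumr.
  rewrite exchange_big; apply: eq_bigr => j _ /=.
  under eq_bigr do rewrite scalerA exp_coeffE.
  rewrite -scaler_suml; congr (_ *: _).
  rewrite /series /= !big_mkord; elim/big_ind3: _ => // x1 x2 [y1 y2] z1 z2 [w1 w2] [-> ->] [-> ->].
  by [].
have fst_sum (F : 'I_m -> g) : (\sum_j F j).1 = \sum_j (F j).1.
  exact: (big_morph fst (fun x y => erefl) erefl).
have snd_sum (F : 'I_m -> g) : (\sum_j F j).2 = \sum_j (F j).2.
  exact: (big_morph snd (fun x y => erefl) erefl).
rewrite /Ad_exp (_ : (fun n => _) = fun n => \sum_j
    Complex (series (cos_coeff (a j)) n) (series (sin_coeff (a j)) n) *: v j); last first.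
  by apply/funext => n; apply: partE.
rewrite /cplx_lim [RHS]surjective_pairing; congr pair.
  rewrite (_ : (fun n => _) = fun n => \sum_j (series (cos_coeff (a j)) n *: (v j).1
      + series (sin_coeff (a j)) n *: - (v j).2)); last first.
    by apply/funext => n; rewrite fst_sum; apply: eq_bigr => j _; rewrite /= scalerN.
  rewrite (vect_lim_lincomb _ _ (fun j => @cvg_cos_series (a j)) (fun j => @cvg_sin_series (a j))).
  by rewrite fst_sum; apply: eq_bigr => j _; rewrite /= scalerN.
rewrite (_ : (fun n => _) = fun n => \sum_j (series (cos_coeff (a j)) n *: (v j).2
    + series (sin_coeff (a j)) n *: (v j).1)); last first.
  by apply/funext => n; rewrite snd_sum; apply: eq_bigr => j _.
rewrite (vect_lim_lincomb _ _ (fun j => @cvg_cos_series (a j)) (fun j => @cvg_sin_series (a j))).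
by rewrite snd_sum; apply: eq_bigr.
Qed.

Lemma expiE a : expi a = (cos a)%:C + 'i * (sin a)%:C.
Proof. by rewrite [LHS]complexE complexiE. Qed.

Lemma expi0 : expi 0 = 1.
Proof. by rewrite expiE cos0 sin0 rmorph0 mulr0 addr0. Qed.

Lemma expiD a b : expi (a + b) = expi a * expi b.
Proof.
have ii : 'i * 'i = -1 :> C by rewrite -expr2 sqrCi.
by rewrite !expiE cosD sinD rmorphB rmorphD !rmorphM /=; ring: ii.
Qed.

Lemma expiJ a : (expi a)^* = expi (- a).
Proof.
by rewrite -[LHS]/(Complex (cos a) (- sin a)) /expi cosN sinN.
Qed.

End AdExp.

Section LexicographicOrder.
Variables (R : realDomainType) (T : Type).
Implicit Types (f k : T -> R) (s : seq T).

Lemma ltxi_map_sub f k s :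
  ([seq f x | x <- s] < [seq k x | x <- s] :> seqlexi R)%O =
  ([seq 0 | _ <- s] < [seq k x - f x | x <- s] :> seqlexi R)%O.
Proof.
by elim: s => //= x s IHs; rewrite !ltxi_cons subr_ge0 subr_le0 IHs.
Qed.

End LexicographicOrder.

Section SineZeros.
Variable R : realType.

(** Subtracting a multiple of pi brings x into [0, pi[, where the sine vanishes only at 0. *)
Lemma sin_eq0_int (x : R) : sin x = 0 <-> exists m : int, x = m%:~R * pi.
Proof.
have sinDn (y : R) n : sin (y + pi *+ n) = (-1) ^+ n * sin y.
  elim: n => [|n IHn]; first by rewrite mulr0n addr0 expr0 mul1r.
  by rewrite mulrS addrCA addrC sinDpi IHn exprS mulN1r mulNr.
have pi0 : pi != 0 :> R by rewrite gt_eqF ?pi_gt0.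
have sinDz (y : R) (m : int) : sin (y + m%:~R * pi) = 0 <-> sin y = 0.
  suff H (n : nat) (z : R) : sin (z + pi *+ n) = 0 <-> sin z = 0.
    case: m => n.
      by rewrite -pmulrn mulr_natl.
    rewrite NegzE mulrNz -pmulrn mulNr mulr_natl -(H n.+1 (y - _)).
    by rewrite subrK.
  rewrite sinDn; split=> [/eqP|->]; last by rewrite mulr0.
  by rewrite mulf_eq0 signr_eq0 => /eqP.
split=> [sx|[m ->]]; last by rewrite -[_ * pi]add0r; apply/sinDz/sin0.
pose m := Num.floor (x / pi); exists m.
pose y := x - m%:~R * pi.
have sy : sin y = 0 by apply/(sinDz y m); rewrite subrK.
have y0 : 0 <= y by rewrite subr_ge0 -ler_pdivlMr ?pi_gt0 ?floor_le.
have ypi : y < pi.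
  rewrite ltrBlDr -[X in X + _]mul1r -mulrDl -ltr_pdivrMr ?pi_gt0//.
  by rewrite addrC -intrD1 -floor_lt_int // ltzD1.
move: y0; rewrite le_eqVlt => /orP[/eqP y0|y0].
  by apply/eqP; rewrite -subr_eq0 -/y -y0.
by have := sin_gt0_pi (introT andP (conj y0 ypi)); rewrite sy ltxx.
Qed.

End SineZeros.

Section Normalization.
Variables (R : realType) (u : lieAlgType R).
Local Notation g := (cplx u).
Hypothesis u_simple : compact_simple u.
Variable t : {vspace u}.
Hypothesis t_cartan : cartan_subalgebra t.
Local Notation h := (cplx_vspace t).
Variable B : {symmetric g}.
Hypothesis B_invariant : invariant_form B.
Hypothesis B_normalized : normalized_form B.
Variable alpha0 : dual h.
Hypothesis alpha0_root : is_root alpha0.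

(* The normalization (alpha, alpha) = 2 on short roots is only needed to make *)
(* B a positive multiple of the Killing form.                                 *)
Lemma normalized_compact_structure : compact_structure (@star R u) B.
Proof.
have [[[x0 [y0 xy0]] u_ideal] u_compact] := u_simple.
have u_neq0 : exists x : u, x != 0.
  by exists (lie x0 y0).
pose k : {symmetric g} := @killing R[i] g.
have cs : compact_structure (@star R u) k := killing_compact_structure u_compact.
have ha := cplx_abelian u_compact t_cartan.
have hm := cplx_maximal t_cartan.
have hs := @cplx_star_mem R u t.
have [c BE] := symmetric_schur u_compact u_ideal u_neq0 B_invariant.
have [alpha ra alpha_min] := shortest_root cs ha hm hs alpha0_root.
have Baa : dual_form B alpha alpha = 2.
  by apply: (B_normalized (cplx_cartan u_compact t_cartan)); split.
have c0 : c != 0.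
  apply/eqP => c0; move: Baa; rewrite /dual_form BE c0 mul0r => /esym/eqP.
  by rewrite pnatr_eq0.
(* Scaling the form by c scales the dual vectors, hence the dual form, by the inverse of c; the
   positive length 2 then forces c to be positive. *)
have TE : vsval (dual_vector B alpha) = c^-1 *: vsval (dual_vector k alpha).
  have BT (H : subvs_of h) : B (vsval (dual_vector B alpha)) (vsval H) = alpha H.
    rewrite /dual_vector; set P := [set T | _].
    have : P (xget 0 P).
      apply: xgetPex; exists (c^-1 *: dual_vector k alpha) => H'.
      rewrite BE linearZ /= -[killing _ _]/(k _ _) formZl mulVKf//.
      by rewrite (dual_vectorP cs ha hm hs ra) ?subvsP// /wt vsvalK.
    by apply.
  apply/eqP; rewrite -subr_eq0; apply/eqP/(cartan_nondegenerate cs hs).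
    by rewrite memvB ?memvZ ?subvsP.
  move=> H hH; rewrite formDl formNl formZl (dual_vectorP cs ha hm hs ra)//.
  have := BT (vsproj h H); rewrite vsprojK// BE -[killing _ _]/(k _ _) => BTH.
  by rewrite /wt -BTH mulKf// subrr.
have c_gt0 : 0 < c.
  have E : c^-1 * dual_form k alpha alpha = 2.
    rewrite -Baa /dual_form TE BE -[killing _ _]/(k _ _) formZl formZr.
    by rewrite mulVKf.
  have d0 := dual_form_gt0 cs ha hm hs ra.
  rewrite -invr_gt0 -(pmulr_lgt0 _ d0) E; exact: ltr0n.
apply: cplx_compact_structure => // x x0'.
rewrite BE pmulr_rlt0//; exact: killing_cplx_negative.
Qed.

End Normalization.

(** * The cascade of a Hermitian symmetric pair *)

Section Main.
Variables (R : realType) (u : lieAlgType R).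
Hypothesis u_simple : compact_simple u.
Local Notation g := (cplx u).
Local Notation C := R[i].
Variable B : {symmetric g}.
Hypotheses (B_invariant : invariant_form B) (B_normalized : normalized_form B).
Variable nu : 'End(u).
Hypothesis nu_involution : lie_involution nu.
Variable Z : u.
Hypothesis Z_center : Z \in lie_center (fixedSpace nu).
Hypothesis Z_complex : forall x : u, nu x = - x -> lie Z (lie Z x) = - x.
Variable t : {vspace u}.
Hypothesis t_cartan : cartan_subalgebra t.
Variable b : seq u.
Hypothesis b_basis : basis_of t (Z :: b).
Local Notation h := (cplx_vspace t).
Variable X : dual h -> g.
Hypothesis X_root : root_vectors B (Z :: b) X.
Variable gam : seq (dual h).
Hypothesis gam_cascade : cascade nu B (Z :: b) X gam.
Local Notation ZC := (cincl Z).
Local Notation star := (@star R u).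
Implicit Types alpha beta : dual h.

Let u_compact : forall x : u, x != 0 -> killing x x < 0.
Proof. by have [] := u_simple. Qed.

Let cs : compact_structure star B.
Proof.
have [_ [ra _ _] _ _] := gam_cascade.
exact: (normalized_compact_structure u_simple t_cartan B_invariant B_normalized ra).
Qed.

Let ha : forall H H', H \in h -> H' \in h -> lie H H' = 0.
Proof. by move=> H H'; apply: cplx_abelian. Qed.

Let hm : forall Y, (forall H, H \in h -> lie H Y = 0) -> Y \in h.
Proof. by move=> Y; apply: cplx_maximal. Qed.

Let hs : forall H, H \in h -> star H \in h.
Proof. by move=> H; apply: cplx_star_mem. Qed.

Let b_mem x : x \in Z :: b -> x \in t.
Proof. by move=> xb; apply: (basis_mem b_basis). Qed.

Let hb x : x \in Z :: b -> cincl x \in h.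
Proof. by move=> /b_mem xt; rewrite mem_cplx_vspace xt mem0v. Qed.

Let hZ : ZC \in h.
Proof. by apply: hb; rewrite mem_head. Qed.

Let star_Z : star ZC = - ZC.
Proof. exact: star_cincl. Qed.

(** Z commutes with the fixed vector x + nu x. *)
Let Z_sub x : lie Z (x - nu x) = 2 *: lie Z x.
Proof.
have [Zf Zc] := (mem_lie_center _ _).1 Z_center.
have xf : x + nu x \in fixedSpace nu.
  by apply/fixedSpaceP; rewrite linearD /= nu_involution.1 addrC.
have := Zc _ xf; rewrite lieDr => /eqP; rewrite addr_eq0 => /eqP Zx.
have Zn : lie Z (nu x) = - lie Z x by rewrite Zx opprK.
by rewrite lieBr Zn opprK scaler_nat mulr2n.
Qed.

Let Z_sub2 x : lie Z (lie Z (x - nu x)) = - (x - nu x).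
Proof. by apply: Z_complex; rewrite linearB /= nu_involution.1 opprB. Qed.

Let Z_cube_real x : lie Z (lie Z (lie Z x)) = - lie Z x.
Proof.
have two : (2 : R) != 0 by rewrite pnatr_eq0.
apply: (scalerI two); rewrite -2!lieZr -Z_sub Z_sub2 lieNr Z_sub.
by rewrite scalerN.
Qed.

(** If [Z, x] = 0 then x - nu x, on which (ad Z)^2 = -1, is also killed by Z, hence is 0. *)
Let fixedE x : x \in fixedSpace nu <-> lie Z x = 0.
Proof.
split=> [|Zx]; first exact: ((mem_lie_center _ _).1 Z_center).2.
apply/fixedSpaceP/esym/eqP; rewrite -subr_eq0 -oppr_eq0 -Z_sub2 Z_sub Zx.
by rewrite scaler0 lie0r.
Qed.

Let lieZC Y : lie ZC Y = (lie Z Y.1, lie Z Y.2).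
Proof. by congr pair; rewrite /= lie0l ?subr0 ?addr0. Qed.

Let Z_cube Y : lie ZC (lie ZC (lie ZC Y)) = - lie ZC Y.
Proof. by rewrite !lieZC /= !Z_cube_real. Qed.

Let fixed_cplxE Y : fixed_cplx nu Y <-> lie ZC Y = 0.
Proof.
rewrite lieZC; split=> E; have := congr1 fst E; have := congr1 snd E => /= E2 E1.
  by congr pair; apply/fixedE/fixedSpaceP.
rewrite /fixed_cplx /= /cplx_fun [RHS]surjective_pairing.
by congr pair; apply/fixedSpaceP/fixedE.
Qed.

(** The lexicographic key records only the real part of -i alpha(x); for functionals imaginary on t
    nothing is lost. *)
Let imaginary alpha := forall x, x \in t ->
  (wt alpha (cincl x))^* = - wt alpha (cincl x).

Let root_imaginary alpha : is_root alpha -> imaginary alpha.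
Proof.
move=> [_ [x x0 ax]] y yt; have hy : cincl y \in h by rewrite mem_cplx_vspace yt mem0v.
by rewrite -(weight_star cs hs x0 ax hy) star_cincl wtN.
Qed.

Let imaginaryB alpha beta : imaginary alpha -> imaginary beta -> imaginary (alpha - beta).
Proof. by move=> ia ib x xt; rewrite wtBl rmorphB /= ia// ib// opprB opprK addrC. Qed.

Let key alpha x : R := complex.Re (- 'i * wt alpha (cincl x)).

Let root_keyE alpha : root_key (Z :: b) alpha = [seq key alpha x | x <- Z :: b].
Proof.
apply: eq_map => x; rewrite /key -wtZ /wt; congr (complex.Re (alpha (vsproj h (_ *: _)))).
by rewrite -complexiE; apply/eqP; rewrite eq_complex /= oppr0 !eqxx.
Qed.

Let key0 x : key 0 x = 0.
Proof. by rewrite /key wt0l mulr0. Qed.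

Let keyB alpha beta x : key (alpha - beta) x = key alpha x - key beta x.
Proof. by rewrite /key wtBl mulrBr raddfB. Qed.

Let root_key0 : root_key (Z :: b) (0 : dual h) = [seq 0 | _ <- Z :: b].
Proof. by rewrite root_keyE; apply: eq_map => x; apply: key0. Qed.

Let key_eq0 alpha x : imaginary alpha -> x \in t -> key alpha x = 0 ->
  wt alpha (cincl x) = 0.
Proof.
move=> ia xt; move: (ia x xt); rewrite /key -complexiE; case: (wt _ _) => p q.
move=> [/eqP]; rewrite -addr_eq0 -mulr2n mulrn_eq0 /= => /eqP ->.
by rewrite oppr0 mul0r !mulN1r sub0r opprK => ->.
Qed.

Let key_ext alpha : imaginary alpha ->
  (forall x, x \in Z :: b -> key alpha x = 0) -> alpha = 0.
Proof.
move=> ia kx; apply: wt_ext => H; rewrite mem_cplx_vspace wt0l => /andP[H1 H2].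
have wt0 x : x \in t -> wt alpha (cincl x) = 0.
  move=> xt; rewrite (coord_basis (X := in_tuple (Z :: b)) b_basis xt) cincl_sum wt_sum.
  rewrite big1// => i _; rewrite cinclZ wtZ key_eq0 ?mulr0 ?kx ?mem_nth//.
  by apply: b_mem; apply: mem_nth.
by rewrite (cplx_split H) wtD wtZ !wt0// mulr0 addr0.
Qed.

Let pos alpha := (root_key (Z :: b) (0 : dual h) < root_key (Z :: b) alpha)%O.

Let pos_subE alpha beta :
  (root_key (Z :: b) beta < root_key (Z :: b) alpha)%O = pos (alpha - beta).
Proof.
rewrite /pos root_key0 !root_keyE ltxi_map_sub; congr (_ < _)%O.
by apply: eq_map => x; rewrite keyB.
Qed.

Let pos_asym alpha : pos alpha -> ~ pos (- alpha).
Proof.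
rewrite -[- alpha]sub0r -pos_subE => pa pa'.
have := lt_asym (root_key (Z :: b) (0 : dual h)) (root_key (Z :: b) alpha).
by rewrite pa' andbT => /negP.
Qed.

Let root_le_pos alpha beta : is_root alpha -> is_root beta ->
  root_le (Z :: b) beta alpha -> beta = alpha \/ pos (alpha - beta).
Proof.
move=> ra rb; rewrite /root_le le_eqVlt => /orP[/eqP E|]; last by rewrite pos_subE; right.
left; apply/esym/eqP; rewrite -subr_eq0; apply/eqP/key_ext.
  by apply: imaginaryB; apply: root_imaginary.
move=> x xb; rewrite keyB; apply/eqP; rewrite subr_eq0; apply/eqP/esym.
by move: E; rewrite !root_keyE => /eq_in_map; apply.
Qed.

Let root_le_Z alpha beta : root_le (Z :: b) beta alpha -> key beta Z <= key alpha Z.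
Proof. by rewrite /root_le !root_keyE /= lexi_cons => /andP[]. Qed.

Let key_noncompact alpha : wt alpha ZC = 'i -> key alpha Z = 1.
Proof.
by move=> aZ; rewrite /key aZ mulNr -expr2 sqrCi opprK.
Qed.

Let pos_noncompact alpha : is_root alpha -> wt alpha ZC = 'i -> pos alpha.
Proof.
move=> _ aZ; rewrite /pos root_key0 root_keyE /= ltxi_cons key_noncompact//.
by rewrite ler01 /= ler10.
Qed.

Let pos_total alpha : is_root alpha -> pos alpha \/ pos (- alpha).
Proof.
move=> ra; have [lt0|lt0|E] := ltgtP (root_key (Z :: b) (0 : dual h)) (root_key (Z :: b) alpha).
- by left.
- by right; rewrite -[- alpha]sub0r -pos_subE.
case: (ra) => /eqP[]; apply: key_ext; first exact: root_imaginary.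
by move=> x xb; move: E; rewrite root_key0 root_keyE => /eq_in_map/(_ _ xb).
Qed.

(** The only possible keys at Z are 0, 1 and -1. *)
Let noncompact_of_key alpha : is_root alpha -> 1 <= key alpha Z -> wt alpha ZC = 'i.
Proof.
move=> [_ [x x0 ax]] k1; have Zx := (root_spaceP _ _).1 ax _ hZ.
case: (grade_cases Z_cube x0 Zx) => // aZ; move: k1; rewrite /key aZ.
  by rewrite mulr0 /= ler10.
by rewrite mulrNN -expr2 sqrCi /= => k1; have := le_trans k1 (lerN10 R); rewrite ler10.
Qed.

Let X_rootP alpha : is_root alpha -> pos alpha ->
  [/\ root_space alpha (X alpha),
      B (X alpha) (star (X alpha)) = 2 / dual_form B alpha alpha &
      X (- alpha) = star (X alpha)].
Proof. by move=> ra pa; apply: X_root. Qed.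

Let X_space alpha : is_root alpha -> pos alpha -> root_space alpha (X alpha).
Proof. by move=> ra pa; have [] := X_rootP ra pa. Qed.

Let X_neq0 alpha : is_root alpha -> pos alpha -> X alpha != 0.
Proof.
move=> ra pa; have [ax nx _] := X_rootP ra pa.
exact: (root_vector_neq0 cs ha hm hs ra nx).
Qed.

Let Z_noncentral : exists Y : g, lie ZC Y != 0.
Proof.
apply: contrapT => Z0; have Z_neq0 : Z != 0.
  by have /basis_not0 := b_basis => /(_ Z); apply; rewrite mem_head.
have := u_compact Z_neq0; rewrite killingE.
have -> : ad Z = 0.
  apply/lfunP => x; rewrite adE zero_lfunE; apply/eqP/negPn/negP => Zx; apply: Z0.
  by exists (cincl x); rewrite -cincl_lie cincl_eq0.
by rewrite linear0 mulmx0 linear0 ltxx.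
Qed.

(** A centralizing element outside g^nu is not killed by Z, so it has a weight component that is
    nonzero at Z; up to sign its weight takes the value i there. *)
Let noncompact_root (gs : seq (dual h)) : ~ (coroot_centralizer B gs `<=` fixed_cplx nu) ->
  exists beta, [/\ is_root beta, wt beta ZC = 'i &
    forall gamma, gamma \in gs -> wt beta (coroot B gamma) = 0].
Proof.
move=> /existsNP[Y /not_implyP[gsY Yf]].
have ZY : lie ZC Y != 0 by apply/eqP => /fixed_cplxE.
have [] := @centralizer_weight _ _ _ _ cs _ ha hs [seq coroot B gamma | gamma <- gs] ZC Y.
- by move=> _ /mapP[gamma _ ->]; apply: coroot_mem.
- exact: hZ.
- by move=> _ /mapP[gamma gg ->]; apply: gsY.
- exact: ZY.
move=> alpha [x [x0 ax aZ gs0]].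
have {}gs0 gamma : gamma \in gs -> wt alpha (coroot B gamma) = 0.
  by move=> gg; apply: gs0; apply: map_f.
have a0 : alpha != 0 by apply: contraNneq aZ => ->; rewrite wt0l.
have ra : is_root alpha := is_root_vector ax x0 a0.
have Zx := (root_spaceP _ _).1 ax _ hZ.
case: (grade_cases Z_cube x0 Zx) => E.
- by rewrite E eqxx in aZ.
- by exists alpha.
exists (- alpha); split.
- exact: (is_rootN cs hs ra).
- by rewrite wtNl E opprK.
by move=> gamma gg; rewrite wtNl gs0// oppr0.
Qed.

Let centralizer_X beta (gs : seq (dual h)) : is_root beta -> pos beta ->
  coroot_centralizer B gs (X beta) <->
  forall gamma, gamma \in gs -> wt beta (coroot B gamma) = 0.
Proof.
move=> rb pb; have bx := X_space rb pb; split=> gs0 gamma gg.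
  have := gs0 _ gg; rewrite (lie_coroot _ _ bx) => /eqP.
  by rewrite scaler_eq0 (negPf (X_neq0 rb pb)) orbF => /eqP.
by rewrite (lie_coroot _ _ bx) gs0// scale0r.
Qed.

(** Each stage admits a noncompact root with first key 1, by [noncompact_root]; the largest root
    there has first key at least 1 and is therefore noncompact. *)
Let cascade_largest i : (i < size gam)%N ->
  [/\ is_root gam`_i, wt gam`_i ZC = 'i,
      forall gamma, gamma \in take i gam -> wt gam`_i (coroot B gamma) = 0 &
      forall beta, is_root beta -> wt beta ZC = 'i ->
        (forall gamma, gamma \in take i gam -> wt beta (coroot B gamma) = 0) ->
        root_le (Z :: b) beta gam`_i].
Proof.
have [_ [r0 _ max0] casc _] := gam_cascade; case: i => [|i] ilt.
  have [Y ZY] := Z_noncentral.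
  have [|beta [rb bZ _]] := @noncompact_root [::].
    by move/(_ Y) => YF; case/eqP: ZY; apply/fixed_cplxE/YF => gamma; rewrite in_nil.
  have g0Z : wt gam`_0 ZC = 'i.
    apply: noncompact_of_key => //; rewrite -(key_noncompact bZ).
    by apply: root_le_Z; apply: max0.
  by split=> // [gamma|beta' rb' _ _]; [rewrite take0 in_nil|apply: max0].
have [ncent [rg Pg maxg]] := casc i.+1 ilt.
have [beta [rb bZ b0]] := noncompact_root ncent.
have max_beta beta' : is_root beta' -> wt beta' ZC = 'i ->
    (forall gamma, gamma \in take i.+1 gam -> wt beta' (coroot B gamma) = 0) ->
    root_le (Z :: b) beta' gam`_i.+1.
  move=> rb' b'Z b'0; apply: maxg => //.
  by apply/(centralizer_X _ rb' (pos_noncompact rb' b'Z)).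
have gZ : wt gam`_i.+1 ZC = 'i.
  by apply: noncompact_of_key => //; rewrite -(key_noncompact bZ) root_le_Z// max_beta.
split=> //; apply/(centralizer_X _ rg (pos_noncompact rg gZ)) => //.
Qed.

Let nth_take_mem i j : (j < i < size gam)%N -> gam`_j \in take i gam.
Proof.
move=> /andP[ji ilt]; rewrite -(nth_take 0 ji); apply: mem_nth.
by rewrite size_take ilt.
Qed.

Let take_mem_nth i gamma : (i < size gam)%N -> gamma \in take i gam ->
  exists2 j, (j < i)%N & gamma = gam`_j.
Proof.
move=> ilt /(nthP 0)[j]; rewrite size_take ilt => ji <-.
by exists j; rewrite ?nth_take.
Qed.

Let gam_root i : (i < size gam)%N -> is_root gam`_i /\ wt gam`_i ZC = 'i.
Proof. by move=> /cascade_largest[]. Qed.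

Let gam_orthogonal i j : (j < i < size gam)%N -> wt gam`_i (coroot B gam`_j) = 0.
Proof.
move=> jin; have /andP[_ ilt] := jin; have [_ _ g0 _] := cascade_largest ilt.
exact/g0/nth_take_mem.
Qed.

Let gam_max i beta : (i < size gam)%N -> is_root beta -> wt beta ZC = 'i ->
  (forall j, (j < i)%N -> wt beta (coroot B gam`_j) = 0) ->
  beta = gam`_i \/ pos (gam`_i - beta).
Proof.
move=> ilt rb bZ b0; have [rg _ _ gmax] := cascade_largest ilt.
apply: root_le_pos => //; apply: gmax => // gamma /(take_mem_nth ilt)[j ji ->].
exact: b0.
Qed.

Let gam_end beta : is_root beta -> wt beta ZC = 'i ->
  exists2 i, (i < size gam)%N & wt beta (coroot B gam`_i) != 0.
Proof.
move=> rb bZ; have [_ _ _ cent] := gam_cascade; apply: contrapT => none.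
have pb := pos_noncompact rb bZ.
have : fixed_cplx nu (X beta).
  apply: cent; apply/(centralizer_X _ rb pb) => gamma /(nthP 0)[i ilt <-].
  by apply/eqP/negPn/negP => wi; apply: none; exists i.
move/fixed_cplxE; rewrite ((root_spaceP _ _).1 (X_space rb pb) _ hZ) bZ => /eqP.
by rewrite scaler_eq0 (negPf (X_neq0 rb pb)) (negPf (neq0Ci _)).
Qed.

Let gam_gt0 : (0 < size gam)%N.
Proof. by have [] := gam_cascade. Qed.

Let positive_seq : exists ps : seq (dual h), uniq ps /\
  forall alpha, alpha \in ps <-> is_root alpha /\ pos alpha.
Proof.
have [s sP] := finite_roots cs ha hs.
exists (undup [seq a <- s | `[< is_root a /\ pos a >]]); split=> [|alpha].
  exact: undup_uniq.
rewrite mem_undup mem_filter; split=> [/andP[/asboolP//]|[ra pa]].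
by rewrite sP// andbT; apply/asboolP.
Qed.

Section Rotation.
Variable phi : R.
Let theta : R := pi * (phi - 1) / 4.
Let A : g := SE X gam + star (SE X gam).
Let G : g -> g := Ad_exp (log_g X gam (phi - 1)).
(** Meaningful at real l, the only eigenvalues that occur; the real part makes it a function on all
    of C. *)
Let e (l : C) : C := expi (theta * complex.Re l).

Let log_gE : log_g X gam (phi - 1) = ('i * theta%:C) *: A.
Proof.
rewrite /log_g; congr (_ *: _).
  by rewrite -complexiE; apply/eqP; rewrite eq_complex /= !mul0r !mul1r subrr add0r !eqxx.
rewrite /A /SE (star_sum cs) -big_split (big_nth 0) big_mkord.
apply: eq_bigr => i _; have [ri iZ] := gam_root (ltn_ord i).
by have [_ _ ->] := X_rootP ri (pos_noncompact ri iZ); rewrite addrC.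
Qed.

Let star_A : star A = A.
Proof. by rewrite /A (starD cs) (starK cs) addrC. Qed.

Let e0 : e 0 = 1.
Proof. by rewrite /e /= mulr0 expi0. Qed.

Let eD l l' : l \is Num.real -> l' \is Num.real -> e (l + l') = e l * e l'.
Proof. by move=> _ _; rewrite /e raddfD mulrDr expiD. Qed.

Let eJ l : l \is Num.real -> (e l)^* = e (- l).
Proof. by move=> _; rewrite /e expiJ raddfN mulrN. Qed.

Let G_sum m (v : 'I_m -> g) (l : 'I_m -> C) : (forall i, l i \is Num.real) ->
  (forall i, lie A (v i) = l i *: v i) -> G (\sum_i v i) = \sum_i e (l i) *: v i.
Proof.
move=> lr Av; apply: Ad_exp_sum => i.
have liE : (complex.Re (l i))%:C = l i by apply: RRe_real.
have -> : (theta * complex.Re (l i))%:C = theta%:C * l i by rewrite rmorphM /= liE.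
by rewrite log_gE lieZl Av scalerA mulrA.
Qed.

Let c1 : C := (cos theta)%:C.
Let s1 : C := (sin theta)%:C.
Let c2 : C := (cos (theta *+ 2))%:C.
Let s2 : C := (sin (theta *+ 2))%:C.

Let realJ (x : R) : (x%:C)^* = x%:C.
Proof. by apply/eqP; rewrite eq_complex /= oppr0 !eqxx. Qed.

Let cs1 : c1 ^+ 2 + s1 ^+ 2 = 1.
Proof. by rewrite -!rmorphXn -rmorphD /= cos2Dsin2 rmorph1. Qed.

Let c2E : c2 = c1 ^+ 2 - s1 ^+ 2.
Proof. by rewrite -!rmorphXn -rmorphB /c2 mulr2n cosD !expr2. Qed.

Let s2E : s2 = 2 * c1 * s1.
Proof.
by rewrite /s2 mulr2n sinD [sin _ * _]mulrC -mulr2n rmorphMn rmorphM /= -mulrA mulr_natl.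
Qed.

Let eN (a : R) : expi (- a) = (cos a)%:C - 'i * (sin a)%:C.
Proof. by rewrite expiE cosN sinN rmorphN mulrN. Qed.

Let G0 x : lie A x = 0 -> G x = x.
Proof.
move=> Ax; rewrite (exp_eigenvector G_sum (a := 0)) ?real0 ?scale0r//.
by rewrite e0 scale1r.
Qed.

Let G1 x : lie A x = x -> G x = (c1 + 'i * s1) *: x.
Proof.
move=> Ax; rewrite (exp_eigenvector G_sum (a := 1)) ?real1 ?scale1r//.
by rewrite /e /= mulr1 expiE.
Qed.

Let GN1 x : lie A x = - x -> G x = (c1 - 'i * s1) *: x.
Proof.
move=> Ax; rewrite (exp_eigenvector G_sum (a := -1)) ?realN ?real1 ?scaleN1r//.
by rewrite /e /= mulrN1 eN.
Qed.

Let Re2 : complex.Re (2 : C) = 2.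
Proof. by []. Qed.

Let ReN (l : C) : complex.Re (- l) = - complex.Re l.
Proof. by case: l. Qed.

Let G2 x : lie A x = 2 *: x -> G x = (c2 + 'i * s2) *: x.
Proof.
move=> Ax; rewrite (exp_eigenvector G_sum (a := 2)) ?realn//.
by rewrite /e Re2 mulr_natr expiE.
Qed.

Let GN2 x : lie A x = - 2 *: x -> G x = (c2 - 'i * s2) *: x.
Proof.
move=> Ax; rewrite (exp_eigenvector G_sum (a := - 2)) ?realN ?realn//.
by rewrite /e ReN Re2 mulrN mulr_natr eN.
Qed.

Let real_formE : @real_form R u = real_part star.
Proof.
apply/seteqP; split=> [_ [x _ <-]|Y /cplx_real ->]; first exact: star_cincl.
by exists Y.1.
Qed.

Let k_E : k_ nu X gam phi = [set G y | y in [set y | star y = - y /\ lie ZC y = 0]].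
Proof.
apply/seteqP; split=> ? [x].
  move=> /fixedE Zx <-; exists (cincl x) => //; split; first exact: star_cincl.
  by rewrite lieZC /= Zx lie0r.
move=> [/cplx_real -> ]; rewrite lieZC /= => -[Zx _] <-.
by exists x.1 => //; apply/fixedE.
Qed.

Let r_matrixE ps : uniq ps -> (forall alpha, alpha \in ps <-> is_root alpha /\ pos alpha) ->
  r_matrix B (Z :: b) X = r_tens B ps X.
Proof.
move=> ps_uniq psP; rewrite /r_matrix /r_tens complexiE; congr (_ *: _).
have psE : [set alpha | positive_root (Z :: b) alpha] = [set` ps].
  by apply/seteqP; split=> alpha; rewrite /= psP.
by rewrite psE (fsbig_seq _ _ ps_uniq).
Qed.

Lemma coisotropic_poisson_lie :
  coisotropic B (Z :: b) X (k_ nu X gam phi) /\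
  (poisson_lie B (Z :: b) X (k_ nu X gam phi) <->
     exists m : int, phi = (2 * m + 1)%:~R).
Proof.
have [ps [ps_uniq psP]] := positive_seq.
rewrite /coisotropic /poisson_lie /delta_r (r_matrixE ps_uniq psP) real_formE k_E.
have GD := expD cs star_A G_sum.
have GZ := expZ cs star_A G_sum.
have G_lie := exp_lie cs star_A eD G_sum.
have G_form := exp_form cs star_A e0 eD G_sum.
have G_star := exp_star cs star_A eJ G_sum.
split=> [Y|].
  exact: (cayley_coisotropic cs ha hm hs hZ star_Z Z_cube pos_asym pos_total
    pos_noncompact ps_uniq psP X_rootP gam_root gam_orthogonal gam_max gam_end
    (realJ _) (realJ _) cs1 c2E s2E GD GZ G_lie G_form G_star G0 G1 GN1 G2 GN2).
rewrite (cayley_poisson_lie cs ha hm hs hZ star_Z Z_cube pos_asym pos_total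
    pos_noncompact ps_uniq psP X_rootP gam_root gam_orthogonal gam_max gam_end
    (realJ _) (realJ _) cs1 c2E s2E GD GZ G_lie G_form G_star G0 G1 GN1 G2 GN2 gam_gt0).
rewrite /s2; split=> [/eqP|[m phiE]].
  (* The equation pi (phi - 1) / 2 = m pi says that phi = 2 m + 1. *)
  rewrite fmorph_eq0 => /eqP/sin_eq0_int[m thetaE]; exists m.
  have pi0 : pi != 0 :> R by rewrite gt_eqF ?pi_gt0.
  apply: (mulfI pi0); move: thetaE; rewrite /theta intrD intrM /= => E.
  by lra.
suff /sin_eq0_int -> : exists m : int, theta *+ 2 = m%:~R * pi by rewrite rmorph0.
by exists m; rewrite /theta phiE intrD intrM /=; lra.
Qed.

End Rotation.
End Main.

Theorem corollary3p13 (R : realType) (u : lieAlgType R)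
  (u_simple : compact_simple u)
  (B : {symmetric (cplx u)})
  (B_invariant : invariant_form B) (B_normalized : normalized_form B)
  (nu : 'End(u)) (nu_involution : lie_involution nu)
  (nu_hermitian : \dim (lie_center (fixedSpace nu)) = 1%N)
  (Z : u) (Z_center : Z \in lie_center (fixedSpace nu))
  (Z_complex : forall x : u, nu x = - x -> lie Z (lie Z x) = - x)
  (t : {vspace u}) (t_cartan : cartan_subalgebra t)
  (t_center : (lie_center (fixedSpace nu) <= t)%VS)
  (b : seq u) (b_basis : basis_of t (Z :: b))
  (X : dual (cplx_vspace t) -> cplx u)
  (X_root : root_vectors B (Z :: b) X)
  (gam : seq (dual (cplx_vspace t)))
  (gam_cascade : cascade nu B (Z :: b) X gam)
  (phi : R) :
  coisotropic B (Z :: b) X (k_ nu X gam phi) /\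
  (poisson_lie B (Z :: b) X (k_ nu X gam phi) <->
     exists m : int, phi = (2 * m + 1)%:~R).
Proof. exact: coisotropic_poisson_lie. Qed.
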